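(* Let $\Delta,c_1,c_2,c_3>0$ with $\frac{c_2}{c_1}\Delta^2\le5/3$, and let $\nu$ be the measure supported in $[-\Delta,\Delta]$ given by $d\nu(\alpha)=c_1\boldsymbol\delta(\alpha)+c_2|\alpha|e^{-c_3|\alpha|}d\alpha$. Let $\eta_1,\eta_2$ be roots of $c_1\eta^4+2(c_2-c_1c_3^2)\eta^2+c_3^2(2c_2+c_1c_3^2)=0$ with $\eta_1+\eta_2\ne0$. Then $$\begin{aligned}K_\nu(0,0)=&\frac{2}{A(\eta_1)B(\eta_2)-B(\eta_1)A(\eta_2)}\left(\frac1{c_1}-\frac{A(0)c_3^2}{2c_2+c_3^2c_1}\right)\left(\frac{\sinh\frac{\Delta\eta_1}{2}}{\eta_1}B(\eta_2)-\frac{\sinh\frac{\Delta\eta_2}{2}}{\eta_2}B(\eta_1)\right)\\&+\frac{2}{A(\eta_1)B(\eta_2)-B(\eta_1)A(\eta_2)}\left(\frac{c_3^2}{c_1}+\frac{B(0)c_3^2}{2c_2+c_3^2c_1}\right)\left(\frac{\sinh\frac{\Delta\eta_1}{2}}{\eta_1}A(\eta_2)-\frac{\sinh\frac{\Delta\eta_2}{2}}{\eta_2}A(\eta_1)\right)\\&+\frac{\Delta c_3^2}{2c_2+c_3^2c_1},\end{aligned}$$ where the expression is interpreted as a limit whenever $\eta_1=\eta_2$.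
   Context: For $\eta\in\mathbb C$: $A(\eta)=1+\frac{c_2}{c_1}\int_{-\Delta/2}^{\Delta/2}\cosh(\eta\alpha)|\alpha|e^{-c_3|\alpha|}d\alpha$ and $B(\eta)=\eta^2+2\frac{c_2}{c_1}-c_3^2+2\frac{c_2c_3}{c_1}\int_{-\Delta/2}^{\Delta/2}\cosh(\eta\alpha)e^{-c_3|\alpha|}d\alpha$. $\boldsymbol\delta$ is the Dirac mass at 0; $\widehat\nu(x)=\int e^{-2\pi ix\alpha}d\nu(\alpha)$. $\mathcal H_\nu$ is the space of entire functions $f$ of exponential type at most $\pi\Delta$ (i.e. $|f(z)|\le C_\varepsilon e^{(\pi\Delta+\varepsilon)|z|}$ for each $\varepsilon>0$) with $\|f\|_\nu^2=\int_{\mathbb R}|f|^2\widehat\nu\,dx<\infty$ and inner product $\int f\bar g\widehat\nu\,dx$; under the hypotheses it is a reproducing kernel Hilbert space, with reproducing kernel $K_\nu$: $K_\nu(w,\cdot)\in\mathcal H_\nu$ and $f(w)=\langle f,K_\nu(w,\cdot)\rangle$.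
   Formalization: The last term of B(η) is taken with a minus sign, −2(c2c3/c1)∫cosh(ηα)e^{−c3|α|}dα, since with the printed plus the formula fails already at order Δ⁴ for small Δ; η1, η2 are roots counted with multiplicity, so η1=η2 means a double root. *)

(* Defs.v *)
From HB Require Import structures.
From mathcomp Require Import all_boot all_order all_algebra.
From mathcomp Require Import complex.
From mathcomp Require Import all_classical all_reals all_analysis.

Set Implicit Arguments.
Unset Strict Implicit.
Unset Printing Implicit Defensive.

Import Order.TTheory GRing.Theory Num.Theory.
Import numFieldNormedType.Exports.

Local Open Scope classical_set_scope.
Local Open Scope ring_scope.
Local Open Scope complex_scope.

Section ComplexFunctions.
Variable R : realType.
Implicit Types z : R[i].

Definition cexp z : R[i] :=
  (expR (complex.Re z))%:C * (cos (complex.Im z) +i* sin (complex.Im z)).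

Definition ccosh z : R[i] := (cexp z + cexp (- z)) / 2.

Definition csinh z : R[i] := (cexp z - cexp (- z)) / 2.

Definition entire (f : R[i] -> R[i]) : Prop :=
  forall z, derivable (f : R[i]^o -> R[i]^o) z 1.

(* [`|z|] is valued in R[i], where [u <= v] means that [v - u] is real and
   nonnegative. *)
Definition exp_type_le (tau : R) (f : R[i] -> R[i]) : Prop :=
  forall eps : R, 0 < eps -> exists C : R, forall z,
    `|f z| <= (C * expR ((tau + eps) * complex.Re `|z|))%:C.

End ComplexFunctions.

Section ComplexIntegral.
Context d (T : measurableType d) (R : realType).
Variables (mu : {measure set T -> \bar R}) (D : set T).
Implicit Type f : T -> R[i].

Definition cintegrable f : Prop :=
  mu.-integrable D (fun x => (complex.Re (f x))%:E) /\
  mu.-integrable D (fun x => (complex.Im (f x))%:E).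

Definition cintegral f : R[i] :=
  (\int[mu]_(x in D) complex.Re (f x))%R
    +i* (\int[mu]_(x in D) complex.Im (f x))%R.

End ComplexIntegral.

Section HilbertSpace.
Variable R : realType.
Local Notation leb := (@lebesgue_measure R).

Definition is_dirac_plus_density (Delta c1 c2 c3 : R)
    (nu : {measure set (measurableTypeR R) -> \bar R}) : Prop :=
  forall A : set (measurableTypeR R), measurable A ->
    nu A = (c1%:E * \d_(0%R : R) A
      + \int[leb]_(x in A `&` `[(- Delta)%R, Delta])
          (c2 * `|x| * expR (- c3 * `|x|))%:E)%E.

Variables (nu : {measure set (measurableTypeR R) -> \bar R}) (Delta : R).
Implicit Types f g : R[i] -> R[i].

Definition fourier (x : R) : R[i] :=
  cintegral nu setT (fun alpha => cexp (0 +i* (- (2 * pi * x * alpha)))).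

Definition inner f g : R[i] :=
  cintegral leb setT (fun x => f x%:C * (g x%:C)^* * fourier x).

Definition Hspace : set (R[i] -> R[i]) :=
  [set f | [/\ entire f, exp_type_le (pi * Delta) f &
     cintegrable leb setT (fun x => `|f x%:C| ^+ 2 * fourier x)]].

Definition reproducing_kernel (K : R[i] -> R[i] -> R[i]) : Prop :=
  (forall w, Hspace (K w)) /\
  (forall f w, Hspace f -> f w = inner f (K w)).

End HilbertSpace.

Section ClosedForm.
Variables (R : realType) (Delta c1 c2 c3 : R).
Implicit Type eta : R[i].
Local Notation leb := (@lebesgue_measure R).
Local Notation I := (`[- (Delta / 2), Delta / 2]%classic).

Definition quartic : {poly R[i]} :=
  c1%:C *: 'X^4 + (2 * (c2 - c1 * c3 ^+ 2))%:C *: 'X^2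
    + ((c3 ^+ 2 * (2 * c2 + c1 * c3 ^+ 2))%:C)%:P.

Definition Afun eta : R[i] :=
  1 + (c2 / c1)%:C * cintegral leb I
    (fun alpha => ccosh (eta * alpha%:C) *
                  (`|alpha| * expR (- c3 * `|alpha|))%:C).

(* If T phi = c1 phi + c2 (k * phi) on [- Delta / 2, Delta / 2], where
   k(x) = |x| exp (- c3 |x|), and phi = cosh (eta x), then
   T phi (0) = c1 A(eta) and (T phi)''(0) = c1 (B(eta) + c3 ^ 2 A(eta)).  Since
   k'' = 2 delta_0 + (c3 ^ 2 |x| - 2 c3) exp (- c3 |x|), the integral below
   enters with a minus sign; with a plus sign the formula for K(0, 0) fails. *)
Definition Bfun eta : R[i] :=
  eta ^+ 2 + (2 * (c2 / c1) - c3 ^+ 2)%:C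
  - (2 * (c2 * c3 / c1))%:C * cintegral leb I
      (fun alpha => ccosh (eta * alpha%:C) * (expR (- c3 * `|alpha|))%:C).

Definition detAB eta1 eta2 : R[i] :=
  Afun eta1 * Bfun eta2 - Bfun eta1 * Afun eta2.

Definition shc eta : R[i] := csinh (Delta%:C * eta / 2) / eta.

Definition kernel_formula eta1 eta2 : R[i] :=
  let q : R[i] := (2 * c2 + c3 ^+ 2 * c1)%:C in
  2 / detAB eta1 eta2 * (c1%:C^-1 - Afun 0 * (c3 ^+ 2)%:C / q)
    * (shc eta1 * Bfun eta2 - shc eta2 * Bfun eta1)
  + 2 / detAB eta1 eta2 * ((c3 ^+ 2 / c1)%:C + Bfun 0 * (c3 ^+ 2)%:C / q)
    * (shc eta1 * Afun eta2 - shc eta2 * Afun eta1)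
  + (Delta * c3 ^+ 2)%:C / q.

End ClosedForm.

(* Main.v *)
(* Let h = Delta / 2 and let T phi = c1 phi + c2 (k * phi) on [- h, h], where
   k(x) = |x| exp (- c3 |x|); thus nu^ is the transform of the convolution
   kernel, extended to [- Delta, Delta].  The smallness of c2 Delta^2 / c1 makes
   T injective by a Schur test.  For a root eta of the quartic, T maps
   cosh (eta x) into the span of cosh (c3 x) and x sinh (c3 x), with coordinates
   given by A(eta) and B(eta), and T 1 is a constant plus an element of the same
   span.  Hence the determinant is nonzero and some explicit combination phi of
   1, cosh (eta1 x), cosh (eta2 x) solves T phi = 1; at a double root
   x sinh (eta x) replaces the second cosh.  The closed form is the integral of
   phi, so it remains to see that F, the Fourier transform of phi, represents
   evaluation at 0, i.e. that f(0) is the integral of f F nu^ for every f in the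
   space.  On the real line T phi = 1 gives
     F nu^ = sin (pi Delta x) / (pi x) + J(x) + J(- x),
   where J is analytic in the closed lower half plane and
   |J(z)| <= C exp (pi Delta Im z) / |z| there.  Splitting the sine accordingly,
   f times the first half has exponential type 0 on the negative imaginary axis,
   so, after subtracting its pole f(0) / (2 pi z) at 0 by means of
   f(0) / (2 pi z (z - i)), its integral over R vanishes by rotating the contour
   to that axis; the same applies to f(- x).  The rotation needs only Goursat's
   theorem on triangles, after the substitution z = u^2 and a damping factor
   exp (- s (1 - 2 i) u^3).  Finally K(0, 0) = F(0) because K_0 is reproducing,
   F lies in the space, and evaluation at 0 of conj K_0(conj z) gives
   conj K(0, 0) = K(0, 0). *)

Require Import Defs.
From HB Require Import structures.
From mathcomp Require Import all_boot all_order all_algebra.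
From mathcomp Require Import complex.
From mathcomp Require Import all_classical all_reals all_analysis.
From mathcomp Require Import measurable_realfun ring lra.

Set Implicit Arguments.
Unset Strict Implicit.
Unset Printing Implicit Defensive.

Import Order.TTheory GRing.Theory Num.Theory.
Import numFieldNormedType.Exports.

Local Open Scope classical_set_scope.
Local Open Scope ring_scope.
Local Open Scope complex_scope.

(** * Complex limits and integrals *)

(** Two obstacles shape the contour argument. Inside a quadrant only a bound exp (B |z|) is known,
    without decay on far arcs, so the damping must have order above 1 in z, yet below 2, the
    critical order of a quadrant. The power z^(3/2) fits, and z = u^2 makes it the polynomial u^3,
    with no branch to choose. At the origin the integrand is only known to be continuous, which
    suffices because dz = 2 u du vanishes there. No residue theorem is involved: the terms
    subtracted for f(x) and f(- x) add up to f(0) / pi times 1 / (1 + x^2), and the known integral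
    of this weight returns f(0). The limit at a double root runs over pairs of distinct points near
    the diagonal, so derivatives in eta have to be strict. The closed form is a ratio of expressions
    alternating in the two triples (A, B, sinh (Delta eta / 2) / eta), so the second triple may be
    replaced by a difference quotient before passing to the limit. *)

Section ComplexBasics.
Variable R : realType.
Local Notation C := R[i].
Local Notation Re := complex.Re.
Local Notation Im := complex.Im.
Implicit Types z w : C.

(** The norm of [R[i]] is valued in [R[i]]; a modulus valued in [R] keeps estimates in a totally
    ordered field, where [lra] and real limits apply. *)
Definition cnorm z : R := ComplexField.Normc.normc z.

Lemma cnormE z : `|z| = (cnorm z)%:C. Proof. by []. Qed.

Lemma cnorm_ge0 z : 0 <= cnorm z.
Proof. by case: z => a b; rewrite /cnorm /= sqrtr_ge0. Qed.

Lemma cnormD z w : cnorm (z + w) <= cnorm z + cnorm w.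
Proof. exact: (@le_normcD R z w). Qed.

Lemma cnormN z : cnorm (- z) = cnorm z.
Proof. exact: (@normcN R z). Qed.

Lemma cnormB z w : cnorm (z - w) <= cnorm z + cnorm w.
Proof. by rewrite (le_trans (cnormD _ _))// cnormN. Qed.

Lemma cnormBC z w : cnorm (z - w) = cnorm (w - z).
Proof. by rewrite -cnormN opprB. Qed.

Lemma cnormM z w : cnorm (z * w) = cnorm z * cnorm w.
Proof. exact: (@ComplexField.Normc.normcM R z w). Qed.

Lemma cnormV z : cnorm z^-1 = (cnorm z)^-1.
Proof. exact: (@ComplexField.Normc.normcV R z). Qed.

Lemma cnorm0 : cnorm 0 = 0.
Proof. exact: (@ComplexField.Normc.normc0 R). Qed.

Lemma cnorm_eq0 z : (cnorm z == 0) = (z == 0).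
Proof.
apply/eqP/eqP => [|->]; last exact: cnorm0.
exact: (@ComplexField.Normc.eq0_normc R z).
Qed.

Lemma cnorm_gt0 z : (0 < cnorm z) = (z != 0).
Proof. by rewrite lt_def cnorm_eq0 cnorm_ge0 andbT. Qed.

Lemma cnormR (x : R) : cnorm x%:C = `|x|.
Proof. by rewrite /cnorm /= expr0n/= addr0 sqrtr_sqr. Qed.

Lemma real_complex_eq0 (x : R) : (x%:C == 0 :> C) = (x == 0).
Proof. by rewrite -(rmorph0 (real_complex R)) (inj_eq (@complexI R)). Qed.

Lemma cnormX z n : cnorm (z ^+ n) = cnorm z ^+ n.
Proof.
elim: n => [|n ih]; first by rewrite !expr0 (cnormR 1) normr1.
by rewrite !exprS cnormM ih.
Qed.

Lemma cnorm_sqr z : cnorm z ^+ 2 = Re z ^+ 2 + Im z ^+ 2.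
Proof. by case: z => a b; rewrite /cnorm /= sqr_sqrtr// addr_ge0// sqr_ge0. Qed.

Lemma normRe_le z : `|Re z| <= cnorm z.
Proof.
by rewrite -(ler_pXn2r (n := 2))// ?nnegrE// ?cnorm_ge0// cnorm_sqr real_normK ?num_real// lerDl sqr_ge0.
Qed.

Lemma normIm_le z : `|Im z| <= cnorm z.
Proof.
by rewrite -(ler_pXn2r (n := 2))// ?nnegrE// ?cnorm_ge0// cnorm_sqr real_normK ?num_real// lerDr sqr_ge0.
Qed.

Lemma cnorm_le_ReIm z : cnorm z <= `|Re z| + `|Im z|.
Proof.
rewrite -(ler_pXn2r (n := 2))// ?nnegrE ?cnorm_ge0// ?addr_ge0//.
rewrite cnorm_sqr sqrrD !real_normK ?num_real// -addrA lerD2l lerDr.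
by rewrite mulrn_wge0// mulr_ge0.
Qed.

Lemma ReD z w : Re (z + w) = Re z + Re w. Proof. by case: z; case: w. Qed.
Lemma ImD z w : Im (z + w) = Im z + Im w. Proof. by case: z; case: w. Qed.
Lemma ReN z : Re (- z) = - Re z. Proof. by case: z. Qed.
Lemma ImN z : Im (- z) = - Im z. Proof. by case: z. Qed.
Lemma ReM z w : Re (z * w) = Re z * Re w - Im z * Im w.
Proof. by case: z; case: w. Qed.
Lemma ImM z w : Im (z * w) = Re z * Im w + Im z * Re w.
Proof. by case: z; case: w. Qed.
Lemma ReB z w : Re (z - w) = Re z - Re w. Proof. by rewrite ReD ReN. Qed.
Lemma ImB z w : Im (z - w) = Im z - Im w. Proof. by rewrite ImD ImN. Qed.

Definition ReImE := (ReB, ImB, ReD, ImD, ReN, ImN, ReM, ImM).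

Lemma complexP z w : Re z = Re w -> Im z = Im w -> z = w.
Proof. by case: z w => [a b] [c d] /= -> ->. Qed.

Lemma ReV z : Re z^-1 = Re z / (Re z ^+ 2 + Im z ^+ 2).
Proof. by case: z. Qed.

Lemma ImV z : Im z^-1 = - Im z / (Re z ^+ 2 + Im z ^+ 2).
Proof. by case: z => a b /=; rewrite mulNr. Qed.

Lemma sumsq_neq0 z : z != 0 -> Re z ^+ 2 + Im z ^+ 2 != 0.
Proof. by move=> z0; rewrite -cnorm_sqr expf_neq0// cnorm_eq0. Qed.

Lemma cexpD z w : cexp (z + w) = cexp z * cexp w.
Proof.
case: z w => [a b] [c d]; rewrite /cexp /= expRD cosD sinD.
by apply: complexP; rewrite !ReImE /=; ring.
Qed.

Lemma cexp0 : cexp (0 : C) = 1.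
Proof. by rewrite /cexp /= expR0 cos0 sin0 mul1r. Qed.

Lemma cnorm_cexp z : cnorm (cexp z) = expR (Re z).
Proof.
rewrite /cexp cnormM cnormR ger0_norm ?expR_ge0//.
by rewrite /cnorm /= cos2Dsin2 sqrtr1 mulr1.
Qed.

Lemma cexp_neq0 z : cexp z != 0.
Proof. by rewrite -cnorm_eq0 cnorm_cexp gt_eqF// expR_gt0. Qed.

Lemma cexpN z : cexp (- z) = (cexp z)^-1.
Proof.
apply: (mulfI (cexp_neq0 z)); rewrite -cexpD subrr cexp0 divff//.
exact: cexp_neq0.
Qed.

Lemma cexpB z w : cexp (z - w) = cexp z / cexp w.
Proof. by rewrite cexpD cexpN. Qed.

Lemma cexpR (x : R) : cexp x%:C = (expR x)%:C.
Proof. by rewrite /cexp /= cos0 sin0 mulr1. Qed.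

Section Tends.
Context {T : Type}.
Implicit Types (F : set_system T) (f g : T -> C).

(** Convergence is tested on real and imaginary parts, so that real limit theorems and real
    integrals apply; [cvg_ctends] identifies it with convergence in [R[i]^o]. *)
Definition ctends F f z :=
  Re (f x) @[x --> F] --> Re z /\ Im (f x) @[x --> F] --> Im z.

Lemma ctends_cst F {FF : Filter F} z : ctends F (fun=> z) z.
Proof. by split; exact: cvg_cst. Qed.

Lemma ctendsD F {FF : Filter F} f g z w : ctends F f z -> ctends F g w ->
  ctends F (fun x => f x + g x) (z + w).
Proof.
move=> [a b] [c d]; split; rewrite !ReImE; under eq_fun do rewrite !ReImE;
  exact: cvgD.
Qed.

Lemma ctendsN F {FF : Filter F} f z : ctends F f z ->
  ctends F (fun x => - f x) (- z).
Proof.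
move=> [a b]; split; rewrite !ReImE; under eq_fun do rewrite !ReImE;
  exact: cvgN.
Qed.

Lemma ctendsB F {FF : Filter F} f g z w : ctends F f z -> ctends F g w ->
  ctends F (fun x => f x - g x) (z - w).
Proof. by move=> a b; apply: ctendsD => //; exact: ctendsN. Qed.

Lemma ctendsM F {FF : Filter F} f g z w : ctends F f z -> ctends F g w ->
  ctends F (fun x => f x * g x) (z * w).
Proof.
move=> [a b] [c d]; split; rewrite !ReImE; under eq_fun do rewrite !ReImE;
  [apply: cvgB|apply: cvgD]; exact: cvgM.
Qed.

Lemma ctendsV F {FF : Filter F} f z : z != 0 -> ctends F f z ->
  ctends F (fun x => (f x)^-1) z^-1.
Proof.
move=> z0 [a b].
have c : Re (f x) ^+ 2 + Im (f x) ^+ 2 @[x --> F] --> Re z ^+ 2 + Im z ^+ 2.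
  by apply: cvgD; rewrite expr2; under eq_fun do rewrite expr2; exact: cvgM.
split; rewrite ?ReV ?ImV; under eq_fun do rewrite ?ReV ?ImV.
  by apply: cvgM => //; apply: cvgV => //; exact: sumsq_neq0.
by apply: cvgM; [exact: cvgN|apply: cvgV => //; exact: sumsq_neq0].
Qed.

Lemma ctends_cnorm F {FF : Filter F} f z : ctends F f z ->
  cnorm (f x) @[x --> F] --> cnorm z.
Proof.
move=> [a b]; rewrite /cnorm.
have -> : ComplexField.Normc.normc z = Num.sqrt (Re z ^+ 2 + Im z ^+ 2).
  by case: z {a b}.
rewrite (_ : (fun x => _) = fun x => Num.sqrt (Re (f x) ^+ 2 + Im (f x) ^+ 2)); last first.
  by apply/funext => x; case: (f x).
apply: continuous_cvg; first exact: sqrt_continuous.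
by apply: cvgD; rewrite expr2; under eq_fun do rewrite expr2; exact: cvgM.
Qed.

Lemma ctends0 F {FF : Filter F} f :
  cnorm (f x) @[x --> F] --> 0 -> ctends F f 0.
Proof.
move=> f0; split; apply: norm_cvg0.
  apply: (@squeeze_cvgr _ _ _ _ (fun=> 0) (fun x => cnorm (f x))) => //.
    by near=> x; rewrite normr_ge0 normRe_le.
  exact: cvg_cst.
apply: (@squeeze_cvgr _ _ _ _ (fun=> 0) (fun x => cnorm (f x))) => //.
  by near=> x; rewrite normr_ge0 normIm_le.
exact: cvg_cst.
Unshelve. all: by end_near. Qed.

Lemma ctendsR F {FF : Filter F} (f : T -> R) (l : R) : f x @[x --> F] --> l ->
  ctends F (fun x => (f x)%:C) l%:C.
Proof. by move=> h; split => //=; exact: cvg_cst. Qed.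

Lemma ctends_near F {FF : Filter F} f g z : (\forall x \near F, f x = g x) ->
  ctends F f z -> ctends F g z.
Proof.
move=> fg [a b]; split.
  apply: cvg_trans a; apply: near_eq_cvg.
  by apply: filterS fg => x ->.
apply: cvg_trans b; apply: near_eq_cvg.
by apply: filterS fg => x ->.
Qed.

End Tends.

Definition cpoint (p : R * R) : C := p.1 +i* p.2.

(** The neighbourhoods are those of [R * R], carried over by [cpoint]; [ccontP] and [ccontI] give
    the usual epsilon-delta form. *)
Definition ccont (f : C -> C) z :=
  ctends (nbhs (Re z, Im z)) (f \o cpoint) (f z).

Lemma ctends_comp T (F : set_system T) {FF : Filter F} (f : C -> C) (g : T -> C) z :
  ccont f z -> ctends F g z -> ctends F (fun x => f (g x)) (f z).
Proof.
move=> [a b] [c d].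
have h : (Re (g x), Im (g x)) @[x --> F] --> (Re z, Im z) by exact: (cvg_pair c d).
have e : forall x, f (g x) = (f \o cpoint) (Re (g x), Im (g x)).
  by move=> x /=; rewrite /cpoint; case: (g x).
split; under eq_fun do rewrite e.
  exact: (cvg_comp _ _ h a).
exact: (cvg_comp _ _ h b).
Qed.

Lemma ctends_cpoint z : ctends (nbhs (Re z, Im z)) cpoint z.
Proof. by split; [exact: cvg_fst|exact: cvg_snd]. Qed.

Lemma ccontP (f : C -> C) z : ccont f z -> forall e : R, 0 < e ->
  exists2 d : R, 0 < d & forall w, cnorm (w - z) < d -> cnorm (f w - f z) < e.
Proof.
move=> cf e e0.
have /ctends_cnorm : ctends (nbhs (Re z, Im z)) (fun p => f (cpoint p) - f z) 0.
  rewrite -(subrr (f z)); apply: ctendsB; [exact: cf|exact: ctends_cst].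
rewrite cnorm0 => /cvgrPdist_lt /(_ e e0) /nbhs_ballP[d /= d0 H].
exists d => // w wd.
have : ball (Re z, Im z) d (Re w, Im w).
  split; rewrite /ball /=; apply: le_lt_trans wd.
    by rewrite -ReB cnormBC normRe_le.
  by rewrite -ImB cnormBC normIm_le.
move=> /H /=; rewrite sub0r normrN ger0_norm ?cnorm_ge0//.
by rewrite /cpoint/=; case: w {wd}.
Qed.

Lemma ccontI (f : C -> C) z :
  (forall e : R, 0 < e -> exists2 d : R, 0 < d &
    forall w, cnorm (w - z) < d -> cnorm (f w - f z) <= e) -> ccont f z.
Proof.
move=> H.
have : ctends (nbhs (Re z, Im z)) (fun p => f (cpoint p) - f z) 0.
  apply: ctends0; apply/cvgrPdist_le => e e0.
  have [d d0 Hd] := H e e0.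
  apply/nbhs_ballP; exists (d / 2) => /=; first by rewrite divr_gt0.
  move=> [a b] [/=]; rewrite /ball /= => h1 h2.
  rewrite sub0r normrN ger0_norm ?cnorm_ge0//; apply: Hd.
  apply: le_lt_trans (cnorm_le_ReIm _) _; rewrite ReB ImB /cpoint /=.
  by rewrite distrC (distrC b) [d]splitr ltrD.
move=> h; rewrite /ccont -[f z]add0r.
have -> : f \o cpoint = fun p => (f (cpoint p) - f z) + f z.
  by apply/funext => p /=; rewrite subrK.
by apply: ctendsD => //; exact: ctends_cst.
Qed.

Lemma ccont_cst c z : ccont (fun=> c) z.
Proof. exact: ctends_cst. Qed.
Lemma ccont_id z : ccont id z.
Proof. exact: ctends_cpoint. Qed.
Lemma ccontD (f g : C -> C) z : ccont f z -> ccont g z -> ccont (fun w => f w + g w) z.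
Proof. exact: ctendsD. Qed.
Lemma ccontN (f : C -> C) z : ccont f z -> ccont (fun w => - f w) z.
Proof. exact: ctendsN. Qed.
Lemma ccontB (f g : C -> C) z : ccont f z -> ccont g z -> ccont (fun w => f w - g w) z.
Proof. exact: ctendsB. Qed.
Lemma ccontM (f g : C -> C) z : ccont f z -> ccont g z -> ccont (fun w => f w * g w) z.
Proof. exact: ctendsM. Qed.
Lemma ccontV (f : C -> C) z : f z != 0 -> ccont f z -> ccont (fun w => (f w)^-1) z.
Proof. exact: ctendsV. Qed.
Lemma ccont_comp (f g : C -> C) z : ccont f (g z) -> ccont g z ->
  ccont (fun w => f (g w)) z.
Proof. by move=> a b; exact: (ctends_comp a b). Qed.

Lemma ccont_cexp z : ccont (@cexp R) z.
Proof.
rewrite /ccont /cexp; apply: ctendsM.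
  apply: ctendsR; apply: continuous_cvg; first exact: continuous_expR.
  exact: cvg_fst.
split => /=.
  by apply: continuous_cvg; [exact: continuous_cos|exact: cvg_snd].
by apply: continuous_cvg; [exact: continuous_sin|exact: cvg_snd].
Qed.

Lemma ccont_conj z : ccont (fun w => w^*%C) z.
Proof.
split => /=; first by case: z => a b; exact: cvg_fst.
by case: z => a b /=; apply: cvgN; exact: cvg_snd.
Qed.

End ComplexBasics.

Section ComplexIntegrals.
Variable R : realType.
Local Notation C := R[i].
Local Notation Re := complex.Re.
Local Notation Im := complex.Im.
Local Notation leb := (@lebesgue_measure R).

Section General.
Context d (T : measurableType d) (mu : {measure set T -> \bar R}) (D : set T).
Hypothesis mD : measurable D.
Implicit Types f g : T -> C.

Definition cmeasurable f :=
  measurable_fun D (fun x => Re (f x)) /\ measurable_fun D (fun x => Im (f x)).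

Lemma cmeasurableM f g : cmeasurable f -> cmeasurable g ->
  cmeasurable (fun x => f x * g x).
Proof.
move=> [a b] [a' b']; split; under eq_fun do rewrite !ReImE;
  [apply: measurable_funB|apply: measurable_funD]; exact: measurable_funM.
Qed.

Lemma cintegrable_cmeasurable f : cintegrable mu D f -> cmeasurable f.
Proof. by move=> [/integrableP[/measurable_EFinP ? _] /integrableP[/measurable_EFinP ? _]]. Qed.

Lemma cintegrable_dom f (g : T -> R) : cmeasurable f ->
  mu.-integrable D (EFin \o g) -> (forall x, D x -> cnorm (f x) <= g x) ->
  cintegrable mu D f.
Proof.
move=> [a b] ig fg; split; apply: (le_integrable mD _ _ ig).
- exact/measurable_EFinP.
- move=> x Dx /=; rewrite lee_fin (le_trans (normRe_le _))//.
  by rewrite (le_trans (fg x Dx))// ler_norm.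
- exact/measurable_EFinP.
- move=> x Dx /=; rewrite lee_fin (le_trans (normIm_le _))//.
  by rewrite (le_trans (fg x Dx))// ler_norm.
Qed.

Lemma cintegrable_cnorm f : cintegrable mu D f ->
  mu.-integrable D (fun x => (cnorm (f x))%:E).
Proof.
move=> fi; have [mR mI] := cintegrable_cmeasurable fi; case: fi => iR iI.
have i2 : mu.-integrable D (fun x => (`|Re (f x)| + `|Im (f x)|)%:E).
  under eq_fun do rewrite EFinD.
  apply: integrableD => //.
    by have := integrable_abse iR.
  by have := integrable_abse iI.
apply: (le_integrable mD _ _ i2).
  apply/measurable_EFinP.
  rewrite (_ : (fun x => _) = fun x => Num.sqrt (Re (f x) ^+ 2 + Im (f x) ^+ 2)); last first.
    by apply/funext => x; rewrite /cnorm; case: (f x).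
  have msqrt : measurable_fun [set: R] (@Num.sqrt R) by apply: continuous_measurable_fun; exact: sqrt_continuous.
  apply: (measurableT_comp msqrt).
  by apply: measurable_funD; exact: measurable_funX.
move=> x Dx /=; rewrite lee_fin ger0_norm ?cnorm_ge0//.
by rewrite ger0_norm ?addr_ge0// cnorm_le_ReIm.
Qed.

Lemma eq_cintegral f g : (forall x, D x -> f x = g x) ->
  cintegral mu D f = cintegral mu D g.
Proof.
by move=> fg; congr (_ +i* _); apply: eq_Rintegral => x /set_mem Dx; rewrite fg.
Qed.

Lemma eq_cintegrable f g : (forall x, D x -> f x = g x) ->
  cintegrable mu D f -> cintegrable mu D g.
Proof.
move=> fg [a b]; split; [move: a|move: b]; apply: eq_integrable => // x /set_mem Dx;
  by rewrite fg.
Qed.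

Lemma cintegrableD f g : cintegrable mu D f -> cintegrable mu D g ->
  cintegrable mu D (fun x => f x + g x).
Proof.
move=> [a b] [a' b']; split; under eq_fun do rewrite !ReImE EFinD;
  exact: integrableD.
Qed.

Lemma cintegrableN f : cintegrable mu D f -> cintegrable mu D (fun x => - f x).
Proof.
move=> [a b]; split; under eq_fun do rewrite !ReImE EFinN.
  exact: integrableN a.
exact: integrableN b.
Qed.

Lemma cintegrableB f g : cintegrable mu D f -> cintegrable mu D g ->
  cintegrable mu D (fun x => f x - g x).
Proof. by move=> a b; apply: cintegrableD => //; exact: cintegrableN. Qed.

Lemma cintegrableZ c f : cintegrable mu D f -> cintegrable mu D (fun x => c * f x).
Proof.
move=> [a b]; split.
- under eq_fun do rewrite !ReImE EFinB !EFinM.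
  by apply: integrableB => //; exact: integrableZl.
- under eq_fun do rewrite !ReImE EFinD !EFinM.
  by apply: integrableD => //; exact: integrableZl.
Qed.

Lemma cintegralD f g : cintegrable mu D f -> cintegrable mu D g ->
  cintegral mu D (fun x => f x + g x) = cintegral mu D f + cintegral mu D g.
Proof.
move=> [a b] [a' b']; apply: complexP; rewrite ReImE /=.
  by under eq_Rintegral do rewrite ReImE; rewrite RintegralD.
by under eq_Rintegral do rewrite ReImE; rewrite RintegralD.
Qed.

Lemma cintegralZ c f : cintegrable mu D f ->
  cintegral mu D (fun x => c * f x) = c * cintegral mu D f.
Proof.
move=> [a b].
have iZ r (h : T -> R) : mu.-integrable D (fun x => (h x)%:E) ->
    mu.-integrable D (EFin \o (fun x => r * h x)).
  by move=> ih; apply: eq_integrable (integrableZl mD r ih).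
apply: complexP; rewrite ReImE /=; under eq_Rintegral do rewrite ReImE.
  by rewrite RintegralB ?RintegralZl//; exact: iZ.
by rewrite RintegralD ?RintegralZl//; exact: iZ.
Qed.

Lemma cintegralN f : cintegrable mu D f ->
  cintegral mu D (fun x => - f x) = - cintegral mu D f.
Proof.
move=> fi; rewrite -mulN1r -cintegralZ//.
by apply: eq_cintegral => x _; rewrite mulN1r.
Qed.

Lemma cintegralB f g : cintegrable mu D f -> cintegrable mu D g ->
  cintegral mu D (fun x => f x - g x) = cintegral mu D f - cintegral mu D g.
Proof.
move=> a b; rewrite cintegralD//; last exact: cintegrableN.
by rewrite cintegralN.
Qed.

Lemma cintegralE f : cintegral mu D f =
  (\int[mu]_(x in D) Re (f x))%R +i* (\int[mu]_(x in D) Im (f x))%R.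
Proof. by []. Qed.

(** The factor 2 comes from bounding real and imaginary parts separately; only orders of magnitude
    matter where the bound is applied. *)
Lemma cnorm_cintegral_le f (g : T -> R) : cintegrable mu D f ->
  mu.-integrable D (EFin \o g) -> (forall x, D x -> cnorm (f x) <= g x) ->
  cnorm (cintegral mu D f) <= 2 * (\int[mu]_(x in D) g x)%R.
Proof.
move=> [a b] ig fg; apply: le_trans (cnorm_le_ReIm _) _.
rewrite mulr_natl mulr2n; apply: lerD.
- apply: le_trans (le_normr_Rintegral mD a) _; apply: le_Rintegral => //.
    by have := integrable_abse a.
  by move=> x Dx; rewrite (le_trans (normRe_le _))// fg.
- apply: le_trans (le_normr_Rintegral mD b) _; apply: le_Rintegral => //.
    by have := integrable_abse b.
  by move=> x Dx; rewrite (le_trans (normIm_le _))// fg.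
Qed.

Lemma cintegral_dct (f_ : nat -> T -> C) (f : T -> C) (g : T -> R) :
  (forall n, cmeasurable (f_ n)) -> cmeasurable f ->
  mu.-integrable D (EFin \o g) ->
  (forall n x, D x -> cnorm (f_ n x) <= g x) ->
  (forall x, D x -> ctends \oo (fun n => f_ n x) (f x)) ->
  ctends \oo (fun n => cintegral mu D (f_ n)) (cintegral mu D f).
Proof.
move=> mf_ mf ig fg cf.
have aux (h_ : nat -> T -> R) (h : T -> R) :
  (forall n, measurable_fun D (h_ n)) -> measurable_fun D h ->
  (forall n x, D x -> `|h_ n x| <= g x) ->
  (forall x, D x -> h_ n x @[n --> \oo] --> h x) ->
  (\int[mu]_(x in D) h_ n x)%R @[n --> \oo] --> (\int[mu]_(x in D) h x)%R.
  move=> mh_ mh hg hh.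
  have [|||||ih _ Hc] := @dominated_convergence _ _ _ mu D mD
    (fun n x => (h_ n x)%:E) (fun x => (h x)%:E) (EFin \o g).
  - by move=> n; apply/measurable_EFinP.
  - exact/measurable_EFinP.
  - by apply: aeW => x Dx; apply: cvg_EFin; [exact: nearW|exact: hh].
  - exact: ig.
  - by apply: aeW => x Dx n /=; rewrite lee_fin hg.
  rewrite /Rintegral; apply: fine_cvg.
  by rewrite fineK; [exact: Hc|exact: integrable_fin_num].
split; apply: aux.
- by move=> n; case: (mf_ n).
- by case: mf.
- by move=> n x Dx; rewrite (le_trans (normRe_le _))// fg.
- by move=> x Dx; case: (cf x Dx).
- by move=> n; case: (mf_ n).
- by case: mf.
- by move=> n x Dx; rewrite (le_trans (normIm_le _))// fg.
- by move=> x Dx; case: (cf x Dx).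
Qed.

End General.

End ComplexIntegrals.

(** * Integrals over compact intervals *)

Section IntervalIntegrals.
Variable R : realType.
Local Notation C := R[i].
Local Notation Re := complex.Re.
Local Notation Im := complex.Im.
Local Notation leb := (@lebesgue_measure R).

Lemma within_cont (a b : R) (f : R -> R) :
  (forall x, a <= x <= b -> {for x, continuous f}) -> {within `[a, b], continuous f}.
Proof.
move=> cf; apply: continuous_in_subspaceT => x.
by rewrite inE /= in_itv /= => /cf.
Qed.

Lemma cont_integrable (a b : R) (f : R -> R) :
  (forall x, a <= x <= b -> {for x, continuous f}) ->
  leb.-integrable `[a, b] (EFin \o f).
Proof.
move=> cf; apply: continuous_compact_integrable; first exact: segment_compact.
exact: within_cont.
Qed.

Lemma Rintegral_FTC (a b : R) (f F : R -> R) : a <= b ->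
  (forall x, a <= x <= b -> {for x, continuous f}) ->
  (forall x, a <= x <= b -> is_derive x 1 F (f x)) ->
  (\int[leb]_(x in `[a, b]) f x)%R = F b - F a.
Proof.
rewrite le_eqVlt => /predU1P[<- _ _|ab cf dF].
  by rewrite set_itv1 Rintegral_set1 subrr.
have cF x : a <= x <= b -> {for x, continuous F}.
  by move=> /dF [/derivable1_diffP /differentiable_continuous].
rewrite /Rintegral (@continuous_FTC2 _ _ F)//.
- exact: within_cont.
- split.
  + by move=> x; rewrite in_itv/= => /andP[ax xb]; have [] := dF x; rewrite ?ltW.
  + by apply: cvg_at_right_filter; apply: cF; rewrite lexx ltW.
  + by apply: cvg_at_left_filter; apply: cF; rewrite lexx ltW.
- move=> x; rewrite in_itv/= => /andP[ax xb].
  have xab : a <= x <= b by rewrite !ltW.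
  by rewrite derive1E; have [_ ->] := dF x xab.
Qed.

Lemma Rintegral_subst (a b : R) (F F' G : R -> R) : a <= b ->
  {in `[a, b] &, {homo F : x y / x < y}} ->
  (forall x : R, is_derive x 1 F (F' x)) -> continuous F' ->
  (forall x, F a <= x <= F b -> {for x, continuous G}) ->
  (\int[leb]_(x in `[F a, F b]) G x)%R =
  (\int[leb]_(x in `[a, b]) (G (F x) * F' x))%R.
Proof.
move=> ab incF dF cF' cG.
have eF : F^`()%classic = F' by apply/funext => x; rewrite derive1E; have [_ ->] := dF x.
have cF x : {for x, continuous F}.
  by have [/derivable1_diffP /differentiable_continuous] := dF x.
rewrite /Rintegral (@integration_by_substitution_increasing _ F)//.
- by congr fine; apply: eq_integral => x _ /=; rewrite eF.
- by rewrite eF => x _; exact: cF'.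
- by apply/cvg_ex; exists (F' a); rewrite eF; apply: cvg_at_right_filter; exact: cF'.
- by apply/cvg_ex; exists (F' b); rewrite eF; apply: cvg_at_left_filter; exact: cF'.
- split.
  + by move=> x _; have [] := dF x.
  + by apply: cvg_at_right_filter; exact: cF.
  + by apply: cvg_at_left_filter; exact: cF.
- exact: within_cont.
Qed.

Lemma Rintegral_split (a c b : R) (f : R -> R) : a <= c <= b ->
  leb.-integrable `[a, b] (EFin \o f) ->
  (\int[leb]_(x in `[a, b]) f x)%R =
  (\int[leb]_(x in `[a, c]) f x)%R + (\int[leb]_(x in `[c, b]) f x)%R.
Proof.
move=> /andP[ac cb] fi.
have fi' : leb.-integrable `]c, b] (EFin \o f).
  by apply: integrableS fi => //; apply: subset_itv; rewrite bnd_simp.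
rewrite -[in X in _ + X](Rintegral_itv_obnd_cbnd fi').
by rewrite -(Rintegral_itvB fi) ?bnd_simp// addrC subrK.
Qed.

Lemma Rintegral_oppr (a : R) (f : R -> R) : 0 <= a ->
  (forall x, - a <= x <= a -> {for x, continuous f}) ->
  (\int[leb]_(x in `[- a, a]) f x)%R = (\int[leb]_(x in `[- a, a]) f (- x))%R.
Proof.
move=> a0 cf; have := @integration_by_substitution_oppr R f (- a) a.
rewrite opprK => h; rewrite /Rintegral h// ?ge0_cp//.
exact: within_cont.
Qed.

Definition rcont (f : R -> C) x := ctends (nbhs x) f (f x).

Definition cint (a b : R) (f : R -> C) : C := cintegral leb `[a, b] f.

Lemma rcont_integrable (a b : R) (f : R -> C) :
  (forall x, a <= x <= b -> rcont f x) -> cintegrable leb `[a, b] f.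
Proof.
by move=> cf; split; apply: cont_integrable => x /cf [].
Qed.

Definition rder (F : R -> C) (x : R) (d : C) :=
  is_derive x 1 (fun x => Re (F x)) (Re d) /\ is_derive x 1 (fun x => Im (F x)) (Im d).

Lemma cint_FTC (a b : R) (f F : R -> C) : a <= b ->
  (forall x, a <= x <= b -> rcont f x) ->
  (forall x, a <= x <= b -> rder F x (f x)) -> cint a b f = F b - F a.
Proof.
move=> ab cf dF; apply: complexP; rewrite ReImE /=.
  apply: (Rintegral_FTC (F := fun x => Re (F x))) => // x xab.
    by have [] := cf x xab.
  by have [] := dF x xab.
apply: (Rintegral_FTC (F := fun x => Im (F x))) => // x xab.
  by have [] := cf x xab.
by have [] := dF x xab.
Qed.

Lemma cint_subst (a b : R) (F F' : R -> R) (G : R -> C) : a <= b ->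
  {in `[a, b] &, {homo F : x y / x < y}} ->
  (forall x : R, is_derive x 1 F (F' x)) -> continuous F' ->
  (forall x, F a <= x <= F b -> rcont G x) ->
  cint (F a) (F b) G = cint a b (fun x => G (F x) * (F' x)%:C).
Proof.
move=> ab incF dF cF' cG; apply: complexP => /=.
  rewrite (@Rintegral_subst a b F F')//; last by move=> x /cG [].
  by apply: eq_Rintegral => x _; rewrite ReImE /= mulr0 subr0.
rewrite (@Rintegral_subst a b F F')//; last by move=> x /cG [].
by apply: eq_Rintegral => x _; rewrite ReImE /= mulr0 add0r.
Qed.

Lemma cint_split (a c b : R) (f : R -> C) : a <= c <= b ->
  cintegrable leb `[a, b] f -> cint a b f = cint a c f + cint c b f.
Proof.
by move=> acb [fR fI]; apply: complexP; rewrite ReImE /=; exact: Rintegral_split.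
Qed.

Lemma cint_oppr (a : R) (f : R -> C) : 0 <= a ->
  (forall x, - a <= x <= a -> rcont f x) ->
  cint (- a) a f = cint (- a) a (fun x => f (- x)).
Proof.
by move=> a0 cf; apply: complexP => /=; apply: Rintegral_oppr => // x /cf [].
Qed.

Lemma lebesgue_itvcc (a b : R) : a <= b -> leb `[a, b] = (b - a)%:E.
Proof. by move=> ab; rewrite lebesgue_measure_itv /= lte_fin; case: ltgtP ab => // ->; rewrite subrr. Qed.

Lemma cst_integrable_itv (a b M : R) : leb.-integrable `[a, b] (EFin \o (fun=> M)).
Proof. by apply: cont_integrable => x _; exact: cvg_cst. Qed.

Lemma cnorm_cint_le (a b M : R) (f : R -> C) : a <= b ->
  cintegrable leb `[a, b] f ->
  (forall x, a <= x <= b -> cnorm (f x) <= M) -> cnorm (cint a b f) <= 2 * (M * (b - a)).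
Proof.
move=> ab fi fM.
have fM' x : `[a, b]%classic x -> cnorm (f x) <= M by rewrite /= in_itv/=; exact: fM.
have mI : measurable (`[a, b]%classic : set (measurableTypeR R)) by [].
have := cnorm_cintegral_le mI fi (cst_integrable_itv a b M) fM'.
by rewrite Rintegral_cst//= lebesgue_itvcc.
Qed.

Lemma Rintegral_swap (a b c d M : R) (h : R * R -> R) :
  measurable_fun (setT : set (measurableTypeR R * measurableTypeR R)%type) h ->
  (forall x y, a <= x <= b -> c <= y <= d -> `|h (x, y)| <= M) ->
  (\int[leb]_(x in `[a, b]) \int[leb]_(y in `[c, d]) h (x, y))%R =
  (\int[leb]_(y in `[c, d]) \int[leb]_(x in `[a, b]) h (x, y))%R.
Proof.
move=> mh hM.
pose A := `[a, b]%classic : set (measurableTypeR R).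
pose B := `[c, d]%classic : set (measurableTypeR R).
have mA : measurable A by exact: measurable_itv.
have mB : measurable B by exact: measurable_itv.
have mAB : measurable (A `*` B) by apply: measurableX.
have fA : (leb A < +oo)%E by apply: compact_finite_measure; exact: segment_compact.
have fB : (leb B < +oo)%E by apply: compact_finite_measure; exact: segment_compact.
have i0 : (leb \x leb)%E.-integrable (A `*` B) (EFin \o h).
  apply: measurable_bounded_integrable => //.
  - apply: (@le_lt_trans _ _ (leb A * leb B)%E).
      by have := product_measure1E leb leb mA mB => /= ->.
    by rewrite lte_mul_pinfty// ge0_fin_numE.
  - exact: measurable_funTS.
  - exists M; split; first exact: num_real.
    move=> N MN [x y] [/= xA yB]; rewrite /A/B /= !in_itv/= in xA yB.
    by rewrite (le_trans (hM _ _ xA yB))// ltW.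
(* Fubini is applied on the whole plane, to [h] extended by 0 outside the rectangle. *)
have ih := (iffLR (integrable_mkcond _ mAB)) i0.
have e1 : (\int[leb]_x \int[leb]_y ((EFin \o h) \_ (A `*` B)) (x, y) =
          \int[leb]_(x in A) \int[leb]_(y in B) (h (x, y))%:E)%E.
  rewrite [RHS]integral_mkcond; apply: eq_integral => x _.
  rewrite patchE; case: ifPn => xA.
    rewrite [RHS]integral_mkcond; apply: eq_integral => y _.
    by rewrite !patchE in_setX xA.
  rewrite (eq_integral (cst 0%E)) ?integral0// => y _.
  by rewrite patchE in_setX (negbTE xA).
have e2 : (\int[leb]_y \int[leb]_x ((EFin \o h) \_ (A `*` B)) (x, y) =
          \int[leb]_(y in B) \int[leb]_(x in A) (h (x, y))%:E)%E.
  rewrite [RHS]integral_mkcond; apply: eq_integral => y _.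
  rewrite patchE; case: ifPn => yB.
    rewrite [RHS]integral_mkcond; apply: eq_integral => x _.
    by rewrite !patchE in_setX yB andbT.
  rewrite (eq_integral (cst 0%E)) ?integral0// => x _.
  by rewrite patchE in_setX (negbTE yB) andbF.
have iB x : A x -> leb.-integrable B (fun y => (h (x, y))%:E).
  move=> xA; apply: (@measurable_bounded_integrable _ _ _ leb (fun y => h (x, y)) B mB fB).
    apply: measurable_funTS; apply: measurableT_comp => //.
  exists M; split; first exact: num_real.
  move=> N MN y yB; rewrite /A/B /= !in_itv/= in xA yB.
  by rewrite /= (le_trans (hM _ _ xA yB))// ltW.
have iA y : B y -> leb.-integrable A (fun x => (h (x, y))%:E).
  move=> yB; apply: (@measurable_bounded_integrable _ _ _ leb (fun x => h (x, y)) A mA fA).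
    apply: measurable_funTS; apply: measurableT_comp => //.
  exists M; split; first exact: num_real.
  move=> N MN x xA; rewrite /A/B /= !in_itv/= in xA yB.
  by rewrite /= (le_trans (hM _ _ xA yB))// ltW.
have := Fubini ih; rewrite e1 e2 => H.
rewrite /Rintegral; congr fine.
transitivity (\int[leb]_(x in A) \int[leb]_(y in B) (h (x, y))%:E)%E.
  apply: eq_integral => x /set_mem xA; apply: fineK.
  by apply: integrable_fin_num; [exact: mB|exact: iB].
rewrite H; apply: eq_integral => y /set_mem yB; apply: esym; apply: fineK.
by apply: integrable_fin_num; [exact: mA|exact: iA].
Qed.

Lemma cint_swap (a b c d M : R) (h : R * R -> C) :
  cmeasurable (setT : set (measurableTypeR R * measurableTypeR R)%type) h ->
  (forall x y, a <= x <= b -> c <= y <= d -> cnorm (h (x, y)) <= M) ->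
  cint a b (fun x => cint c d (fun y => h (x, y))) =
  cint c d (fun y => cint a b (fun x => h (x, y))).
Proof.
move=> [mR mI] hM; apply: complexP => /=.
  apply: (@Rintegral_swap a b c d M (fun p => Re (h p))) => // x y xab ycd.
  by rewrite (le_trans (normRe_le _))// hM.
apply: (@Rintegral_swap a b c d M (fun p => Im (h p))) => // x y xab ycd.
by rewrite (le_trans (normIm_le _))// hM.
Qed.

End IntervalIntegrals.

(** * Derivatives along a real parameter *)

Section RealParameterDerivatives.
Variable R : realType.
Local Notation C := R[i].
Local Notation Re := complex.Re.
Local Notation Im := complex.Im.
Local Notation leb := (@lebesgue_measure R).
Implicit Types (F G : R -> C) (x : R).

Lemma rder_cst (c : C) x : rder (fun=> c) x 0.
Proof. by split; exact: is_derive_cst. Qed.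

Lemma rder_real (F : R -> R) (F' x : R) : is_derive x 1 F F' ->
  rder (fun y => (F y)%:C) x F'%:C.
Proof. by move=> h; split => //=; exact: is_derive_cst. Qed.

Lemma rder_id x : rder (fun y => y%:C) x 1.
Proof. exact: (rder_real (is_derive_id x 1)). Qed.

Lemma rderD F G x (d e : C) : rder F x d -> rder G x e ->
  rder (fun y => F y + G y) x (d + e).
Proof.
move=> [a b] [a' b']; split; rewrite ReImE; under eq_fun do rewrite ReImE;
  exact: is_deriveD.
Qed.

Lemma rderN F x (d : C) : rder F x d -> rder (fun y => - F y) x (- d).
Proof.
move=> [a b]; split; rewrite ReImE; under eq_fun do rewrite ReImE; exact: is_deriveN.
Qed.

Lemma rderM F G x (d e : C) : rder F x d -> rder G x e ->
  rder (fun y => F y * G y) x (d * G x + F x * e).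
Proof.
move=> [a b] [a' b']; split; under eq_fun do rewrite ReImE.
  have h := is_deriveB (is_deriveM a a') (is_deriveM b b').
  by apply: (is_derive_eq h); rewrite !ReImE /GRing.scale /=; ring.
have h := is_deriveD (is_deriveM a b') (is_deriveM b a').
by apply: (is_derive_eq h); rewrite !ReImE /GRing.scale /=; ring.
Qed.

Lemma rderZ (c : C) F x (d : C) : rder F x d -> rder (fun y => c * F y) x (c * d).
Proof.
by move=> h; have := rderM (rder_cst c x) h; rewrite mul0r add0r.
Qed.

Lemma rder_cexp (c : C) x : rder (fun y => cexp (c * y%:C)) x (c * cexp (c * x%:C)).
Proof.
case: c => a b.
have E (y : R) : cexp ((a +i* b) * y%:C) = (expR (a * y))%:C * (cos (b * y) +i* sin (b * y)).
  by rewrite /cexp !ReImE /= !mulr0 subr0 add0r.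
have dl (c : R) : is_derive x 1 (fun y => c * y) c.
  by have h := is_deriveZ c (is_derive_id x 1); apply: (is_derive_eq h); rewrite /GRing.scale /= mulr1.
have dE := is_derive1_comp (is_derive_expR (a * x)) (dl a).
have dC := is_derive1_comp (is_derive_cos (b * x)) (dl b).
have dS := is_derive1_comp (is_derive_sin (b * x)) (dl b).
split; under eq_fun do rewrite E.
- under eq_fun do rewrite !ReImE /= mul0r subr0.
  have h := is_deriveM dE dC; apply: (is_derive_eq h).
  by rewrite E !ReImE /GRing.scale /=; ring.
- under eq_fun do rewrite !ReImE /= mul0r addr0.
  have h := is_deriveM dE dS; apply: (is_derive_eq h).
  by rewrite E !ReImE /GRing.scale /=; ring.
Qed.

Lemma rder_eq F x (d e : C) : rder F x d -> d = e -> rder F x e.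
Proof. by move=> h <-. Qed.

Lemma rcont_cst (c : C) x : rcont (fun=> c) x.
Proof. exact: ctends_cst. Qed.
Lemma rcont_real (F : R -> R) x : {for x, continuous F} -> rcont (fun y => (F y)%:C) x.
Proof. exact: ctendsR. Qed.
Lemma rcont_id x : rcont (fun y => y%:C) x.
Proof. by apply: ctendsR; exact: cvg_id. Qed.
Lemma rcontD F G x : rcont F x -> rcont G x -> rcont (fun y => F y + G y) x.
Proof. exact: ctendsD. Qed.
Lemma rcontN F x : rcont F x -> rcont (fun y => - F y) x.
Proof. exact: ctendsN. Qed.
Lemma rcontB F G x : rcont F x -> rcont G x -> rcont (fun y => F y - G y) x.
Proof. exact: ctendsB. Qed.
Lemma rcontM F G x : rcont F x -> rcont G x -> rcont (fun y => F y * G y) x.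
Proof. exact: ctendsM. Qed.
Lemma rcont_comp (f : C -> C) F x : ccont f (F x) -> rcont F x -> rcont (fun y => f (F y)) x.
Proof. exact: ctends_comp. Qed.
Lemma rcont_cexp F x : rcont F x -> rcont (fun y => cexp (F y)) x.
Proof. by apply: rcont_comp; exact: ccont_cexp. Qed.

Lemma rcont_cmeasurable (f : R -> C) (D : set (measurableTypeR R)) :
  measurable D -> (forall x, rcont f x) -> cmeasurable D f.
Proof.
move=> mD cf; split; apply: measurable_funTS; apply: continuous_measurable_fun => x;
  by case: (cf x).
Qed.

End RealParameterDerivatives.

(** * Taylor remainders of the exponential *)

Section ExponentialEstimates.
Variable R : realType.
Local Notation C := R[i].
Local Notation Re := complex.Re.
Local Notation leb := (@lebesgue_measure R).
Implicit Types (z w : C).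

Lemma cnorm_cexp_le z : cnorm (cexp z) <= expR (cnorm z).
Proof. by rewrite cnorm_cexp ler_expR (le_trans (ler_norm _))// normRe_le. Qed.

Lemma rcont_cexpM (c : C) (x : R) : rcont (fun y => cexp (c * y%:C)) x.
Proof. by apply: rcont_cexp; apply: rcontM; [exact: rcont_cst|exact: rcont_id]. Qed.

Lemma cnorm_ray_le w (t : R) : 0 <= t <= 1 -> cnorm (w * t%:C) <= cnorm w.
Proof.
move=> /andP[t0 t1]; rewrite cnormM cnormR ger0_norm//.
by rewrite ler_piMr// cnorm_ge0.
Qed.

(** Each Taylor remainder is the integral of [w] times the preceding one along the ray from 0 to
    [w]; [cexp_sub1l_le] and [cexp_sub2_le] repeat the step. *)
Lemma cexp_sub1_le w : cnorm (cexp w - 1) <= 2 * cnorm w * expR (cnorm w).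
Proof.
have -> : cexp w - 1 = cint 0 1 (fun t => w * cexp (w * t%:C)).
  rewrite (@cint_FTC _ 0 1 _ (fun t => cexp (w * t%:C)))//.
  - by rewrite mulr1 mulr0 cexp0.
  - by move=> x _; apply: rcontM; [exact: rcont_cst|exact: rcont_cexpM].
  - by move=> x _; exact: rder_cexp.
apply: le_trans (cnorm_cint_le (M := cnorm w * expR (cnorm w)) _ _ _) _ => //.
- by apply: rcont_integrable => x _; apply: rcontM; [exact: rcont_cst|exact: rcont_cexpM].
- move=> x x01; rewrite cnormM ler_wpM2l ?cnorm_ge0// (le_trans (cnorm_cexp_le _))//.
  by rewrite ler_expR cnorm_ray_le.
by rewrite subr0 mulr1 mulrA.
Qed.

Lemma cexp_sub1l_le w : cnorm (cexp w - 1 - w) <= 4 * cnorm w ^+ 2 * expR (cnorm w).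
Proof.
have c0 x : rcont (fun t : R => w * (cexp (w * t%:C) - 1)) x.
  by apply: rcontM; [exact: rcont_cst|apply: rcontB; [exact: rcont_cexpM|exact: rcont_cst]].
have -> : cexp w - 1 - w = cint 0 1 (fun t => w * (cexp (w * t%:C) - 1)).
  rewrite (@cint_FTC _ 0 1 _ (fun t => cexp (w * t%:C) - w * t%:C))//.
  - by rewrite mulr1 mulr0 cexp0; ring.
  - move=> x _; apply: rder_eq; first apply: rderD; first exact: rder_cexp.
      by apply: rderN; apply: rderZ; exact: rder_id.
    by ring.
apply: le_trans (cnorm_cint_le (M := cnorm w * (2 * cnorm w * expR (cnorm w))) _ _ _) _ => //.
- exact: rcont_integrable.
- move=> x x01; rewrite cnormM ler_wpM2l ?cnorm_ge0// (le_trans (cexp_sub1_le _))//.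
  apply: ler_pM; rewrite ?mulr_ge0 ?cnorm_ge0 ?expR_ge0//.
    by rewrite ler_wpM2l// cnorm_ray_le.
  by rewrite ler_expR cnorm_ray_le.
have -> : 2 * (cnorm w * (2 * cnorm w * expR (cnorm w)) * (1 - 0)) = 4 * cnorm w ^+ 2 * expR (cnorm w) by ring.
exact: lexx.
Qed.
End ExponentialEstimates.

(** * Complex differentiation and Goursat's theorem *)

(** Both radii range over positive elements of [K]. For [K = R[i]] positivity forces them to be
    real, which is how [derivableP_cder] passes to real radii. *)
Lemma derivable_numFieldP (K : numFieldType) (f : K -> K) (z : K) :
  derivable (f : K^o -> K^o) z 1 <-> exists d : K, forall e : K, 0 < e ->
    exists2 r : K, 0 < r & forall h, `|h| < r -> h != 0 ->
      `|h^-1 * (f (h + z) - f z) - d| <= e.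
Proof.
pose D : K -> K := fun h => h^-1 * (f (h + z) - f z).
have E : (fun h => h^-1 *: (((f : K^o -> K^o) \o shift z) (h *: (1 : K^o)) - f z)) = D.
  by apply/funext => h; rewrite /D /shift /= -[h *: 1]/(h * 1) mulr1.
rewrite /derivable E; split.
- move=> /cvg_ex[/= L] /cvgrPdist_le HL; exists L => e e0.
  have := HL e e0; rewrite near_withinE => /nbhs_normP[r r0 Hr]; exists r => // h hr h0.
  by rewrite distrC; apply: (Hr h) => //=; rewrite sub0r normrN.
- move=> [L HL]; apply/cvg_ex; exists L; apply/cvgrPdist_le => e e0.
  rewrite near_withinE; have [r r0 Hr] := HL e e0.
  apply/nbhs_normP; exists r => // h /=; rewrite sub0r normrN => hr h0.
  by rewrite distrC; exact: Hr.
Qed.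

Section ComplexDerivative.
Variable R : realType.
Local Notation C := R[i].
Local Notation Re := complex.Re.
Local Notation Im := complex.Im.
Implicit Types (f g : C -> C) (z w d e : C).

(* Caratheodory's form of complex differentiability. *)
Definition cder f z d := exists q : C -> C,
  [/\ forall w, f w = f z + (w - z) * q w, q z = d & ccont q z].

Lemma cder_eq f z d e : cder f z d -> d = e -> cder f z e.
Proof. by move=> h <-. Qed.

Lemma cder_cont f z d : cder f z d -> ccont f z.
Proof.
move=> [q [fq qz cq]].
have -> : f = fun w => f z + (w - z) * q w by apply/funext => w; exact: fq.
apply: ccontD; first exact: ccont_cst.
by apply: ccontM => //; apply: ccontB; [exact: ccont_id|exact: ccont_cst].
Qed.

Lemma cder_cst c z : cder (fun=> c) z 0.
Proof.
exists (fun=> 0); split => //; last exact: ccont_cst.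
by move=> w; rewrite mulr0 addr0.
Qed.

Lemma cder_id z : cder id z 1.
Proof.
exists (fun=> 1); split => //; last exact: ccont_cst.
by move=> w; rewrite mulr1 addrC subrK.
Qed.

Lemma cderD f g z d e : cder f z d -> cder g z e ->
  cder (fun w => f w + g w) z (d + e).
Proof.
move=> [q [fq qz cq]] [r [gr rz cr]]; exists (fun w => q w + r w); split.
- by move=> w; rewrite fq gr; ring.
- by rewrite qz rz.
- exact: ccontD.
Qed.

Lemma cderM f g z d e : cder f z d -> cder g z e ->
  cder (fun w => f w * g w) z (d * g z + f z * e).
Proof.
move=> Hf Hg; have cg := cder_cont Hg; move: Hf Hg.
move=> [q [fq qz cq]] [r [gr rz cr]].
exists (fun w => q w * g w + f z * r w); split.
- by move=> w; rewrite fq gr; ring.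
- by rewrite qz rz.
- by apply: ccontD; apply: ccontM => //; exact: ccont_cst.
Qed.

Lemma cderZ c f z d : cder f z d -> cder (fun w => c * f w) z (c * d).
Proof.
by move=> h; apply: cder_eq (cderM (cder_cst c z) h) _; rewrite mul0r add0r.
Qed.

Lemma cderN f z d : cder f z d -> cder (fun w => - f w) z (- d).
Proof.
move=> h; apply: cder_eq (mulN1r d).
by have := cderZ (-1) h; under eq_fun do rewrite mulN1r.
Qed.

Lemma cderB f g z d e : cder f z d -> cder g z e ->
  cder (fun w => f w - g w) z (d - e).
Proof. by move=> a b; apply: cderD => //; exact: cderN. Qed.

Lemma cder_comp f g z d e : cder f (g z) d -> cder g z e ->
  cder (fun w => f (g w)) z (d * e).
Proof.
move=> Hf Hg; have cg := cder_cont Hg; move: Hf Hg.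
move=> [q [fq qz cq]] [r [gr rz cr]].
exists (fun w => q (g w) * r w); split.
- move=> w; rewrite fq; have -> : g w - g z = (w - z) * r w.
    by rewrite {1}(gr w); ring.
  by ring.
- by rewrite qz rz.
- by apply: ccontM => //; exact: ccont_comp.
Qed.

Lemma cder_inv z : z != 0 -> cder (fun w => w^-1) z (- (z ^+ 2)^-1).
Proof.
move=> z0.
(* At [w = 0] the convention [0^-1 = 0] leaves [z^-1 ^+ 2] as the only possible value of the
   quotient. *)
exists (fun w => if w == 0 then z^-1 ^+ 2 else - (z * w)^-1); split.
- move=> w; case: eqVneq => [->|w0]; first by rewrite invr0; field.
  by field; rewrite ?z0 ?w0.
- by rewrite (negbTE z0) expr2.
- have c1 : ccont (fun w => - (z * w)^-1) z.
    apply: ccontN; apply: ccontV; first by rewrite mulf_neq0.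
    by apply: ccontM; [exact: ccont_cst|exact: ccont_id].
  apply: ccontI => e e0; have [d d0 Hd] := ccontP c1 e0.
  exists (Num.min d (cnorm z)); first by rewrite lt_min d0 cnorm_gt0.
  move=> w; rewrite lt_min => /andP[wd wz].
  have w0 : w != 0.
    by apply: contraTneq wz => ->; rewrite sub0r cnormN ltxx.
  by rewrite (negbTE w0) (negbTE z0) ltW// Hd.
Qed.

Lemma cderV f z d : f z != 0 -> cder f z d ->
  cder (fun w => (f w)^-1) z (- (f z ^+ 2)^-1 * d).
Proof. by move=> f0 h; exact: (cder_comp (cder_inv f0) h). Qed.

Lemma cderI f z d : (forall e : R, 0 < e -> exists2 r : R, 0 < r &
    forall w, cnorm (w - z) < r ->
      cnorm (f w - f z - d * (w - z)) <= e * cnorm (w - z)) -> cder f z d.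
Proof.
move=> H; exists (fun w => if w == z then d else (f w - f z) / (w - z)); split.
- move=> w; case: eqVneq => [->|wz]; first by rewrite subrr mul0r addr0.
  by rewrite mulrC divfK ?subr_eq0// addrC subrK.
- by rewrite eqxx.
- apply: ccontI => e e0; have [r r0 Hr] := H e e0; exists r => // w wr.
  rewrite eqxx; case: eqVneq => [_|wz]; first by rewrite subrr cnorm0 ltW.
  have wz0 : w - z != 0 by rewrite subr_eq0.
  have -> : (f w - f z) / (w - z) - d = (f w - f z - d * (w - z)) / (w - z) by field.
  by rewrite cnormM cnormV ler_pdivrMr ?cnorm_gt0// Hr.
Qed.

Lemma cderP f z d : cder f z d -> forall e : R, 0 < e -> exists2 r : R, 0 < r &
    forall w, cnorm (w - z) < r ->
      cnorm (f w - f z - d * (w - z)) <= e * cnorm (w - z).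
Proof.
move=> [q [fq qz cq]] e e0; have [r r0 Hr] := ccontP cq e0.
exists r => // w wr; rewrite fq -qz.
have -> : f z + (w - z) * q w - f z - q z * (w - z) = (q w - q z) * (w - z) by ring.
by rewrite cnormM ler_wpM2r ?cnorm_ge0// ltW// Hr.
Qed.

(** Serves to equate the derivatives in [eta] of the two sides of [Top_ccosh] at a double root. *)
Lemma cder_unique f z d e : cder f z d -> cder f z e -> d = e.
Proof.
move=> hd he; apply/eqP; rewrite -subr_eq0 -cnorm_eq0 eq_le cnorm_ge0 andbT.
apply/ler_addgt0Pr => k k0; rewrite add0r.
have k2 : 0 < k / 2 by rewrite divr_gt0.
have [r r0 Hr] := cderP hd k2; have [s s0 Hs] := cderP he k2.
pose t := Num.min r s / 2.
have t0 : 0 < t by rewrite divr_gt0// lt_min r0.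
have tl : cnorm ((z + t%:C) - z) = t by rewrite addrC addKr cnormR gtr0_norm.
have tm : t < Num.min r s by rewrite ltr_pdivrMr// ltr_pMr ?ltr1n// lt_min r0.
have h1 := Hr (z + t%:C); have h2 := Hs (z + t%:C).
rewrite tl in h1 h2; move: tm; rewrite lt_min => /andP[/h1 a /h2 b].
rewrite -(ler_pM2r t0) -{1}tl -cnormM.
have -> : (d - e) * (z + t%:C - z) = (f (z + t%:C) - f z - e * (z + t%:C - z)) -
  (f (z + t%:C) - f z - d * (z + t%:C - z)) by ring.
by rewrite (le_trans (cnormB _ _))// (le_trans (lerD b a))// -mulrDl -splitr.
Qed.

Lemma cder_near f g z d (r : R) : 0 < r ->
  (forall w, cnorm (w - z) < r -> f w = g w) -> cder f z d -> cder g z d.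
Proof.
move=> r0 fg h; apply: cderI => e e0; have [s s0 Hs] := cderP h e0.
exists (Num.min r s); first by rewrite lt_min r0.
move=> w; rewrite lt_min => /andP[wr ws].
by rewrite -!fg// ?subrr ?cnorm0//; exact: Hs.
Qed.

Lemma cder_cexp z : cder (@cexp R) z (cexp z).
Proof.
apply: cderI => e e0.
pose M := 4 * expR 1 * cnorm (cexp z).
have M0 : 0 < M by rewrite !mulr_gt0// ?expR_gt0// cnorm_gt0 cexp_neq0.
exists (Num.min 1 (e / M)); first by rewrite lt_min ltr01 divr_gt0.
move=> w; rewrite lt_min => /andP[w1 we].
have -> : cexp w - cexp z - cexp z * (w - z) =
    cexp z * (cexp (w - z) - 1 - (w - z)).
  by rewrite cexpB; field; exact: cexp_neq0.
rewrite cnormM; apply: (@le_trans _ _ (cnorm (cexp z) * (4 * cnorm (w - z) ^+ 2 * expR 1))).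
  rewrite ler_wpM2l ?cnorm_ge0// (le_trans (cexp_sub1l_le _))//.
  apply: ler_wpM2l; first by apply: mulr_ge0 => //; exact: sqr_ge0.
  by rewrite ler_expR ltW.
have -> : cnorm (cexp z) * (4 * cnorm (w - z) ^+ 2 * expR 1) =
  (M * cnorm (w - z)) * cnorm (w - z) by rewrite /M; ring.
by rewrite ler_wpM2r ?cnorm_ge0// mulrC -ler_pdivlMr// ltW.
Qed.

Lemma nbhs_cnorm (z : C) (P : set C) : nbhs (z : C^o) P <->
  exists2 r : R, 0 < r & forall w, cnorm (w - z) < r -> P w.
Proof.
split.
  move=> /(@nbhs_ballP _ C^o) [[a b] /=]; rewrite ltcE /= => /andP[/eqP b0 a0] H.
  exists a => // w wz; apply: H.
  by rewrite -(@ball_normE _ C^o) /= cnormE ltcE /= b0 eqxx /= cnormBC.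
move=> [r r0 H]; apply/(@nbhs_ballP _ C^o); exists r%:C => /=; first by rewrite ltcR.
by move=> w; rewrite -(@ball_normE _ C^o) /= cnormE ltcR cnormBC; exact: H.
Qed.

Lemma cvg_ctends (T : Type) (F : set_system T) (FF : Filter F) (f : T -> C) (l : C) :
  f x @[x --> F] --> (l : C^o) <-> ctends F f l.
Proof.
split.
- move=> h; rewrite -[l]add0r.
  have -> : f = fun x => (f x - l) + l by apply/funext => x; rewrite subrK.
  apply: ctendsD; last exact: ctends_cst.
  apply: ctends0; apply/cvgrPdist_lt => e e0.
  have /h H : nbhs (l : C^o) (fun w => cnorm (w - l) < e) by apply/nbhs_cnorm; exists e.
  have : F [set x | cnorm (f x - l) < e] := H.
  by apply: filterS => x /=; rewrite sub0r normrN ger0_norm// cnorm_ge0.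
- move=> h P /nbhs_cnorm [r r0 HP].
  have : ctends F (fun x => f x - l) 0.
    by rewrite -(subrr l); apply: ctendsB => //; exact: ctends_cst.
  move=> /ctends_cnorm; rewrite cnorm0 => /cvgrPdist_lt /(_ r r0) H.
  suff : F (f @^-1` P) by [].
  by apply: filterS H => x; rewrite sub0r normrN ger0_norm ?cnorm_ge0//; exact: HP.
Qed.

Lemma derivableP_cder f z : derivable (f : C^o -> C^o) z 1 <-> exists d, cder f z d.
Proof.
have key (L : C) (r : R) (h : C) : 0 < r -> h != 0 ->
    (`|h^-1 * (f (h + z) - f z) - L| <= r%:C) =
    (cnorm (f (h + z) - f z - L * h) <= r * cnorm h).
  move=> r0 h0; rewrite cnormE lecR -ler_pdivrMr ?cnorm_gt0// -cnormV -cnormM.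
  by congr (cnorm _ <= r); field.
split.
- move=> /derivable_numFieldP[L HL]; exists L; apply: cderI => e e0.
  have [|[a b]] := HL e%:C; first by rewrite ltcR.
  rewrite ltcE /= => /andP[/eqP b0 a0] Hr; exists a => // w wr.
  have [->|wz] := eqVneq w z; first by rewrite !subrr mulr0 subrr cnorm0 mulr0.
  have wz0 : w - z != 0 by rewrite subr_eq0.
  have := Hr (w - z); rewrite cnormE ltcE /= b0 eqxx wr => /(_ isT wz0).
  by rewrite key// subrK.
- move=> [L HL]; apply/derivable_numFieldP; exists L => -[e b].
  rewrite ltcE /= => /andP[/eqP -> e0].
  have [r r0 Hr] := cderP HL e0; exists r%:C; first by rewrite ltcR.
  move=> h; rewrite cnormE ltcR => hr h0; rewrite key//.
  by have := Hr (h + z); rewrite addrK; exact.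
Qed.

End ComplexDerivative.

Section Goursat.
Variable R : realType.
Local Notation C := R[i].
Local Notation Re := complex.Re.
Local Notation Im := complex.Im.
Local Notation leb := (@lebesgue_measure R).
Implicit Types (f g : C -> C) (a b c z w : C).

(** Applied to real and imaginary parts, this yields the limit point of the shrinking triangles in
    Goursat's argument. *)
Lemma nested_intervals (u v : nat -> R) :
  (forall n, u n <= u n.+1) -> (forall n, v n.+1 <= v n) -> (forall n, u n <= v n) ->
  exists x, forall n, u n <= x <= v n.
Proof.
move=> hu hv huv.
have mu : {homo u : m n / (m <= n)%N >-> m <= n} by exact/nondecreasing_seqP.
have mv : {homo v : m n / (m <= n)%N >-> n <= m} by exact/nonincreasing_seqP.
have uv m n : u m <= v n.
  apply: (@le_trans _ _ (u (maxn m n))); first by apply: mu; exact: leq_maxl.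
  by apply: le_trans (huv _) _; apply: mv; exact: leq_maxr.
exists (sup (range u)) => n; apply/andP; split.
  by apply: ub_le_sup; [exists (v 0%N) => _ [m _ <-]|exists n].
by apply: ge_sup; [exists (u 0%N), 0%N|move=> _ [m _ <-]].
Qed.

Definition on_segment a b (t : R) : C := a + t%:C * (b - a).

Definition segint f a b : C := (b - a) * cint 0 1 (fun t => f (on_segment a b t)).

Definition cont_segment f a b := forall t : R, 0 <= t <= 1 -> ccont f (on_segment a b t).

Lemma rcont_on_segment a b t : rcont (on_segment a b) t.
Proof.
by apply: rcontD; [exact: rcont_cst|apply: rcontM; [exact: rcont_id|exact: rcont_cst]].
Qed.

Lemma rcont_segment f a b : cont_segment f a b ->
  forall t : R, 0 <= t <= 1 -> rcont (fun t => f (on_segment a b t)) t.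
Proof. by move=> cf t t01; apply: rcont_comp; [exact: cf|exact: rcont_on_segment]. Qed.

Lemma segint_integrable f a b : cont_segment f a b ->
  cintegrable leb `[0, 1] (fun t => f (on_segment a b t)).
Proof. by move=> cf; apply: rcont_integrable; exact: rcont_segment. Qed.

Lemma segintB f g a b : cont_segment f a b -> cont_segment g a b ->
  segint (fun z => f z - g z) a b = segint f a b - segint g a b.
Proof.
move=> cf cg; rewrite /segint -mulrBr; congr (_ * _).
by apply: cintegralB => //; exact: segint_integrable.
Qed.

Lemma segint_le f a b (M : R) : cont_segment f a b ->
  (forall t : R, 0 <= t <= 1 -> cnorm (f (on_segment a b t)) <= M) ->
  cnorm (segint f a b) <= 2 * M * cnorm (b - a).
Proof.
move=> cf fM; rewrite /segint cnormM mulrC ler_wpM2r ?cnorm_ge0//.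
have := cnorm_cint_le ler01 (segint_integrable cf) fM.
by rewrite subr0 mulr1.
Qed.

Lemma segint_rev f a b : cont_segment f a b -> segint f b a = - segint f a b.
Proof.
move=> cf; rewrite /segint -(opprB b a) mulNr; congr (- (_ * _)).
have E t : on_segment b a t = on_segment a b (1 - t).
  by rewrite /on_segment rmorphB /=; ring.
under eq_fun do rewrite E.
have cf' := rcont_segment cf.
apply: complexP => /=.
  have := @Rintegration_by_substitution_onem R (fun t => Re (f (on_segment a b t))) 1.
  rewrite ler01 lexx /unstable.onem subrr => -> //.
  by apply: within_cont => x /cf' [].
have := @Rintegration_by_substitution_onem R (fun t => Im (f (on_segment a b t))) 1.
rewrite ler01 lexx /unstable.onem subrr => -> //.
by apply: within_cont => x /cf' [].
Qed.

Definition midpoint a b : C := (a + b) / 2.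

Lemma RC_inv2 : (2^-1 : R)%:C = 2^-1 :> C.
Proof. by rewrite fmorphV rmorph_nat. Qed.

Lemma RC_half (t : R) : (t / 2)%:C = t%:C / 2 :> C.
Proof. by rewrite rmorphM /= RC_inv2. Qed.

Lemma segint_split f a b : cont_segment f a b ->
  segint f a b = segint f a (midpoint a b) + segint f (midpoint a b) b.
Proof.
move=> cf; have cf' := rcont_segment cf.
have si : cintegrable leb `[0, 1] (fun t => f (on_segment a b t)) by exact: segint_integrable.
have h01 : 0 <= 2^-1 :> R by rewrite invr_ge0.
have h12 : 2^-1 <= 1 :> R by rewrite invf_le1// ler1n.
have dF (k x : R) : is_derive x 1 (fun t => k + t / 2) 2^-1.
  have h := is_deriveD (is_derive_cst k x 1) (is_deriveM (is_derive_id x 1) (is_derive_cst (2^-1 : R) x 1)).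
  by apply: (is_derive_eq h); rewrite /GRing.scale /=; ring.
have cF (k : R) : continuous (fun _ : R => 2^-1 : R) by move=> x; exact: cvg_cst.
rewrite {1}/segint (cint_split (c := 2^-1)) ?h01//.
have e1 : cint 0 2^-1 (fun t => f (on_segment a b t)) =
    2^-1 * cint 0 1 (fun t => f (on_segment a (midpoint a b) t)).
  have := @cint_subst R 0 1 (fun t => 0 + t / 2) (fun=> 2^-1) (fun t => f (on_segment a b t)).
  rewrite mul0r mul1r !add0r => -> //.
  - rewrite -cintegralZ//.
      apply: eq_cintegral => x _; rewrite add0r mulrC; congr (_ * f _).
        by rewrite RC_inv2.
      by rewrite /on_segment /midpoint RC_half; field.
    apply: segint_integrable => t /andP[t0 t1].
    have -> : on_segment a (midpoint a b) t = on_segment a b (t / 2).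
      by rewrite /on_segment /midpoint RC_half; field.
    by apply: cf; lra.
  - by move=> x y _ _ xy; lra.
  - exact: cF 0.
  - by move=> x /andP[x0 x1]; apply: cf'; lra.
have e2 : cint 2^-1 1 (fun t => f (on_segment a b t)) =
    2^-1 * cint 0 1 (fun t => f (on_segment (midpoint a b) b t)).
  have := @cint_subst R 0 1 (fun t => 2^-1 + t / 2) (fun=> 2^-1) (fun t => f (on_segment a b t)).
  have -> : 2^-1 + 0 / 2 = 2^-1 :> R by lra.
  have -> : 2^-1 + 1 / 2 = 1 :> R by lra.
  have E t : on_segment (midpoint a b) b t = on_segment a b (2^-1 + t / 2).
    by rewrite /on_segment /midpoint rmorphD /= RC_inv2 RC_half; field.
  move=> -> //.
  - rewrite -cintegralZ//.
      apply: eq_cintegral => x _; rewrite mulrC E; congr (_ * f _).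
      by rewrite RC_inv2.
    apply: segint_integrable => t /andP[t0 t1].
    by rewrite E; apply: cf; lra.
  - by move=> x y _ _ xy; lra.
  - exact: cF 0.
  - by move=> x /andP[x0 x1]; apply: cf'; lra.
rewrite e1 e2 /segint /midpoint; set I1 := cint _ _ _; set I2 := cint _ _ _.
by field.
Qed.

(** An affine function has a primitive, so its integral around a closed triangle cancels. *)
Lemma segint_affine (k l z0 a b : C) :
  segint (fun w => k + l * (w - z0)) a b =
  (k * b + l * (b - z0) ^+ 2 / 2) - (k * a + l * (a - z0) ^+ 2 / 2).
Proof.
have c1 x : rcont (fun t => k + l * (on_segment a b t - z0)) x.
  apply: rcontD; first exact: rcont_cst.
  apply: rcontM; first exact: rcont_cst.
  by apply: rcontB; [exact: rcont_on_segment|exact: rcont_cst].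
rewrite /segint (@cint_FTC _ 0 1 _ (fun t => (k + l * (a - z0)) * t%:C + l * (b - a) / 2 * (t%:C * t%:C)))//.
  by rewrite !mulr0 !mulr1; field.
move=> x _; apply: rder_eq.
  by apply: rderD; apply: rderZ; [exact: rder_id|apply: rderM; exact: rder_id].
by rewrite /on_segment; field.
Qed.

Definition triint f (T : C * C * C) : C :=
  segint f T.1.1 T.1.2 + segint f T.1.2 T.2 + segint f T.2 T.1.1.

Section Domain.
Variable D : C -> Prop.
(** Convexity keeps the sides and the subdivided triangles inside [D]; closedness puts their limit
    point into [D], where differentiability is then available. *)
Hypothesis Dconv : forall a b (t : R), D a -> D b -> 0 <= t <= 1 -> D (on_segment a b t).
Hypothesis Dclosed : forall z,
  (forall e : R, 0 < e -> exists2 w, D w & cnorm (w - z) < e) -> D z.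

Lemma midpointE a b : midpoint a b = on_segment a b 2^-1.
Proof. by rewrite /midpoint /on_segment RC_inv2; field. Qed.

Lemma D_midpoint a b : D a -> D b -> D (midpoint a b).
Proof.
by move=> Da Db; rewrite midpointE; apply: Dconv => //; lra.
Qed.

Definition in_domain (T : C * C * C) := [/\ D T.1.1, D T.1.2 & D T.2].

Definition perimeter (T : C * C * C) : R :=
  cnorm (T.1.2 - T.1.1) + cnorm (T.2 - T.1.2) + cnorm (T.1.1 - T.2).

Definition corner1 (T : C * C * C) := (T.1.1, midpoint T.1.1 T.1.2, midpoint T.2 T.1.1).
Definition corner2 (T : C * C * C) := (midpoint T.1.1 T.1.2, T.1.2, midpoint T.1.2 T.2).
Definition corner3 (T : C * C * C) := (midpoint T.2 T.1.1, midpoint T.1.2 T.2, T.2).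
Definition center4 (T : C * C * C) :=
  (midpoint T.1.1 T.1.2, midpoint T.1.2 T.2, midpoint T.2 T.1.1).

Definition subtriangles T := [:: corner1 T; corner2 T; corner3 T; center4 T].

Lemma cnorm_half (z : C) : cnorm (z / 2) = cnorm z / 2.
Proof. by rewrite cnormM -RC_inv2 cnormR ger0_norm// invr_ge0. Qed.

Lemma subtriangles_domain T S : in_domain T -> S \in subtriangles T -> in_domain S.
Proof.
case: T => [[a b] c] [/= Da Db Dc].
rewrite !inE => /or4P[] /eqP ->; split => //=; exact: D_midpoint.
Qed.

Lemma subtriangles_perimeter T S : S \in subtriangles T -> perimeter S = perimeter T / 2.
Proof.
case: T => [[a b] c]; rewrite !inE => /or4P[] /eqP ->; rewrite /perimeter /=.
- have -> : midpoint a b - a = (b - a) / 2 by rewrite /midpoint; field.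
  have -> : midpoint c a - midpoint a b = - ((b - c) / 2) by rewrite /midpoint; field.
  have -> : a - midpoint c a = (a - c) / 2 by rewrite /midpoint; field.
  by rewrite cnormN !cnorm_half (cnormBC b c); field.
- have -> : b - midpoint a b = (b - a) / 2 by rewrite /midpoint; field.
  have -> : midpoint b c - b = (c - b) / 2 by rewrite /midpoint; field.
  have -> : midpoint a b - midpoint b c = (a - c) / 2 by rewrite /midpoint; field.
  by rewrite !cnorm_half; field.
- have -> : midpoint b c - midpoint c a = (b - a) / 2 by rewrite /midpoint; field.
  have -> : c - midpoint b c = (c - b) / 2 by rewrite /midpoint; field.
  have -> : midpoint c a - c = (a - c) / 2 by rewrite /midpoint; field.
  by rewrite !cnorm_half; field.
- have -> : midpoint b c - midpoint a b = (c - a) / 2 by rewrite /midpoint; field.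
  have -> : midpoint c a - midpoint b c = (a - b) / 2 by rewrite /midpoint; field.
  have -> : midpoint a b - midpoint c a = (b - c) / 2 by rewrite /midpoint; field.
  by rewrite !cnorm_half (cnormBC c a) (cnormBC a b) (cnormBC b c); field.
Qed.

Lemma perimeter_ge0 T : 0 <= perimeter T.
Proof. by rewrite !addr_ge0 ?cnorm_ge0. Qed.

(** With the halving of the perimeter, this makes the first vertices of successive triangles move by
    geometrically decreasing steps. *)
Lemma subtriangles_base T S : S \in subtriangles T ->
  cnorm (S.1.1 - T.1.1) <= perimeter T / 2.
Proof.
case: T => [[a b] c].
have p0 := cnorm_ge0 (b - a); have p1 := cnorm_ge0 (c - b); have p2 := cnorm_ge0 (a - c).
have h1 : cnorm (midpoint a b - a) <= perimeter (a, b, c) / 2.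
  have -> : midpoint a b - a = (b - a) / 2 by rewrite /midpoint; field.
  by rewrite cnorm_half /perimeter /=; lra.
rewrite !inE => /or4P[] /eqP -> //=.
  by rewrite subrr cnorm0 divr_ge0// perimeter_ge0.
have -> : midpoint c a - a = - ((a - c) / 2) by rewrite /midpoint; field.
by rewrite cnormN cnorm_half /perimeter /=; lra.
Qed.

Variable f : C -> C.
Hypothesis fD : forall z, D z -> exists d, cder f z d.

Lemma domain_cont_segment a b : D a -> D b -> cont_segment f a b.
Proof.
by move=> Da Db t t01; have [d] := fD (Dconv Da Db t01); exact: cder_cont.
Qed.

Lemma triint_subtriangles T : in_domain T ->
  triint f T = triint f (corner1 T) + triint f (corner2 T) + triint f (corner3 T)
    + triint f (center4 T).
Proof.
case: T => [[a b] c] [/= Da Db Dc]; rewrite /triint /=.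
have Dab := D_midpoint Da Db; have Dbc := D_midpoint Db Dc; have Dca := D_midpoint Dc Da.
have cc := domain_cont_segment.
rewrite (segint_split (cc _ _ Da Db)) (segint_split (cc _ _ Db Dc)) (segint_split (cc _ _ Dc Da)).
rewrite (segint_rev (cc _ _ Dab Dca)) (segint_rev (cc _ _ Dab Dbc)) (segint_rev (cc _ _ Dbc Dca)).
ring.
Qed.

Definition next_triangle T :=
  if cnorm (triint f T) <= 4 * cnorm (triint f (corner1 T)) then corner1 T
  else if cnorm (triint f T) <= 4 * cnorm (triint f (corner2 T)) then corner2 T
  else if cnorm (triint f T) <= 4 * cnorm (triint f (corner3 T)) then corner3 T
  else center4 T.

Lemma next_triangle_in T : next_triangle T \in subtriangles T.
Proof.
rewrite /next_triangle; case: ifP => _; first by rewrite !inE eqxx.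
case: ifP => _; first by rewrite !inE eqxx orbT.
by case: ifP => _; rewrite !inE eqxx !orbT.
Qed.

(** If the first three tests fail, the triangle inequality leaves more than a quarter of the modulus
    to the central triangle. *)
Lemma next_triangle_le T : in_domain T ->
  cnorm (triint f T) <= 4 * cnorm (triint f (next_triangle T)).
Proof.
move=> DT; rewrite /next_triangle.
case: ifPn => // /negP/negP; rewrite -ltNge => h1.
case: ifPn => // /negP/negP; rewrite -ltNge => h2.
case: ifPn => // /negP/negP; rewrite -ltNge => h3.
have h := cnormD (triint f (corner1 T) + triint f (corner2 T) + triint f (corner3 T)) (triint f (center4 T)).
have h' := cnormD (triint f (corner1 T) + triint f (corner2 T)) (triint f (corner3 T)).
have h'' := cnormD (triint f (corner1 T)) (triint f (corner2 T)).
rewrite -triint_subtriangles// in h.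
move: h1 h2 h3 h h' h''; lra.
Qed.

Lemma on_segment_dist a b z0 (t M : R) : 0 <= t <= 1 -> cnorm (a - z0) <= M ->
  cnorm (b - a) <= M -> cnorm (on_segment a b t - z0) <= 2 * M.
Proof.
move=> /andP[t0 t1] ha hb.
have -> : on_segment a b t - z0 = (a - z0) + t%:C * (b - a) by rewrite /on_segment; ring.
rewrite (le_trans (cnormD _ _))// mulr_natl mulr2n lerD// cnormM cnormR ger0_norm//.
by rewrite (le_trans _ hb)// ler_piMl// cnorm_ge0.
Qed.

(** Subtracting the affine approximation at [z0] does not change the integral around the triangle. A
    point of a side lies within one perimeter of its starting vertex, itself within one perimeter of
    the first vertex: hence [2 * perimeter T]. *)
Lemma triint_local T z0 d (e : R) : in_domain T ->
  (forall w, D w -> cnorm (w - T.1.1) <= 2 * perimeter T ->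
    cnorm (f w - f z0 - d * (w - z0)) <= e) ->
  cnorm (triint f T) <= 2 * e * perimeter T.
Proof.
case: T => [[a b] c] [/= Da Db Dc] He.
pose g w := f z0 + d * (w - z0).
have cg x y : cont_segment g x y.
  move=> t _; apply: ccontD; first exact: ccont_cst.
  apply: ccontM; first exact: ccont_cst.
  by apply: ccontB; [exact: ccont_id|exact: ccont_cst].
have cc := domain_cont_segment.
have cfg x y : D x -> D y -> cont_segment (fun w => f w - g w) x y.
  by move=> Dx Dy t t01; apply: ccontB; [exact: cc|exact: cg].
have -> : triint f (a, b, c) = triint (fun w => f w - g w) (a, b, c).
  rewrite /triint /= !segintB//; try exact: cc.
  have g0 : segint g a b + segint g b c + segint g c a = 0.
    by rewrite /g !segint_affine; ring.
  by rewrite -[LHS]subr0 -g0; ring.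
have edge x y : D x -> D y -> cnorm (x - a) <= perimeter (a, b, c) ->
    cnorm (y - x) <= perimeter (a, b, c) ->
    cnorm (segint (fun w => f w - g w) x y) <= 2 * e * cnorm (y - x).
  move=> Dx Dy xa yx; apply: segint_le; first exact: cfg.
  move=> t t01; rewrite /g opprD addrA; apply: He; first exact: Dconv.
  exact: on_segment_dist.
have p0 := cnorm_ge0 (b - a); have p1 := cnorm_ge0 (c - b); have p2 := cnorm_ge0 (a - c).
rewrite /triint [in leRHS]/perimeter /= !mulrDr.
apply: le_trans (cnormD _ _) _; apply: lerD; last first.
  have e1 := cnormBC c a.
  by apply: edge => //; rewrite ?e1 /perimeter /=; lra.
apply: le_trans (cnormD _ _) _; apply: lerD.
  by apply: edge => //; rewrite ?subrr ?cnorm0 /perimeter /=; lra.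
by apply: edge => //; rewrite /perimeter /=; lra.
Qed.

Theorem goursat_triangle T : in_domain T -> triint f T = 0.
Proof.
move=> DT; apply/eqP; rewrite -cnorm_eq0 eq_le cnorm_ge0 andbT.
pose S n := iter n next_triangle T.
have SS n : S n.+1 \in subtriangles (S n) by exact: next_triangle_in.
have SD n : in_domain (S n).
  by elim: n => //= n ih; exact: subtriangles_domain (next_triangle_in _).
pose p := perimeter T.
have p0 : 0 <= p by exact: perimeter_ge0.
have Sp n : perimeter (S n) = p / 2 ^+ n.
  elim: n => [|n ih]; first by rewrite expr0 divr1.
  by rewrite (subtriangles_perimeter (SS n)) ih exprS invfM; ring.
have SI n : cnorm (triint f T) <= 4 ^+ n * cnorm (triint f (S n)).
  elim: n => [|n ih]; first by rewrite expr0 mul1r.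
  apply: le_trans ih _; rewrite exprSr -mulrA ler_wpM2l ?exprn_ge0//.
  exact: next_triangle_le.
have Sb n : cnorm ((S n.+1).1.1 - (S n).1.1) <= p / 2 ^+ n.+1.
  by rewrite (le_trans (subtriangles_base (SS n)))// Sp exprS invfM; lra.
have half n : p / 2 ^+ n = 2 * (p / 2 ^+ n.+1).
  by rewrite exprS invfM; field; rewrite expf_neq0.
have pn0 n : 0 <= p / 2 ^+ n by rewrite divr_ge0// exprn_ge0.
(* The vertex moves by at most [p / 2 ^+ n.+1], exactly the amount by which the radius shrinks, so
   these intervals are nested. *)
have [x Hx] : exists x, forall n, Re (S n).1.1 - p / 2 ^+ n <= x <= Re (S n).1.1 + p / 2 ^+ n.
  apply: nested_intervals => n.
  - have := le_trans (normRe_le _) (Sb n); rewrite ReImE ler_norml => /andP[h1 h2].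
    by move: (half n) h1 h2; lra.
  - have := le_trans (normRe_le _) (Sb n); rewrite ReImE ler_norml => /andP[h1 h2].
    by move: (half n) h1 h2; lra.
  - by move: (pn0 n); lra.
have [y Hy] : exists y, forall n, Im (S n).1.1 - p / 2 ^+ n <= y <= Im (S n).1.1 + p / 2 ^+ n.
  apply: nested_intervals => n.
  - have := le_trans (normIm_le _) (Sb n); rewrite !ReImE ler_norml => /andP[h1 h2].
    by move: (half n) h1 h2; lra.
  - have := le_trans (normIm_le _) (Sb n); rewrite !ReImE ler_norml => /andP[h1 h2].
    by move: (half n) h1 h2; lra.
  - by move: (pn0 n); lra.
pose z0 : C := x +i* y.
have Hz n : cnorm ((S n).1.1 - z0) <= 2 * (p / 2 ^+ n).
  apply: le_trans (cnorm_le_ReIm _) _; rewrite !ReImE /= mulr_natl mulr2n lerD//.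
    by move: (Hx n) => /andP[h1 h2]; rewrite ler_norml; apply/andP; split; lra.
  by move: (Hy n) => /andP[h1 h2]; rewrite ler_norml; apply/andP; split; lra.
have small (e : R) : 0 < e -> exists n, 4 * (p / 2 ^+ n) < e.
  move=> e0; have h0 : 0 <= 4 * p / e by apply: divr_ge0; [exact: mulr_ge0|exact: ltW].
  exists (Num.bound (4 * p / e)); set n := Num.bound _.
  have h1 : 4 * p / e < n%:R by have := archi_boundP h0.
  have h2 : n%:R < 2 ^+ n :> R by rewrite -natrX ltr_nat ltn_expl.
  rewrite mulrA ltr_pdivrMr ?exprn_gt0//; have := lt_trans h1 h2.
  by rewrite ltr_pdivrMr// [e * _]mulrC.
have Dz : D z0.
  apply: Dclosed => e e0; have [n hn] := small e e0.
  exists (S n).1.1; first by case: (SD n).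
  by apply: le_lt_trans (Hz n) _; move: (pn0 n) hn; lra.
have [d hd] := fD Dz.
apply/ler_addgt0Pr => k k0; rewrite add0r.
(* A point of the n-th triangle considered in [triint_local] is within [4 * (p / 2 ^+ n)] of [z0],
   so the powers of 2 cancel and the final bound is [e * (8 * p ^+ 2)]. The summand 1 covers
   [p = 0]. *)
pose e := k / (8 * p ^+ 2 + 1).
have e0 : 0 < e by rewrite divr_gt0// ltr_wpDl// mulr_ge0// sqr_ge0.
have [r r0 Hr] := cderP hd e0.
have [n hn] := small r r0.
apply: le_trans (SI n) _.
have loc w : D w -> cnorm (w - (S n).1.1) <= 2 * perimeter (S n) ->
    cnorm (f w - f z0 - d * (w - z0)) <= e * (4 * (p / 2 ^+ n)).
  rewrite Sp => Dw hw.
  have hw' : cnorm (w - z0) <= 4 * (p / 2 ^+ n).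
    have -> : w - z0 = (w - (S n).1.1) + ((S n).1.1 - z0) by ring.
    by rewrite (le_trans (cnormD _ _))//; move: (Hz n) hw; lra.
  rewrite (le_trans (Hr _ _))//; first exact: le_lt_trans hn.
  by rewrite ler_wpM2l// ltW.
have := triint_local (SD n) loc; rewrite Sp => h.
apply: (@le_trans _ _ (4 ^+ n * (2 * (e * (4 * (p / 2 ^+ n))) * (p / 2 ^+ n)))).
  by rewrite ler_wpM2l// exprn_ge0.
have -> : 4 ^+ n * (2 * (e * (4 * (p / 2 ^+ n))) * (p / 2 ^+ n)) = e * (8 * p ^+ 2).
  have -> : 4 ^+ n = 2 ^+ n * 2 ^+ n :> R by rewrite -exprMn -natrM.
  by field; rewrite expf_neq0.
rewrite /e -mulrA ler_piMr//; first exact: ltW.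
rewrite mulrC ler_pdivrMr ?mul1r ?lerDl//.
by rewrite ltr_wpDl// mulr_ge0// sqr_ge0.
Qed.

End Domain.
End Goursat.

(** * Contour integration over the lower half plane *)

Section Quadrant.
Variable R : realType.
Local Notation C := R[i].
Local Notation Re := complex.Re.
Local Notation Im := complex.Im.
Local Notation leb := (@lebesgue_measure R).
Implicit Types (u z w : C).

(** The set of principal square roots of the closed first quadrant: the domain of [u] under
    [z = u ^+ 2]. *)
Definition sector u := 0 <= Im u <= Re u.

Lemma sector_convex u w (t : R) : sector u -> sector w -> 0 <= t <= 1 ->
  sector (on_segment u w t).
Proof.
move=> /andP[u1 u2] /andP[w1 w2] /andP[t0 t1].
have E1 : Re (on_segment u w t) = (1 - t) * Re u + t * Re w.
  by rewrite /on_segment !ReImE /=; ring.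
have E2 : Im (on_segment u w t) = (1 - t) * Im u + t * Im w.
  by rewrite /on_segment !ReImE /=; ring.
have t1' : 0 <= 1 - t by lra.
rewrite /sector E1 E2 addr_ge0 ?mulr_ge0//=.
by apply: lerD; exact: ler_wpM2l.
Qed.

Lemma sector_closed z :
  (forall e : R, 0 < e -> exists2 w, sector w & cnorm (w - z) < e) -> sector z.
Proof.
move=> H; apply/andP; split; apply/ler_addgt0Pl => e e0.
- have [w /andP[w1 w2] wz] := H e e0.
  have := le_lt_trans (normIm_le _) wz; rewrite ImB ltr_norml => /andP[a b].
  by lra.
- have e2 : 0 < e / 2 by rewrite divr_gt0.
  have [w /andP[w1 w2] wz] := H _ e2.
  have := le_lt_trans (normIm_le _) wz; rewrite ImB ltr_norml => /andP[a b].
  have := le_lt_trans (normRe_le _) wz; rewrite ReB ltr_norml => /andP[a' b'].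
  by lra.
Qed.

(** On the sector [u ^+ 3] has argument between 0 and 3 pi / 4. A factor of argument - arctan 2
    turns this range into a compact part of (- pi / 2, pi / 2), so that [omega * u ^+ 3] has
    positive real part away from 0. *)
Definition omega : C := 1 -i* 2.

Lemma omega_cube u : sector u -> Re u ^+ 3 <= Re (omega * u ^+ 3).
Proof.
case: u => p q su; have [q0 qp] : 0 <= q /\ q <= p by apply/andP.
have -> : Re (omega * (p +i* q) ^+ 3) = p ^+ 3 + q * (6 * p ^+ 2 - 3 * p * q - 2 * q ^+ 2).
  by rewrite /omega !exprS expr0 mulr1 !ReImE /=; ring.
rewrite lerDl mulr_ge0//.
have p0 : 0 <= p by lra.
have h1 : p * q <= p * p by rewrite ler_wpM2l.
have h2 : q * q <= p * q by rewrite ler_wpM2r.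
have h3 : 0 <= p * p by rewrite mulr_ge0.
by rewrite !expr2; lra.
Qed.

Variable k : C -> C.
Variables M B : R.
Hypothesis B0 : 0 <= B.
Hypothesis kD : forall z, 0 <= Re z -> 0 <= Im z -> z != 0 -> exists d, cder k z d.
Hypothesis k0 : ccont k 0.
Hypothesis kB : forall z, 0 <= Re z -> 0 <= Im z -> cnorm (k z) <= M * expR (B * cnorm z).

Lemma growth_ge0 : 0 <= M.
Proof.
have := @kB 0 (lexx 0) (lexx 0); rewrite cnorm0 mulr0 expR0 mulr1.
exact: le_trans (cnorm_ge0 _).
Qed.

Lemma sector_sqr u : sector u -> 0 <= Re (u ^+ 2) /\ 0 <= Im (u ^+ 2).
Proof.
case: u => p q su; have [q0 qp] : 0 <= q /\ q <= p by apply/andP.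
rewrite expr2 !ReImE /=.
have p0 : 0 <= p by lra.
by split; nra.
Qed.

Lemma k_cont z : 0 <= Re z -> 0 <= Im z -> ccont k z.
Proof.
move=> a b; have [->//|z0] := eqVneq z 0.
by have [d] := kD a b z0; exact: cder_cont.
Qed.

(** The factor [2 * u] is the Jacobian of [z = u ^+ 2]. The damping has order 3 in [u], against
    order 2 for the growth exp (B |u|^2) of [k (u ^+ 2)]. *)
Definition damped (s : R) u := 2 * u * (k (u ^+ 2) * cexp (- (s%:C * omega) * u ^+ 3)).

Lemma ccontX n z : ccont (fun w : C => w ^+ n) z.
Proof.
elim: n => [|n ih]; first by under eq_fun do rewrite expr0; exact: ccont_cst.
by under eq_fun do rewrite exprS; apply: ccontM => //; exact: ccont_id.
Qed.

Lemma cderX n z : exists d, cder (fun w : C => w ^+ n) z d.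
Proof.
elim: n => [|n [d ih]].
  by exists 0; exact: (cder_cst 1 z).
exists (1 * z ^+ n + z * d).
rewrite (_ : (fun w => _) = fun w => w * w ^+ n); last by apply/funext => w; rewrite exprS.
by apply: cderM => //; exact: cder_id.
Qed.

Lemma damped_cder s u : sector u -> exists d, cder (damped s) u d.
Proof.
move=> su; have [->|u0] := eqVneq u 0.
  (* At 0 the factor [u] itself supplies the Caratheodory quotient, so continuity of [k] there is
     enough. *)
  exists (2 * (k (0 ^+ 2) * cexp (- (s%:C * omega) * 0 ^+ 3))).
  exists (fun w => 2 * (k (w ^+ 2) * cexp (- (s%:C * omega) * w ^+ 3))); split => //.
    by move=> w; rewrite /damped; ring.
  apply: ccontM; first exact: ccont_cst.
  apply: ccontM.
    by apply: (ccont_comp (f := k)); [rewrite expr0n; exact: k0|exact: ccontX].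
  apply: (ccont_comp (f := @cexp R)); first exact: ccont_cexp.
  by apply: ccontM; [exact: ccont_cst|exact: ccontX].
have [a b] := sector_sqr su.
have [d1 h1] := kD a b (expf_neq0 2 u0).
have [d2 h2] := cderX 2 u; have [d3 h3] := cderX 3 u.
eexists; rewrite /damped; apply: cderM; first by apply: cderZ; exact: cder_id.
apply: cderM; first exact: (cder_comp (f := k) (g := fun w => w ^+ 2) h1 h2).
by apply: (cder_comp (f := @cexp R)); [exact: cder_cexp|apply: cderZ; exact: h3].
Qed.

(** The damped integrand on the ray of direction [c ^+ 2] in the [z] plane, with [x] the length
    along it: [u] is [c] times the square root of [x], and [u ^+ 3] is [c ^+ 3] times
    [x * Num.sqrt x]. *)
Definition ray_damped (s : R) (c : C) (x : R) : C :=
  k (c ^+ 2 * x%:C) * cexp (- (s%:C * omega) * c ^+ 3 * (x * Num.sqrt x)%:C).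

Lemma ray_sector c (x : R) : sector c -> 0 <= x -> sector (c * x%:C).
Proof.
case: c => p q su x0; have [q0 qp] : 0 <= q /\ q <= p by apply/andP.
rewrite /sector !ReImE /=.
by rewrite !mulr0 subr0 add0r mulr_ge0//= ler_wpM2r.
Qed.

Lemma ray_quadrant c (x : R) : sector c -> 0 <= x ->
  0 <= Re (c ^+ 2 * x%:C) /\ 0 <= Im (c ^+ 2 * x%:C).
Proof.
move=> sc x0; have [a b] := sector_sqr sc.
move: (c ^+ 2) a b => w a b.
by rewrite !ReImE /= !mulr0 subr0 add0r; split; exact: mulr_ge0.
Qed.

Lemma ray_damped_cont s c (x : R) : sector c -> 0 <= x -> rcont (ray_damped s c) x.
Proof.
move=> sc x0; have [a b] := ray_quadrant sc x0.
apply: rcontM.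
  apply: (rcont_comp (f := k)); first exact: k_cont.
  by apply: rcontM; [exact: rcont_cst|exact: rcont_id].
apply: rcont_cexp; apply: rcontM; first exact: rcont_cst.
apply: rcont_real; apply: cvgM; first exact: cvg_id.
exact: sqrt_continuous.
Qed.

(** The substitution [x = (L * t) ^+ 2] undoes [z = u ^+ 2] along a ray from the origin. *)
Lemma segint_ray s c (L : R) : sector c -> 0 < L ->
  segint (damped s) 0 (c * L%:C) = c ^+ 2 * cint 0 (L ^+ 2) (ray_damped s c).
Proof.
move=> sc L0.
pose F (t : R) := (L * t) ^+ 2; pose F' (t : R) := 2 * L ^+ 2 * t.
have Fmono : {in `[0, 1] &, {homo F : x y / x < y}}.
  move=> x y; rewrite !in_itv /= => /andP[x0 _] /andP[y0 _] xy.
  have L0' := ltW L0.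
  by rewrite /F ltr_pXn2r ?nnegrE ?mulr_ge0// ltr_pM2l.
have Fder (x : R) : is_derive x 1 F (F' x).
  have dl : is_derive x 1 (fun t => L * t) L.
    by have h := is_deriveZ L (is_derive_id x 1); apply: (is_derive_eq h); rewrite /GRing.scale /= mulr1.
  have h := is_deriveM dl dl; apply: (is_derive_eq h).
  by rewrite /F' /GRing.scale /=; ring.
have Fcont : continuous F' by move=> x; apply: cvgMl_tmp; exact: cvg_id.
have Gcont x : F 0 <= x <= F 1 -> rcont (ray_damped s c) x.
  move=> /andP[x0 _]; apply: ray_damped_cont => //.
  by apply: le_trans x0; exact: sqr_ge0.
have := cint_subst ler01 Fmono Fder Fcont Gcont.
rewrite {1 2}/F mulr0 expr0n mulr1 /= => ->.
rewrite /segint subr0.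
rewrite -[in RHS]cintegralZ//; last first.
  apply: rcont_integrable => t /andP[t0 t1]; apply: rcontM.
    have [c1 c2] : ctends (nbhs t) (fun t => (F t)%:C) (F t)%:C.
      apply: ctendsR; rewrite /F expr2; under eq_fun do rewrite expr2.
      by apply: cvgM; apply: cvgMl_tmp; exact: cvg_id.
    have [a b] := ray_damped_cont s sc (sqr_ge0 (L * t)).
    by split; [exact: (cvg_comp _ _ c1 a)|exact: (cvg_comp _ _ c1 b)].
  by apply: rcont_real; exact: Fcont.
rewrite -[in LHS]cintegralZ//; last first.
  apply: segint_integrable => t /andP[t0 t1].
  have [|d] := @damped_cder s (on_segment 0 (c * L%:C) t); last exact: cder_cont.
  rewrite /on_segment add0r subr0 mulrC -mulrA -rmorphM.
  by apply: ray_sector => //; rewrite mulr_ge0// ltW.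
apply: eq_cintegral => t; rewrite /= in_itv /= => /andP[t0 t1].
rewrite /on_segment add0r subr0 /damped /ray_damped /F /F'.
rewrite sqrtr_sqr ger0_norm; last by rewrite mulr_ge0// ltW.
rewrite (_ : (t%:C * (c * L%:C)) ^+ 2 = c ^+ 2 * ((L * t) ^+ 2)%:C); last first.
  by rewrite rmorphXn rmorphM /=; ring.
rewrite (_ : - (s%:C * omega) * (t%:C * (c * L%:C)) ^+ 3 =
    - (s%:C * omega) * c ^+ 3 * ((L * t) ^+ 2 * (L * t))%:C); last first.
  by rewrite [in RHS]rmorphM rmorphXn rmorphM /=; ring.
have -> : (2 * L ^+ 2 * t)%:C = 2 * (L%:C * L%:C) * t%:C.
  by rewrite expr2 !rmorphM rmorph_nat.
set X := k _; set Y := cexp _; ring.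
Qed.

Lemma rcont_on_cmeasurable (D : set (measurableTypeR R)) (f : R -> C) :
  measurable D -> (forall x, D x -> rcont f x) -> cmeasurable D f.
Proof.
move=> mD cf; split; apply: subspace_continuous_measurable_fun => //;
  by apply: continuous_in_subspaceT => x /set_mem /cf [].
Qed.

(** Puts truncated integrals on the fixed domain [[0, +oo[], where dominated convergence applies. *)
Lemma cint_indic (b : R) (f : R -> C) :
  cintegral leb `[0, +oo[ (fun x => f x * (\1_(`]-oo, b]%classic : set R) x)%:C) = cint 0 b f.
Proof.
have E : `[0, b]%classic = `[0, +oo[ `&` `]-oo, b] :> set R.
  by apply/seteqP; split => x /=; rewrite !in_itv/= ?andbT; [move=> /andP[]|move=> [-> ->]].
rewrite /cint E; apply: complexP => /=.
  rewrite Rintegral_mkcondr; apply: eq_Rintegral => x _.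
  (* Outside the restriction a patched function has the default value [point], which is 0 in [R]. *)
  rewrite patchE indicE !ReImE /= -[point]/(0 : R).
  by case: (x \in _) => /=; ring.
rewrite Rintegral_mkcondr; apply: eq_Rintegral => x _.
rewrite patchE indicE !ReImE /= -[point]/(0 : R).
  by case: (x \in _) => /=; ring.
Qed.

Lemma ray_damped_le s c (x : R) : 0 <= s -> sector c -> 0 <= x ->
  cnorm (ray_damped s c x) <= cnorm (k (c ^+ 2 * x%:C)).
Proof.
move=> s0 sc x0; rewrite /ray_damped cnormM ler_piMr ?cnorm_ge0//.
rewrite cnorm_cexp -expR0 ler_expR.
move: (c ^+ 3) (omega_cube sc) => W h.
have -> : Re (- (s%:C * omega) * W * (x * Num.sqrt x)%:C) =
    - (s * Re (omega * W) * (x * Num.sqrt x)).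
  by rewrite !ReImE /=; ring.
rewrite oppr_le0 mulr_ge0 ?mulr_ge0 ?sqrtr_ge0//.
apply: le_trans h; rewrite exprn_ge0//.
by move: sc => /andP[a b]; exact: le_trans a b.
Qed.

Lemma inv_succ_cvg : (n.+1%:R^-1 : R) @[n --> \oo] --> (0 : R).
Proof. exact: cvg_harmonic. Qed.

(** Damping and radius are coupled: s = 1 / (n + 1) and r = (n + 1)^2, so that on the far side s r^3
    = (n + 1)^5 beats the growth exponent, of size (n + 1)^4. On the rays themselves [k] dominates.
    The factor [l] is the ratio between the length of an edge of the triangle and r. *)
Lemma ray_limit c (l : R) : sector c -> 0 < l ->
  cintegrable leb `[0, +oo[ (fun x => k (c ^+ 2 * x%:C)) ->
  ctends \oo (fun n => cint 0 ((n.+1%:R ^+ 2 * l) ^+ 2) (ray_damped (n.+1%:R^-1) c))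
    (cintegral leb `[0, +oo[ (fun x => k (c ^+ 2 * x%:C))).
Proof.
move=> sc l0 ik.
have D0 x : `[0, +oo[%classic x -> 0 <= x :> R by rewrite /= in_itv /= andbT.
under eq_fun do rewrite -cint_indic.
have mD : measurable (`[0, +oo[%classic : set (measurableTypeR R)) by [].
apply: (cintegral_dct mD (g := fun x => cnorm (k (c ^+ 2 * x%:C)))) => //.
- move=> n; apply: cmeasurableM.
    by apply: rcont_on_cmeasurable => // x /D0; exact: ray_damped_cont.
  by split => /=; [apply: measurable_funTS; exact: measurable_indic|].
- exact: (cintegrable_cmeasurable ik).
- exact: cintegrable_cnorm.
- move=> n x /D0 x0; rewrite cnormM cnormR indicE.
  apply: (@le_trans _ _ (cnorm (ray_damped n.+1%:R^-1 c x))).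
    by rewrite ler_piMr ?cnorm_ge0//; case: (_ \in _); rewrite ?normr1 ?normr0.
  exact: ray_damped_le.
- move=> x /D0 x0; rewrite -[X in ctends _ _ X]mulr1; apply: ctendsM; last first.
    apply: (ctends_near (f := fun=> 1)); last exact: ctends_cst.
    have x1 : 0 <= x / l ^+ 2 by rewrite divr_ge0// sqr_ge0.
    exists (Num.bound (x / l ^+ 2)) => // n /= hn.
    rewrite indicE mem_set//= in_itv /=.
    have h1 := archi_boundP x1.
    have h2 : (Num.bound (x / l ^+ 2))%:R <= n.+1%:R :> R by rewrite ler_nat (leq_trans hn).
    have h3 : n.+1%:R <= n.+1%:R ^+ 4 :> R by rewrite ler_eXnr// ler1n.
    rewrite exprMn -exprM -ler_pdivrMr ?exprn_gt0//.
    by apply: le_trans h3; apply: le_trans h2; exact: ltW.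
  rewrite -[X in ctends _ _ X]mulr1; apply: ctendsM; first exact: ctends_cst.
  rewrite -(cexp0 R); apply: (ctends_comp (f := @cexp R)); first exact: ccont_cexp.
  rewrite -(mul0r ((x * Num.sqrt x)%:C)); apply: ctendsM; last exact: ctends_cst.
  rewrite -(mul0r (c ^+ 3)); apply: ctendsM; last exact: ctends_cst.
  rewrite -oppr0; apply: ctendsN; rewrite -(mul0r omega); apply: ctendsM; last exact: ctends_cst.
  by apply: ctendsR; exact: inv_succ_cvg.
Qed.

(** Comes from exp x = exp (x / 2)^2 and exp (x / 2) >= x / 2. *)
Lemma expRN_le (x : R) : 0 < x -> expR (- x) <= 4 / x ^+ 2.
Proof.
move=> x0; rewrite expRN -[leRHS]invrK lef_pV2 ?posrE ?expR_gt0 ?invr_gt0 ?divr_gt0 ?exprn_gt0//.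
rewrite invf_div; have -> : x ^+ 2 / 4 = (x / 2) ^+ 2 by field.
have -> : expR x = expR (x / 2) ^+ 2.
  by rewrite expr2 -expRD; congr expR; field.
rewrite ler_pXn2r ?nnegrE ?expR_ge0 ?divr_ge0 ?(ltW x0)//.
by apply: le_trans (expR_ge1Dx _); lra.
Qed.

(** On the vertical side [Re u = r] and |u|^2 <= 2 r^2, so [k (u ^+ 2)] contributes at most exp (2 B
    r^2), while [omega_cube] gives the damping exp (- s r^3). *)
Lemma far_side_le s (r : R) : 0 <= s -> 0 < r ->
  cnorm (segint (damped s) r%:C (r +i* r)) <= 8 * r ^+ 2 * M * expR (2 * B * r ^+ 2 - s * r ^+ 3).
Proof.
move=> s0 r0.
have sr : sector r%:C by rewrite /sector /= lexx ltW.
have srr : sector (r +i* r) by rewrite /sector /= lexx ltW.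
have st (t : R) : 0 <= t <= 1 -> sector (on_segment r%:C (r +i* r) t) by exact: sector_convex.
have -> : 8 * r ^+ 2 * M * expR (2 * B * r ^+ 2 - s * r ^+ 3) =
   2 * (4 * r * M * expR (2 * B * r ^+ 2 - s * r ^+ 3)) * cnorm ((r +i* r) - r%:C).
  have -> : (r +i* r) - r%:C = 'i * r%:C by apply: complexP; rewrite !ReImE /=; ring.
  rewrite cnormM cnormR gtr0_norm//.
  have -> : cnorm ('i : C) = 1 by rewrite /cnorm /= expr0n expr1n add0r sqrtr1.
  ring.
apply: segint_le => [t /st /(damped_cder s)[d]|t t01]; first exact: cder_cont.
have /andP[t0 t1] := t01.
have := st t t01; set u := on_segment _ _ _ => su.
have Reu : Re u = r by rewrite /u /on_segment !ReImE /=; ring.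
have Imu : Im u = t * r by rewrite /u /on_segment !ReImE /=; ring.
have u1 : cnorm u ^+ 2 <= 2 * r ^+ 2.
  rewrite cnorm_sqr Reu Imu exprMn.
  have : t ^+ 2 <= 1 by rewrite expr_le1.
  by have := sqr_ge0 r; nra.
have u2 : cnorm u <= 2 * r.
  rewrite -(ler_pXn2r (n := 2)) ?nnegrE ?cnorm_ge0 ?mulr_ge0 ?(ltW r0)// exprMn.
  by apply: le_trans u1 _; have := sqr_ge0 r; nra.
rewrite /damped cnormM (cnormM 2) (cnormM (k _)) (_ : cnorm 2 = 2); last first.
  by rewrite -(rmorph_nat (real_complex R)) cnormR ger0_norm.
have [a b] := sector_sqr su.
have -> : 4 * r * M * expR (2 * B * r ^+ 2 - s * r ^+ 3) =
  2 * (2 * r) * (M * expR (B * (2 * r ^+ 2)) * expR (- (s * r ^+ 3))).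
  by rewrite -[M * _ * _]mulrA -expRD (_ : B * _ - _ = 2 * B * r ^+ 2 - s * r ^+ 3); ring.
apply: ler_pM; rewrite ?mulr_ge0 ?cnorm_ge0//; first by rewrite ler_pM2l.
apply: ler_pM; rewrite ?cnorm_ge0//.
  apply: le_trans (kB a b) _; rewrite ler_wpM2l ?growth_ge0// ler_expR ler_wpM2l//.
  by rewrite cnormX.
rewrite cnorm_cexp ler_expR -Reu.
move: (u ^+ 3) (omega_cube su) => W h.
have -> : Re (- (s%:C * omega) * W) = - (s * Re (omega * W)) by rewrite !ReImE /=; ring.
by rewrite lerN2 ler_wpM2l.
Qed.

Lemma far_side_cvg :
  cnorm (segint (damped n.+1%:R^-1) (n.+1%:R ^+ 2)%:C (n.+1%:R ^+ 2 +i* n.+1%:R ^+ 2))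
    @[n --> \oo] --> (0 : R).
Proof.
apply: (@squeeze_cvgr _ _ _ _ (fun=> 0) (fun n => 32 * M * n.+1%:R^-1)); last 2 first.
- exact: cvg_cst.
- by rewrite -(mulr0 (32 * M)); apply: cvgMl_tmp; exact: inv_succ_cvg.
have B1 : 0 <= 2 * B + 1 by rewrite addr_ge0// mulr_ge0.
(* From [2 * B + 1 <= m] on, the exponent 2 B m^4 - m^5 is at most - m^4. *)
exists (Num.bound (2 * B + 1)) => // n hn.
apply/andP; split; first exact: cnorm_ge0.
set m : R := n.+1%:R.
have m1 : 1 <= m by rewrite /m ler1n.
have m0 : 0 < m by exact: lt_le_trans m1.
have Bm : 2 * B + 1 <= m.
  apply: (le_trans (ltW (archi_boundP B1))).
  by rewrite /m ler_nat (leq_trans hn).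
apply: le_trans (far_side_le _ _) _; rewrite ?invr_ge0 ?exprn_gt0 ?(ltW m0)//.
have h : expR (2 * B * (m ^+ 2) ^+ 2 - m^-1 * (m ^+ 2) ^+ 3) <= 4 / (m ^+ 4) ^+ 2.
  apply: le_trans (expRN_le _); last by rewrite exprn_gt0.
  rewrite ler_expR -!exprM.
  have -> : m^-1 * m ^+ (2 * 3) = m * m ^+ 4 by field; rewrite gt_eqF.
  have -> : m ^+ (2 * 2) = m ^+ 4 by [].
  have : (2 * B + 1) * m ^+ 4 <= m * m ^+ 4.
    by apply: ler_wpM2r => //; rewrite exprn_ge0// ltW.
  by move: (m ^+ 4) => v; lra.
apply: le_trans (ler_wpM2l _ h) _.
  by rewrite mulr_ge0 ?growth_ge0// mulr_ge0// sqr_ge0.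
have -> : 8 * (m ^+ 2) ^+ 2 * M * (4 / (m ^+ 4) ^+ 2) = 32 * M * (m ^+ 4)^-1.
  by field; rewrite gt_eqF.
rewrite ler_wpM2l ?mulr_ge0 ?growth_ge0// lef_pV2 ?posrE ?exprn_gt0//.
by rewrite ler_eXnr.
Qed.

(** The triangle 0, r, r + i r in the [u] plane has its two sides through 0 on the edges of the
    sector, that is, on the positive real and imaginary axes in [z]; the third side tends to 0. *)
Theorem quadrant_rotation :
  cintegrable leb `[0, +oo[ (fun x => k x%:C) ->
  cintegrable leb `[0, +oo[ (fun x => k ('i * x%:C)) ->
  cintegral leb `[0, +oo[ (fun x => k x%:C) =
  'i * cintegral leb `[0, +oo[ (fun x => k ('i * x%:C)).
Proof.
move=> i1 i2.
(* The unit vector of argument pi / 4, the square root of ['i] in the sector. *)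
pose c : C := (1 +i* 1) * ((Num.sqrt 2)^-1)%:C.
have s20 : 0 < Num.sqrt 2 :> R by rewrite sqrtr_gt0.
have c2 : c ^+ 2 = 'i.
  rewrite /c exprMn -rmorphXn /= exprVn sqr_sqrtr//.
  by apply: complexP; rewrite expr2 !ReImE /=; field.
have s1 : sector 1 by rewrite /sector /= lexx ler01.
have sc : sector c by apply: ray_sector; rewrite ?/sector /= ?lexx ?ler01// invr_ge0 ltW.
have E1 : (fun x : R => k (1 ^+ 2 * x%:C)) = fun x => k x%:C.
  by apply/funext => x; rewrite expr1n mul1r.
have i1' : cintegrable leb `[0, +oo[ (fun x => k (1 ^+ 2 * x%:C)).
  by rewrite E1.
have i2' : cintegrable leb `[0, +oo[ (fun x => k (c ^+ 2 * x%:C)).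
  by rewrite c2.
have L1 := ray_limit s1 ltr01 i1'.
have L2 := ray_limit sc s20 i2'.
rewrite E1 in L1; rewrite c2 in L2.
have E n : cint 0 ((n.+1%:R ^+ 2 * 1) ^+ 2) (ray_damped n.+1%:R^-1 1) -
    'i * cint 0 ((n.+1%:R ^+ 2 * Num.sqrt 2) ^+ 2) (ray_damped n.+1%:R^-1 c) =
    - segint (damped n.+1%:R^-1) (n.+1%:R ^+ 2)%:C (n.+1%:R ^+ 2 +i* n.+1%:R ^+ 2).
  set s := n.+1%:R^-1; set r : R := n.+1%:R ^+ 2.
  have r0 : 0 < r by rewrite exprn_gt0.
  have sr : sector r%:C by rewrite /sector /= lexx ltW.
  have srr : sector (r +i* r) by rewrite /sector /= lexx ltW.
  have s0 : sector 0 by rewrite /sector /= lexx.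
  have := segint_ray s s1 (mulr_gt0 r0 ltr01); rewrite expr1n !mul1r => <-.
  have := segint_ray s sc (mulr_gt0 r0 s20); rewrite c2 => <-.
  have -> : c * (r * Num.sqrt 2)%:C = r +i* r.
    rewrite /c -mulrA -rmorphM /= mulrCA mulVf ?gt_eqF// mulr1.
    by apply: complexP; rewrite !ReImE /=; ring.
  have := @goursat_triangle R sector sector_convex sector_closed (damped s) (damped_cder s) (0, r%:C, (r +i* r)).
  rewrite /triint /= (segint_rev (a := 0) (b := r +i* r)); last first.
    move=> t t01; have [d] := damped_cder s (sector_convex s0 srr t01); exact: cder_cont.
  rewrite mulr1 => H.
  have {}H := H (And3 s0 sr srr); move: H.
  move: (segint _ _ _) (segint _ _ _) (segint _ _ _) => x y z H.
  by apply/eqP; rewrite -subr_eq0 opprK; apply/eqP; rewrite -[RHS]H; ring.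
move: E L1 L2.
set I1 := cintegral _ _ _; set I2 := cintegral _ _ _.
set a := (fun n => cint 0 ((n.+1%:R ^+ 2 * 1) ^+ 2) _).
set b := (fun n => cint 0 ((n.+1%:R ^+ 2 * Num.sqrt 2) ^+ 2) _) => E L1 L2.
have L : ctends \oo (fun n => a n - 'i * b n) (I1 - 'i * I2).
  by apply: ctendsB => //; apply: ctendsM => //; exact: ctends_cst.
have Ln : cnorm (a n - 'i * b n) @[n --> \oo] --> cnorm (I1 - 'i * I2).
  exact: ctends_cnorm.
have L0 : cnorm (a n - 'i * b n) @[n --> \oo] --> (0 : R).
  by under eq_fun do rewrite E cnormN; exact: far_side_cvg.
have : cnorm (I1 - 'i * I2) = 0.
  by rewrite -(cvg_lim (@Rhausdorff R) Ln) (cvg_lim (@Rhausdorff R) L0).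
by move/eqP; rewrite cnorm_eq0 subr_eq0 => /eqP.
Qed.

End Quadrant.

(** * Integrals over the real line *)

Section Line.
Variable R : realType.
Local Notation C := R[i].
Local Notation Re := complex.Re.
Local Notation Im := complex.Im.
Local Notation leb := (@lebesgue_measure R).

Lemma integrable_half_opp (f : R -> R) :
  leb.-integrable setT (EFin \o f) -> leb.-integrable `[0, +oo[ (fun x => (f (- x))%:E).
Proof.
move=> fi; have /integrableP[/measurable_EFinP mf ffin] := fi.
have mf' : measurable_fun (setT : set (measurableTypeR R)) (fun x : R => f (- x)).
  exact: measurableT_comp mf (@oppr_measurable _ setT).
apply/integrableP; split; first exact/measurable_EFinP/measurable_funTS.
rewrite (@ge0_integration_by_substitution0 R (fun x => `|(f (- x))%:E|)%E)//; last first.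
  by apply: measurableT_comp => //; exact/measurable_EFinP.
apply: le_lt_trans ffin; under eq_integral do rewrite opprK.
apply: ge0_subset_integral => //; apply: measurableT_comp => //.
exact/measurable_EFinP.
Qed.

Lemma integrable_opp (f : R -> R) :
  leb.-integrable setT (EFin \o f) -> leb.-integrable setT (fun x => (f (- x))%:E).
Proof.
move=> fi; have /integrableP[/measurable_EFinP mf _] := fi.
have mf' : measurable_fun (setT : set (measurableTypeR R)) (fun x : R => f (- x)).
  exact: measurableT_comp mf (@oppr_measurable _ setT).
have /integrableP[_ ffin] := fi.
apply/integrableP; split; first exact/measurable_EFinP.
pose g := (fun x : R => `|(f x)%:E|)%E.
have mg : measurable_fun (setT : set (measurableTypeR R)) g.
  by apply: measurableT_comp => //; exact/measurable_EFinP.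
have -> : (\int[leb]_x `|(f (- x))%:E| = \int[leb]_x g x)%E.
  transitivity (\int[pushforward leb (-%R : _ -> measurableTypeR R)]_x g x)%E.
    have mo : measurable_fun (setT : set (measurableTypeR R)) (-%R : _ -> measurableTypeR R).
      exact: oppr_measurable.
    by rewrite (@ge0_integral_pushforward _ _ _ _ _ _ mo leb setT g measurableT mg) //= => x _; exact: abse_ge0.
  by apply: eq_measure_integral => //= A mA _; exact: lebesgue_measureN.
exact: ffin.
Qed.

Lemma Rintegral_half_opp (f : R -> R) : leb.-integrable setT (EFin \o f) ->
  (\int[leb]_(x in `]-oo, 0]) f x)%R = (\int[leb]_(x in `[0, +oo[) f (- x))%R.
Proof.
move=> fi; have /integrableP[mf _] := fi.
rewrite /Rintegral; congr fine; rewrite integralE [RHS]integralE.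
have aux (g : R -> \bar R) : measurable_fun (setT : set (measurableTypeR R)) g -> (forall x, 0 <= g x)%E ->
    (\int[leb]_(x in `]-oo, 0%R]) g x = \int[leb]_(x in `[0%R, +oo[) g (- x)%R)%E.
  move=> mg g0; rewrite (@ge0_integration_by_substitution0 R (fun x => g (- x)))//.
    by apply: eq_integral => x _; rewrite opprK.
  exact: measurableT_comp.
congr (_ - _)%E.
  rewrite aux; [by apply: eq_integral => x _; rewrite ?unlock|exact: measurable_funepos|].
  by move=> x; exact: funepos_ge0.
rewrite aux; [by apply: eq_integral => x _; rewrite ?unlock|exact: measurable_funeneg|].
by move=> x; exact: funeneg_ge0.
Qed.

Lemma Rintegral_line (f : R -> R) : leb.-integrable setT (EFin \o f) ->
  (\int[leb]_x f x)%R =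
  (\int[leb]_(x in `[0, +oo[) f x)%R + (\int[leb]_(x in `[0, +oo[) f (- x))%R.
Proof.
move=> fi; have E : setT = `]-oo, 0[ `|` `[0, +oo[ :> set (measurableTypeR R).
  by apply/seteqP; split => // x _ /=; rewrite !in_itv/= andbT; case: ltP; [left|right].
rewrite -Rintegral_half_opp// {1}E Rintegral_setU//.
- by rewrite addrC Rintegral_itv_bndo_bndc//; exact: integrableS fi.
- by rewrite -E.
- apply/disj_setPS => x [] /=; rewrite !in_itv/= andbT => h1 h2.
  by move: (lt_le_trans h1 h2); rewrite ltxx.
Qed.

Lemma cintegrableS (D E : set (measurableTypeR R)) (f : R -> C) :
  measurable D -> measurable E -> D `<=` E -> cintegrable leb E f -> cintegrable leb D f.
Proof. by move=> mD mE DE [a b]; split; exact: integrableS DE _. Qed.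

Lemma cintegrable_half_opp (f : R -> C) : cintegrable leb setT f ->
  cintegrable leb `[0, +oo[ (fun x => f (- x)).
Proof.
move=> [a b]; split; first exact: (integrable_half_opp (f := fun x => Re (f x))).
exact: (integrable_half_opp (f := fun x => Im (f x))).
Qed.

Lemma cintegral_line (f : R -> C) : cintegrable leb setT f ->
  cintegral leb setT f =
  cintegral leb `[0, +oo[ f + cintegral leb `[0, +oo[ (fun x => f (- x)).
Proof.
move=> [a b]; apply: complexP; rewrite ReImE /=.
  exact: (Rintegral_line (f := fun x => Re (f x))).
exact: (Rintegral_line (f := fun x => Im (f x))).
Qed.

(** A standard integrable majorant on the line; its exact integral is also what produces [f 0] in
    [transform_reproducing]. *)
Definition cauchy_weight (x : R) : R := (1 + x ^+ 2)^-1.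

Lemma cauchy_weight_gt0 x : 0 < cauchy_weight x.
Proof. by rewrite invr_gt0 ltr_wpDr// sqr_ge0. Qed.

Lemma cauchy_weight_cont : continuous cauchy_weight.
Proof. exact: (@continuous_oneDsqrV R). Qed.

Lemma integral_cauchy_weight : (\int[leb]_x (cauchy_weight x)%:E = pi%:E)%E.
Proof.
rewrite ge0_symfun_integralT//.
- by rewrite -set_itvcy integral0y_oneDsqr -EFinM; congr EFin; field.
- by move=> x; rewrite ltW// cauchy_weight_gt0.
- exact: cauchy_weight_cont.
- by move=> x; rewrite /cauchy_weight /= sqrrN.
Qed.

Lemma cauchy_weight_integrable : leb.-integrable setT (EFin \o cauchy_weight).
Proof.
apply/integrableP; split.
  by apply/measurable_EFinP; apply: continuous_measurable_fun; exact: cauchy_weight_cont.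
under eq_integral do rewrite /= ger0_norm ?ltW ?cauchy_weight_gt0//.
by rewrite integral_cauchy_weight ltry.
Qed.

(** Square 1 + t <= exp t at t = a y / 2; the summand [4 / a ^+ 2] compensates the coefficient of
    y^2. *)
Lemma expRN_cauchy_weight (a y : R) : 0 < a -> 0 <= y ->
  expR (- (a * y)) <= (1 + 4 / a ^+ 2) * cauchy_weight y.
Proof.
move=> a0 y0; rewrite expRN /cauchy_weight.
rewrite -[leRHS]invrK invfM invrK lef_pV2 ?posrE ?expR_gt0 ?divr_gt0 ?mulr_gt0 ?invr_gt0//.
- rewrite mulrC ler_pdivrMr.
    have -> : expR (a * y) = expR (a * y / 2) ^+ 2.
      by rewrite expr2 -expRD; congr expR; field.
    have h : 1 + a * y / 2 <= expR (a * y / 2) by exact: expR_ge1Dx.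
    have ay : 0 <= a * y by rewrite mulr_ge0// ltW.
    have h2 : (1 + a * y / 2) ^+ 2 <= expR (a * y / 2) ^+ 2.
      by rewrite ler_pXn2r ?nnegrE ?expR_ge0//; lra.
    apply: (@le_trans _ _ ((1 + a * y / 2) ^+ 2 * (1 + 4 / a ^+ 2))); last first.
      by rewrite ler_wpM2r// addr_ge0// divr_ge0// sqr_ge0.
    have -> : (1 + a * y / 2) ^+ 2 * (1 + 4 / a ^+ 2) =
      1 + y ^+ 2 + (a * y + a ^+ 2 * y ^+ 2 / 4 + 4 / a ^+ 2 * (1 + a * y)).
      by field; rewrite gt_eqF.
    have q1 : 0 <= a ^+ 2 * y ^+ 2 / 4 by rewrite divr_ge0// mulr_ge0// sqr_ge0.
    have q2 : 0 <= 4 / a ^+ 2 * (1 + a * y) by rewrite mulr_ge0 ?addr_ge0// divr_ge0// sqr_ge0.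
    by rewrite lerDl addr_ge0// addr_ge0.
  by rewrite ltr_wpDr// divr_ge0// sqr_ge0.
- by rewrite ltr_wpDr// divr_ge0// sqr_ge0.
- by rewrite ltr_wpDr// sqr_ge0.
Qed.

End Line.

(** * Vanishing of integrals by rotation to the negative imaginary axis *)

Section HalfPlane.
Variable R : realType.
Local Notation C := R[i].
Local Notation Re := complex.Re.
Local Notation Im := complex.Im.
Local Notation leb := (@lebesgue_measure R).

Lemma cnorm_i : cnorm ('i : C) = 1.
Proof. by rewrite /cnorm /= expr0n expr1n add0r sqrtr1. Qed.

Lemma cder_linear (c z : C) : cder (fun w => c * w) z c.
Proof. by have := cderZ c (cder_id z); rewrite mulr1. Qed.

Lemma mulii : 'i * 'i = -1 :> C.
Proof. by rewrite -expr2 sqr_i. Qed.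

(** Both halves of the real line are rotated to the negative imaginary axis, where their
    contributions are opposite multiples of one integral. *)
Lemma lower_half_plane_integrable (k : C -> C) (M B : R) : 0 <= B ->
  (forall z, Im z <= 0 -> z != 0 -> exists d, cder k z d) -> ccont k 0 ->
  (forall z, Im z <= 0 -> cnorm (k z) <= M * expR (B * cnorm z)) ->
  cintegrable leb setT (fun x => k x%:C) ->
  cintegrable leb `[0, +oo[ (fun y => k (- 'i * y%:C)) ->
  cintegral leb setT (fun x => k x%:C) = 0.
Proof.
move=> B0 kD k0 kB ik ii.
have D0 x : `[0, +oo[%classic x -> 0 <= x :> R by rewrite /= in_itv /= andbT.
have mD : measurable (`[0, +oo[%classic : set (measurableTypeR R)) by [].
have ik1 : cintegrable leb `[0, +oo[ (fun x => k x%:C) by apply: cintegrableS ik.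
have ik2 : cintegrable leb `[0, +oo[ (fun x => k (- x)%:C) by exact: (cintegrable_half_opp ik).
(* Multiplication by [t] carries the first quadrant to the lower right one for [t = - 'i] and to the
   lower left one for [t = -1]. *)
have rot (t : C) : cnorm t = 1 ->
    (forall z, 0 <= Re z -> 0 <= Im z -> Im (t * z) <= 0) ->
    cintegrable leb `[0, +oo[ (fun x => k (t * x%:C)) ->
    cintegrable leb `[0, +oo[ (fun x => k (t * 'i * x%:C)) ->
    cintegral leb `[0, +oo[ (fun x => k (t * x%:C)) =
    'i * cintegral leb `[0, +oo[ (fun x => k (t * 'i * x%:C)).
  move=> t1 tq i1 i2.
  have t0 : t != 0 by rewrite -cnorm_eq0 t1 oner_eq0.
  have := @quadrant_rotation R (fun z => k (t * z)) M B B0.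
  rewrite (_ : (fun x : R => k (t * ('i * x%:C))) = fun x => k (t * 'i * x%:C)); last first.
    by apply/funext => x; rewrite mulrA.
  apply => //.
  - move=> z a b z0; have [|d kd] := kD (t * z) (tq _ a b); first by rewrite mulf_neq0.
    by exists (d * t); apply: (cder_comp (f := k)) kd (cder_linear _ _).
  - apply: (ccont_comp (f := k)); first by rewrite mulr0.
    exact: cder_cont (cder_linear _ _).
  - by move=> z a b; have := kB (t * z) (tq _ a b); rewrite cnormM t1 mul1r.
have r1 := rot (- 'i); have r2 := rot (-1).
rewrite (cintegral_line ik).
have -> : cintegral leb `[0, +oo[ (fun x => k x%:C) =
    - ('i * cintegral leb `[0, +oo[ (fun x => k (- 'i * x%:C))).
  have E : (fun x : R => k (- 'i * 'i * x%:C)) = fun x => k x%:C.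
    by apply/funext => x; rewrite mulNr mulii opprK mul1r.
  move: r1; rewrite E => -> //.
  - by rewrite mulrA mulii mulN1r opprK.
  - by rewrite cnormN cnorm_i.
  - by move=> z a b; rewrite mulNr !ReImE /=; lra.
have -> : cintegral leb `[0, +oo[ (fun x => k (- x)%:C) =
    'i * cintegral leb `[0, +oo[ (fun x => k (- 'i * x%:C)).
  have E1 : (fun x : R => k (-1 * x%:C)) = fun x => k (- x)%:C.
    by apply/funext => x; rewrite mulN1r rmorphN.
  have E2 : (fun x : R => k (-1 * 'i * x%:C)) = fun x => k (- 'i * x%:C).
    by apply/funext => x; rewrite mulN1r.
  move: r2; rewrite E1 E2 => -> //.
  - by rewrite cnormN -[1]/(1%:C) cnormR normr1.
  - by move=> z a b; rewrite mulN1r !ReImE /= oppr_le0.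
by rewrite addrC subrr.
Qed.

(** Exponential type 0 on the axis does not give integrability there. The factor exp (- i e z) has
    modulus exp (e Im z): it is at most 1 on the half plane, of modulus 1 on the line, and decaying
    on the axis. Dominated convergence then lets e tend to 0. *)
Theorem lower_half_plane (k : C -> C) (M B : R) : 0 <= B ->
  (forall z, Im z <= 0 -> z != 0 -> exists d, cder k z d) -> ccont k 0 ->
  (forall z, Im z <= 0 -> cnorm (k z) <= M * expR (B * cnorm z)) ->
  cintegrable leb setT (fun x => k x%:C) ->
  (forall e : R, 0 < e -> exists A, forall y : R, 0 <= y ->
     cnorm (k (- 'i * y%:C)) <= A * expR (e * y)) ->
  cintegral leb setT (fun x => k x%:C) = 0.
Proof.
move=> B0 kD k0 kB ik kA.
pose ke (e : R) z := k z * cexp (- ('i * e%:C) * z).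
have D0 x : `[0, +oo[%classic x -> 0 <= x :> R by rewrite /= in_itv /= andbT.
have mD : measurable (`[0, +oo[%classic : set (measurableTypeR R)) by [].
have nexp (e : R) z : cnorm (cexp (- ('i * e%:C) * z)) = expR (e * Im z).
  by rewrite cnorm_cexp; congr expR; rewrite !ReImE /=; ring.
have M0 : 0 <= M.
  have := @kB 0 (lexx 0); rewrite cnorm0 mulr0 expR0 mulr1.
  exact: le_trans (cnorm_ge0 _).
have exd (e : R) z : cder (fun z => cexp (- ('i * e%:C) * z)) z (cexp (- ('i * e%:C) * z) * - ('i * e%:C)).
  by apply: (cder_comp (f := @cexp R)); [exact: cder_cexp|exact: cder_linear].
have kr x : rcont (fun x => k x%:C) x.
  apply: (rcont_comp (f := k)); last exact: rcont_id.
  have [->//|x0] := eqVneq x%:C 0; have [|d] := kD x%:C _ x0; first by [].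
  exact: cder_cont.
have bound e x : cnorm (ke e x%:C) <= cnorm (k x%:C).
  by rewrite cnormM nexp /= mulr0 expR0 mulr1.
have mke e : cmeasurable (setT : set (measurableTypeR R)) (fun x : R => ke e x%:C).
  apply: rcont_cmeasurable => // x; apply: rcontM; first exact: kr.
  by apply: rcont_cexp; apply: rcontM; [exact: rcont_cst|exact: rcont_id].
have Z (e : R) : 0 < e -> cintegral leb setT (fun x => ke e x%:C) = 0.
  move=> e0; apply: (@lower_half_plane_integrable (ke e) M B) => //.
  - move=> z z0 zn; have [d kd] := kD z z0 zn.
    by eexists; apply: cderM; [exact: kd|exact: exd].
  - by apply: ccontM => //; exact: cder_cont (exd e 0).
  - move=> z z0; rewrite cnormM nexp (le_trans _ (kB z z0))// ler_piMr ?cnorm_ge0//.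
    by rewrite -expR0 ler_expR pmulr_rle0.
  - apply: (cintegrable_dom _ _ (cintegrable_cnorm _ ik)) => //.
  (* Half of the decay rate [e] absorbs the growth on the axis; the other half makes the product
     integrable. *)
  have e2 : 0 < e / 2 by rewrite divr_gt0.
  have [A HA] := kA _ e2.
  have A0 : 0 <= A.
    have := HA 0 (lexx 0); rewrite !mulr0 expR0 mulr1.
    exact: le_trans (cnorm_ge0 _).
  apply: (@cintegrable_dom R _ _ leb _ mD _ (fun y => A * ((1 + 4 / (e / 2) ^+ 2) * cauchy_weight y))).
  - apply: rcont_on_cmeasurable => // y /D0 y0; apply: rcontM.
      apply: (rcont_comp (f := k)); last by apply: rcontM; [exact: rcont_cst|exact: rcont_id].
      have [->//|yn] := eqVneq (- 'i * y%:C) 0; have [|d] := kD _ _ yn; last exact: cder_cont.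
      by rewrite mulNr !ReImE /=; lra.
    apply: rcont_cexp; apply: rcontM; first exact: rcont_cst.
    by apply: rcontM; [exact: rcont_cst|exact: rcont_id].
  - apply: (integrableS measurableT) => //.
    have h := integrableZl measurableT (A * (1 + 4 / (e / 2) ^+ 2)) (@cauchy_weight_integrable R).
    by apply: eq_integrable h => // x _; rewrite /= -EFinM mulrA.
  - move=> y /D0 y0; rewrite cnormM nexp.
    have -> : Im (- 'i * y%:C) = - y by rewrite mulNr !ReImE /=; ring.
    apply: (@le_trans _ _ (A * expR (e / 2 * y) * expR (e * - y))).
      by rewrite ler_wpM2r ?expR_ge0// HA.
    rewrite -mulrA -expRD ler_wpM2l//.
    have -> : e / 2 * y + e * - y = - (e / 2 * y) by field.
    exact: expRN_cauchy_weight.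
have L : ctends \oo (fun n => cintegral leb setT (fun x => ke n.+1%:R^-1 x%:C))
    (cintegral leb setT (fun x => k x%:C)).
  apply: (@cintegral_dct R _ _ leb setT measurableT (fun n x => ke n.+1%:R^-1 x%:C)
    (fun x => k x%:C) (fun x => cnorm (k x%:C))) => //.
  - exact: (cintegrable_cmeasurable ik).
  - exact: cintegrable_cnorm.
  move=> x _; rewrite -[X in ctends _ _ X]mulr1; apply: ctendsM; first exact: ctends_cst.
  rewrite -(cexp0 R); apply: (ctends_comp (f := @cexp R)); first exact: ccont_cexp.
  rewrite -(mul0r (x%:C)); apply: ctendsM; last exact: ctends_cst.
  rewrite -oppr0; apply: ctendsN; rewrite -(mulr0 ('i : C)); apply: ctendsM; first exact: ctends_cst.
  by apply: ctendsR; exact: inv_succ_cvg.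
have E0 : (fun n => cintegral leb setT (fun x => ke n.+1%:R^-1 x%:C)) = fun=> 0.
  by apply/funext => n; rewrite Z// invr_gt0.
rewrite E0 in L.
case: L => /(cvg_lim (@Rhausdorff R)); rewrite lim_cst// => L1.
move=> /(cvg_lim (@Rhausdorff R)); rewrite lim_cst// => L2.
exact: complexP.
Qed.

End HalfPlane.

(** * Exponential integrals *)

Section StrictDerivative.
Variable R : realType.
Local Notation C := R[i].
Local Notation Re := complex.Re.
Local Notation Im := complex.Im.
Local Notation leb := (@lebesgue_measure R).
Implicit Types (f g : C -> C) (z d e : C).

(** Strict differentiability: both points move. An ordinary derivative at [z] does not control the
    slopes between two points near [z], which occur in the limit at [eta1 = eta2]. *)
Definition sder f z d := forall e : R, 0 < e -> exists2 r : R, 0 < r &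
  forall p q, cnorm (p - z) < r -> cnorm (q - z) < r ->
    cnorm (f q - f p - d * (q - p)) <= e * cnorm (q - p).

Lemma sder_cder f z d : sder f z d -> cder f z d.
Proof.
move=> H; apply: cderI => e e0; have [r r0 Hr] := H e e0; exists r => // w wr.
by apply: Hr; rewrite ?subrr ?cnorm0.
Qed.

Lemma sder_eq f z d e : sder f z d -> d = e -> sder f z e.
Proof. by move=> h <-. Qed.

Lemma sder_cst c z : sder (fun=> c) z 0.
Proof.
move=> e e0; exists 1 => // p q _ _.
by rewrite subrr sub0r mul0r oppr0 cnorm0 mulr_ge0 ?cnorm_ge0// ltW.
Qed.

Lemma sderD f g z d e : sder f z d -> sder g z e -> sder (fun w => f w + g w) z (d + e).
Proof.
move=> Hf Hg k k0; have k2 : 0 < k / 2 by rewrite divr_gt0.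
have [r r0 Hr] := Hf _ k2; have [s s0 Hs] := Hg _ k2.
exists (Num.min r s); first by rewrite lt_min r0.
move=> p q; rewrite !lt_min => /andP[pr ps] /andP[qr qs].
have -> : f q + g q - (f p + g p) - (d + e) * (q - p) =
  (f q - f p - d * (q - p)) + (g q - g p - e * (q - p)) by ring.
rewrite (le_trans (cnormD _ _))// (le_trans (lerD (Hr p q pr qr) (Hs p q ps qs)))//.
by rewrite -mulrDl -splitr.
Qed.

Lemma sderZ c f z d : sder f z d -> sder (fun w => c * f w) z (c * d).
Proof.
move=> Hf k k0; have c1 : 0 < cnorm c + 1 by rewrite ltr_wpDl// cnorm_ge0.
have [r r0 Hr] := Hf _ (divr_gt0 k0 c1); exists r => // p q pr qr.
have -> : c * f q - c * f p - c * d * (q - p) = c * (f q - f p - d * (q - p)) by ring.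
rewrite cnormM; apply: (@le_trans _ _ ((cnorm c + 1) * (k / (cnorm c + 1) * cnorm (q - p)))).
  by apply: ler_pM; rewrite ?cnorm_ge0//; [lra|exact: Hr].
by rewrite mulrA (mulrC (_ + 1)) divfK// gt_eqF.
Qed.

Lemma sder_opp f z d : sder f (- z) d -> sder (fun w => f (- w)) z (- d).
Proof.
move=> Hf e e0; have [r r0 Hr] := Hf e e0; exists r => // p q pr qr.
have N (w : C) : - w - - z = - (w - z) by ring.
have := Hr (- p) (- q); rewrite !N !cnormN => /(_ pr qr).
have -> : - q - - p = - (q - p) by ring.
by rewrite cnormN mulNr mulrN.
Qed.

Lemma sder_sqr z : sder (fun w => w ^+ 2) z (2 * z).
Proof.
move=> e e0; exists (e / 2); first by rewrite divr_gt0.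
move=> p q pr qr.
have -> : q ^+ 2 - p ^+ 2 - 2 * z * (q - p) = ((q - z) + (p - z)) * (q - p) by ring.
rewrite cnormM ler_wpM2r ?cnorm_ge0// (le_trans (cnormD _ _))//.
by rewrite [leRHS]splitr lerD ?ltW.
Qed.

Lemma rcont_bounded (a b : R) (f : R -> C) : (forall x, rcont f x) ->
  exists2 W, 0 <= W & forall x, a <= x <= b -> cnorm (f x) <= W.
Proof.
move=> cf; case: (leP a b) => ab; last first.
  by exists 0 => // x /andP[h1 h2]; move: (lt_le_trans ab (le_trans h1 h2)); rewrite ltxx.
have cn : {within `[a, b], continuous (fun x => cnorm (f x))}.
  by apply: continuous_subspaceT => x; exact: ctends_cnorm (cf x).
have [c _ Hc] := EVT_max ab cn.
exists (cnorm (f c)); first exact: cnorm_ge0.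
by move=> x xab; apply: Hc; rewrite in_itv.
Qed.

(** The two-sided Laplace transform of a weight cut off at [h]. It yields A and B through [coshint],
    and the Fourier transforms of the solution and of the density on the imaginary axis. *)
Definition expint (h : R) (wt : R -> C) (xi : C) : C :=
  cint (- h) h (fun a => wt a * cexp (xi * a%:C)).

Section ExpInt.
Variables (h : R) (wt : R -> C).
Hypothesis h0 : 0 <= h.
Hypothesis wtc : forall x, rcont wt x.

Lemma expint_rcont xi x : rcont (fun a => wt a * cexp (xi * a%:C)) x.
Proof. by apply: rcontM => //; exact: rcont_cexpM. Qed.

Lemma expint_integrable xi : cintegrable leb `[- h, h] (fun a => wt a * cexp (xi * a%:C)).
Proof. by apply: rcont_integrable => x _; exact: expint_rcont. Qed.

Lemma wtmul_rcont x : rcont (fun a => wt a * a%:C) x.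
Proof. by apply: rcontM => //; exact: rcont_id. Qed.

Lemma expint_sder xi : sder (expint h wt) xi (expint h (fun a => wt a * a%:C) xi).
Proof.
have [W W0 HW] := rcont_bounded (- h) h wtc.
pose M := 2 * h * W * (4 * h ^+ 2 * expR ((cnorm xi + 1) * h) * expR (2 * h)
  + 2 * h ^+ 2 * expR (cnorm xi * h) * expR h).
have M0 : 0 <= M by rewrite /M !(mulr_ge0, addr_ge0, expR_ge0, sqr_ge0).
suff key p q : cnorm (p - xi) < 1 -> cnorm (q - xi) < 1 ->
    cnorm (expint h wt q - expint h wt p - expint h (fun a => wt a * a%:C) xi * (q - p)) <=
    2 * M * (cnorm (q - p) * (cnorm (q - p) + cnorm (p - xi))).
  move=> e e0; have M1 : 0 < 6 * M + 1 by rewrite ltr_wpDl// mulr_ge0.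
  (* With both points within a radius r of [xi], the sum [cnorm (q - p) + cnorm (p - xi)] is below 3
     r, whence [6 * M]; the summand 1 keeps the denominator positive. *)
  exists (Num.min 1 (e / (6 * M + 1))); first by rewrite lt_min ltr01 divr_gt0.
  move=> p q; rewrite !lt_min => /andP[p1 pe] /andP[q1 qe].
  apply: le_trans (key p q p1 q1) _; rewrite mulrCA mulrC ler_wpM2r ?cnorm_ge0//.
  have : cnorm (q - p) <= cnorm (q - xi) + cnorm (p - xi).
    by have -> : q - p = (q - xi) - (p - xi); [ring|exact: cnormB].
  move: pe qe; rewrite !ltr_pdivlMr//.
  have := cnorm_ge0 (p - xi); have := cnorm_ge0 (q - xi).
  move: (cnorm (p - xi)) (cnorm (q - xi)) (cnorm (q - p)) => a b c a0 b0 ha hb hc.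
  by nra.
move=> p1 q1; have hh : - h <= h by rewrite ge0_cp.
have wtc' := wtmul_rcont.
(* The first summand is quadratic in [q - p], the second is of size |q - p| |p - xi|; both are small
   against |q - p| when [p] and [q] approach [xi]. *)
have -> : expint h wt q - expint h wt p - expint h (fun a => wt a * a%:C) xi * (q - p) =
  cint (- h) h (fun a => wt a * (cexp (p * a%:C) * (cexp ((q - p) * a%:C) - 1 - (q - p) * a%:C)
     + (q - p) * a%:C * cexp (xi * a%:C) * (cexp ((p - xi) * a%:C) - 1))).
  rewrite mulrC -cintegralZ//; last first.
    by apply: rcont_integrable => x _; apply: rcontM => //; exact: rcont_cexpM.
  rewrite -!cintegralB//; try exact: expint_integrable.
  - apply: eq_cintegral => a _; rewrite !mulrBl !cexpB.
    by field; rewrite !cexp_neq0.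
  - by apply: cintegrableB => //; exact: expint_integrable.
  - apply: rcont_integrable => x _; apply: rcontM; first exact: rcont_cst.
    by apply: rcontM => //; exact: rcont_cexpM.
have cI x : rcont (fun a => wt a * (cexp (p * a%:C) * (cexp ((q - p) * a%:C) - 1 - (q - p) * a%:C)
     + (q - p) * a%:C * cexp (xi * a%:C) * (cexp ((p - xi) * a%:C) - 1))) x.
  have cl c : rcont (fun a : R => c * a%:C) x by apply: rcontM; [exact: rcont_cst|exact: rcont_id].
  apply: rcontM => //; apply: rcontD.
    apply: rcontM; first exact: rcont_cexpM.
    by apply: rcontB => //; apply: rcontB; [exact: rcont_cexpM|exact: rcont_cst].
  apply: rcontM; first by apply: rcontM => //; exact: rcont_cexpM.
  by apply: rcontB; [exact: rcont_cexpM|exact: rcont_cst].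
pose d := cnorm (q - p); pose b := cnorm (p - xi).
have d0 : 0 <= d by exact: cnorm_ge0.
have b0 : 0 <= b by exact: cnorm_ge0.
have d2 : d <= 2.
  rewrite /d (_ : q - p = (q - xi) - (p - xi)); last by ring.
  by apply: le_trans (cnormB _ _) _; move: p1 q1; lra.
have pb : cnorm p <= cnorm xi + 1.
  have -> : p = xi + (p - xi) by ring.
  by rewrite (le_trans (cnormD _ _))// lerD2l ltW.
pose K := 4 * h ^+ 2 * expR ((cnorm xi + 1) * h) * expR (2 * h)
  + 2 * h ^+ 2 * expR (cnorm xi * h) * expR h.
have K0 : 0 <= K by rewrite /K !(mulr_ge0, addr_ge0, expR_ge0, sqr_ge0).
apply: le_trans (cnorm_cint_le (M := W * (K * (d * (d + b)))) hh _ _) _.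
- by apply: rcont_integrable => x _; exact: cI.
- move=> x xh; have xh' : `|x| <= h by rewrite ler_norml.
  have sc (c : C) (m : R) : cnorm c <= m -> cnorm (c * x%:C) <= m * h.
    by move=> cm; rewrite cnormM cnormR; apply: ler_pM => //; exact: cnorm_ge0.
  have se (c : C) (m : R) : cnorm c <= m -> expR (cnorm (c * x%:C)) <= expR (m * h).
    by move=> cm; rewrite ler_expR; exact: sc.
  rewrite cnormM; apply: ler_pM; rewrite ?cnorm_ge0 ?HW//.
  have t1 : cnorm (cexp (p * x%:C) * (cexp ((q - p) * x%:C) - 1 - (q - p) * x%:C)) <=
      expR ((cnorm xi + 1) * h) * (4 * (d * h) ^+ 2 * expR (2 * h)).
    rewrite cnormM; apply: ler_pM; rewrite ?cnorm_ge0//.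
      by apply: le_trans (cnorm_cexp_le _) _; exact: se.
    apply: le_trans (cexp_sub1l_le _) _; apply: ler_pM; rewrite ?expR_ge0//.
    - by apply: mulr_ge0 => //; exact: sqr_ge0.
    - by rewrite ler_pM2l// ler_pXn2r ?nnegrE ?cnorm_ge0 ?mulr_ge0//; exact: sc.
    - exact: se.
  have t2 : cnorm ((q - p) * x%:C * cexp (xi * x%:C) * (cexp ((p - xi) * x%:C) - 1)) <=
      d * h * expR (cnorm xi * h) * (2 * (b * h) * expR h).
    rewrite cnormM; apply: ler_pM; rewrite ?cnorm_ge0//.
      rewrite cnormM; apply: ler_pM; rewrite ?cnorm_ge0//; first exact: sc.
      by apply: le_trans (cnorm_cexp_le _) _; exact: se.
    apply: le_trans (cexp_sub1_le _) _; apply: ler_pM; rewrite ?mulr_ge0 ?cnorm_ge0 ?expR_ge0//.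
      by rewrite ler_pM2l//; exact: sc.
    by rewrite -[in leRHS](mul1r h); apply: se; exact: ltW.
  apply: le_trans (cnormD _ _) _; apply: le_trans (lerD t1 t2) _.
  have -> : K * (d * (d + b)) = expR ((cnorm xi + 1) * h) * (4 * (d * h) ^+ 2 * expR (2 * h)) +
     d * h * expR (cnorm xi * h) * (2 * (b * h) * expR h) +
     (4 * h ^+ 2 * expR ((cnorm xi + 1) * h) * expR (2 * h) * (d * b) +
      2 * h ^+ 2 * expR (cnorm xi * h) * expR h * d ^+ 2) by rewrite /K; ring.
  by rewrite lerDl !(mulr_ge0, addr_ge0, expR_ge0, sqr_ge0).
have -> : 2 * (W * (K * (d * (d + b))) * (h - - h)) = 2 * M * (d * (d + b)).
  by rewrite /M -/K; ring.
exact: lexx.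
Qed.

Lemma expint_cder xi : cder (expint h wt) xi (expint h (fun a => wt a * a%:C) xi).
Proof. exact: sder_cder (expint_sder xi). Qed.

Lemma expint_bound : exists2 W, 0 <= W & forall xi,
  cnorm (expint h wt xi) <= W * expR (h * `|Re xi|).
Proof.
have [W W0 HW] := rcont_bounded (- h) h wtc.
exists (2 * (W * (h - - h))) => [|xi].
  by rewrite !mulr_ge0// opprK addr_ge0.
have hh : - h <= h by rewrite ge0_cp.
apply: le_trans (cnorm_cint_le (M := W * expR (h * `|Re xi|)) hh _ _) _.
- exact: expint_integrable.
- move=> y yh; rewrite cnormM; apply: ler_pM; rewrite ?cnorm_ge0 ?HW//.
  rewrite cnorm_cexp ler_expR ReM /= mulr0 subr0; apply: le_trans (ler_norm _) _.
  by rewrite normrM mulrC ler_wpM2r// ler_norml.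
by rewrite le_eqVlt; apply/orP; left; apply/eqP; ring.
Qed.

End ExpInt.

Definition coshint (h : R) (wt : R -> C) (eta : C) : C :=
  cint (- h) h (fun a => ccosh (eta * a%:C) * wt a).

Lemma coshintE h wt eta : 0 <= h -> (forall x, rcont wt x) ->
  coshint h wt eta = 2^-1 * (expint h wt eta + expint h wt (- eta)).
Proof.
move=> h0 wtc; rewrite -cintegralD//; try exact: expint_integrable.
rewrite -cintegralZ//; last first.
  by apply: cintegrableD => //; exact: expint_integrable.
by apply: eq_cintegral => a _; rewrite /ccosh mulNr; field.
Qed.

Lemma coshint_sder h wt eta : 0 <= h -> (forall x, rcont wt x) ->
  sder (coshint h wt) eta (cint (- h) h (fun a => a%:C * csinh (eta * a%:C) * wt a)).
Proof.
move=> h0 wtc.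
have -> : coshint h wt = fun eta => 2^-1 * (expint h wt eta + expint h wt (- eta)).
  by apply/funext => x; exact: coshintE.
apply: sder_eq.
  apply: sderZ; apply: sderD; first exact: expint_sder.
  by apply: sder_opp; exact: expint_sder.
have wtc' := wtmul_rcont wtc.
rewrite -cintegralB//; try exact: expint_integrable.
rewrite -cintegralZ//; last first.
  by apply: cintegrableB => //; exact: expint_integrable.
by apply: eq_cintegral => a _; rewrite /csinh mulNr; field.
Qed.

Lemma cexp_sub2_le (w : C) :
  cnorm (cexp w - 1 - w - w ^+ 2 / 2) <= 8 * cnorm w ^+ 3 * expR (cnorm w).
Proof.
have c0 x : rcont (fun t : R => w * (cexp (w * t%:C) - 1 - w * t%:C)) x.
  apply: rcontM; first exact: rcont_cst.
  apply: rcontB; last by apply: rcontM; [exact: rcont_cst|exact: rcont_id].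
  by apply: rcontB; [exact: rcont_cexpM|exact: rcont_cst].
have -> : cexp w - 1 - w - w ^+ 2 / 2 = cint 0 1 (fun t => w * (cexp (w * t%:C) - 1 - w * t%:C)).
  rewrite (@cint_FTC _ 0 1 _ (fun t => cexp (w * t%:C) - w * t%:C - w ^+ 2 / 2 * (t%:C * t%:C)))//.
  - by rewrite !mulr1 !mulr0 cexp0; ring.
  - move=> x _; apply: rder_eq.
      apply: rderD; last by apply: rderN; apply: rderZ; apply: rderM; exact: rder_id.
      by apply: rderD; [exact: rder_cexp|apply: rderN; apply: rderZ; exact: rder_id].
    by rewrite /=; set E := cexp _; field.
apply: le_trans (cnorm_cint_le (M := cnorm w * (4 * cnorm w ^+ 2 * expR (cnorm w))) _ _ _) _ => //.
- exact: rcont_integrable.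
- move=> x x01; rewrite cnormM ler_wpM2l ?cnorm_ge0// (le_trans (cexp_sub1l_le _))//.
  apply: ler_pM; rewrite ?expR_ge0//; first by apply: mulr_ge0 => //; exact: sqr_ge0.
    by rewrite ler_pM2l// ler_pXn2r ?nnegrE ?cnorm_ge0// cnorm_ray_le.
  by rewrite ler_expR cnorm_ray_le.
have -> : 2 * (cnorm w * (4 * cnorm w ^+ 2 * expR (cnorm w)) * (1 - 0)) =
  8 * cnorm w ^+ 3 * expR (cnorm w) by ring.
exact: lexx.
Qed.

Lemma ccosh_taylor (w : C) :
  cnorm (ccosh w - 1 - w ^+ 2 / 2) <= 8 * cnorm w ^+ 3 * expR (cnorm w).
Proof.
have -> : ccosh w - 1 - w ^+ 2 / 2 = ((cexp w - 1 - w - w ^+ 2 / 2) +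
    (cexp (- w) - 1 - (- w) - (- w) ^+ 2 / 2)) / 2 by rewrite /ccosh; field.
rewrite cnorm_half ler_pdivrMr//.
have := cexp_sub2_le w; have := cexp_sub2_le (- w); rewrite cnormN => h1 h2.
by apply: le_trans (cnormD _ _) _; lra.
Qed.

Lemma csinh_taylor (w : C) :
  cnorm (csinh w - w) <= 4 * cnorm w ^+ 2 * expR (cnorm w).
Proof.
have -> : csinh w - w = ((cexp w - 1 - w) - (cexp (- w) - 1 - (- w))) / 2.
  by rewrite /csinh; field.
rewrite cnorm_half ler_pdivrMr//.
have := cexp_sub1l_le w; have := cexp_sub1l_le (- w); rewrite cnormN => h1 h2.
by apply: le_trans (cnormB _ _) _; lra.
Qed.

(** Extracts a vanishing Taylor coefficient from a remainder estimate, in the proofs of linear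
    independence. *)
Lemma cnorm_le_small_eq0 (c : C) (K h : R) : 0 < h ->
  (forall x : R, 0 < x <= h -> cnorm c <= K * x) -> c = 0.
Proof.
move=> h0 H; apply/eqP; rewrite -cnorm_eq0 eq_le cnorm_ge0 andbT.
have K0 : 0 <= K.
  by have := le_trans (cnorm_ge0 _) (H h _); rewrite h0 lexx pmulr_lge0//; apply.
apply/ler_addgt0Pr => e e0; rewrite add0r.
have K1 : 0 < K + 1 by rewrite ltr_wpDl.
have m0 : 0 < Num.min h (e / (K + 1)) by rewrite lt_min h0 divr_gt0.
apply: le_trans (H (Num.min h (e / (K + 1))) _) _.
  by rewrite m0 ge_min lexx.
apply: (@le_trans _ _ ((K + 1) * (e / (K + 1)))); last by rewrite mulrC divfK// gt_eqF.
by apply: ler_pM => //; [exact: ltW|lra|rewrite ge_min lexx orbT].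
Qed.

End StrictDerivative.

(** * Removing the pole at the origin *)

Section HalfPlaneResidue.
Variable R : realType.
Local Notation C := R[i].
Local Notation Re := complex.Re.
Local Notation Im := complex.Im.
Local Notation leb := (@lebesgue_measure R).

Lemma ball_bound (q : C -> C) : ccont q 0 ->
  exists2 r : R, 0 < r & forall w, cnorm w < r -> cnorm (q w) <= cnorm (q 0) + 1.
Proof.
move=> cq; have [r r0 Hr] := ccontP cq ltr01; exists r => // w wr.
have -> : q w = q 0 + (q w - q 0) by ring.
rewrite (le_trans (cnormD _ _))// lerD2l ltW// Hr// subr0 //.
Qed.

Lemma le_cauchy_weight (x : R) : 1 <= `|x| -> x ^- 2 <= 2 * cauchy_weight x.
Proof.
move=> x1; have x2 : 1 <= x ^+ 2 by rewrite -(real_normK (num_real x)) exprn_ege1.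
have x20 : 0 < x ^+ 2 by rewrite (lt_le_trans ltr01).
rewrite /cauchy_weight ler_pdivlMr ?addr_gt0// mulrC ler_pdivrMr//; lra.
Qed.

(** The prescribed value of [l 0] makes the right-hand side vanish at [w = 0], since 1 / (- i) = i.
    The subtracted term has its other pole at ['i], outside the half plane, and after division by
    [w] it decays like 1 / |w|^2. *)
Lemma half_plane_residue (f l : C -> C) (B L : R) : 0 <= B ->
  (forall z, exists d, cder f z d) ->
  (forall e : R, 0 < e -> exists A, forall z, cnorm (f z) <= A * expR ((B + e) * cnorm z)) ->
  leb.-integrable setT (fun x => (cnorm (f x%:C) ^+ 2)%:E) ->
  (forall z, Im z <= 0 -> exists d, cder l z d) ->
  (forall z, Im z <= 0 -> cnorm (l z) <= L * expR (B * Im z)) ->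
  l 0 = 'i / (2 * pi)%:C ->
  exists k : C -> C, [/\ forall w, w * k w = f w * l w - f 0 / (2 * pi)%:C / (w - 'i),
    forall x, rcont (fun x => k x%:C) x, cintegrable leb setT (fun x => k x%:C) &
    cintegral leb setT (fun x => k x%:C) = 0].
Proof.
move=> B0 fD fB fL2 lD lB l0.
have pi0 : (2 * pi)%:C != 0 :> C.
  by rewrite real_complex_eq0 gt_eqF// mulr_gt0// pi_gt0.
set a := f 0 / (2 * pi)%:C.
pose g w := f w * l w - a / (w - 'i).
have ii := mulii.
have i0 : ('i : C) != 0 by rewrite -cnorm_gt0 cnorm_i ltr01.
have ImBi (z : C) : Im (z - 'i) = Im z - 1 by rewrite ImB.
have zi1 (z : C) : Im z <= 0 -> 1 <= cnorm (z - 'i).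
  move=> z0; apply: le_trans (normIm_le _); rewrite ImBi ler0_norm; lra.
have zi0 (z : C) : Im z <= 0 -> z - 'i != 0.
  by move=> /zi1 h; rewrite -cnorm_gt0 (lt_le_trans ltr01).
have L0 : 0 <= L.
  by have := le_trans (cnorm_ge0 _) (lB 0 (lexx _)); rewrite pmulr_lge0 ?expR_gt0.
have gD z : Im z <= 0 -> exists d, cder g z d.
  move=> z0; have [df Hf] := fD z; have [dl Hl] := lD z z0.
  exists (df * l z + f z * dl - (0 * (z - 'i)^-1 + a * (- ((z - 'i) ^+ 2)^-1 * (1 - 0)))).
  apply: cderB; first exact: cderM.
  apply: cderM; first exact: cder_cst.
  by apply: cderV; [exact: zi0|apply: cderB; [exact: cder_id|exact: cder_cst]].
have g0 : g 0 = 0.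
  rewrite /g l0 sub0r.
  have -> : f 0 * ('i / (2 * pi)%:C) = a * 'i by rewrite /a; ring.
  have -> : (- 'i)^-1 = 'i :> C.
    by apply: (mulfI (x := - 'i)); rewrite ?oppr_eq0// divff ?oppr_eq0// mulNr ii opprK.
  by rewrite subrr.
have gB e : 0 < e -> exists2 A, 0 <= A & forall z, Im z <= 0 ->
    cnorm (g z) <= A * expR (B * Im z + (B + e) * cnorm z) + cnorm a.
  move=> e0; have [A HA] := fB e e0.
  have A0 : 0 <= A.
    by have := le_trans (cnorm_ge0 _) (HA 0); rewrite pmulr_lge0 ?expR_gt0.
  exists (A * L); first exact: mulr_ge0.
  move=> z z0; apply: le_trans (cnormB _ _) _; apply: lerD.
    rewrite cnormM; apply: (@le_trans _ _ (A * expR ((B + e) * cnorm z) * (L * expR (B * Im z)))).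
      by apply: ler_pM; rewrite ?cnorm_ge0 ?lB.
    by rewrite mulrACA -expRD addrC.
  rewrite cnormM ler_piMr ?cnorm_ge0// cnormV invf_le1//; first exact: zi1.
  by rewrite (lt_le_trans ltr01)//; exact: zi1.
(* Since [g 0 = 0], the Caratheodory quotient of [g] at 0 is the continuous extension of [g w / w]:
   the removable singularity comes for free. *)
have [d [q [qE qd qc]]] := gD 0 (lexx _).
have {}qE w : w * q w = g w by rewrite (qE w) g0 add0r subr0.
have [r r0 Hr] := ball_bound qc.
have [Q Q0 {}Hr] : exists2 Q, 0 <= Q & forall w, cnorm w < r -> cnorm (q w) <= Q.
  by exists (cnorm (q 0) + 1) => //; rewrite addr_ge0 ?cnorm_ge0.
(* Continuity bounds [q] near 0; elsewhere the division by [z] costs at most a factor [r^-1]. *)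
have qB z : cnorm (q z) <= Q + cnorm (g z) / r.
  case: (ltP (cnorm z) r) => zr.
    by rewrite (le_trans (Hr z zr))// lerDl divr_ge0 ?cnorm_ge0// ltW.
  apply: le_trans (_ : cnorm (g z) / r <= _); last by rewrite lerDr.
  by rewrite -qE cnormM ler_pdivlMr// mulrC ler_wpM2r// cnorm_ge0.
have qD z : Im z <= 0 -> z != 0 -> exists d, cder q z d.
  move=> z0 nz; have [dg Hg] := gD z z0.
  exists (dg * z^-1 + g z * (- (z ^+ 2)^-1 * 1)).
  have nz' : 0 < cnorm z by rewrite cnorm_gt0.
  apply: (cder_near (f := fun w => g w * w^-1) nz').
    move=> w wz; have w0 : w != 0.
      by apply: contraTneq wz => ->; rewrite sub0r cnormN ltxx.
    by rewrite -qE mulrAC mulfV// mul1r.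
  by apply: cderM => //; apply: cderV => //; exact: cder_id.
have qr x : rcont (fun x => q x%:C) x.
  apply: (rcont_comp (f := q)); last exact: rcont_id.
  have [->//|x0] := eqVneq x 0.
  have [dq Hq] : exists d, cder q x%:C d.
    by apply: qD => //; rewrite real_complex_eq0.
  exact: cder_cont Hq.
have [W W0 HW] := rcont_bounded (-1) 1 qr.
have qi : cintegrable leb setT (fun x => q x%:C).
  (* For |x| > 1 the product of |f x| and L / |x| is bounded by the sum of their squares, one
     integrable by hypothesis and the other by comparison with the weight; [W] takes care of |x| <=
     1. *)
  pose bd (x : R) : R := cnorm (f x%:C) ^+ 2 + (2 * L ^+ 2 + 2 * cnorm a + 2 * W) * cauchy_weight x.
  apply: (@cintegrable_dom _ _ _ leb setT measurableT _ bd).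
  - by apply: rcont_cmeasurable.
  - apply: (@integrableD _ _ _ leb setT measurableT (fun x => (cnorm (f x%:C) ^+ 2)%:E)
      (fun x => ((2 * L ^+ 2 + 2 * cnorm a + 2 * W) * cauchy_weight x)%:E)) => //.
    exact: (integrableZl measurableT _ (cauchy_weight_integrable R)).
  move=> x _; have cw := cauchy_weight_gt0 x.
  case: (leP `|x| 1) => x1.
    apply: (@le_trans _ _ W); first by apply: HW; rewrite -ler_norml.
    apply: (@le_trans _ _ (2 * W * cauchy_weight x)).
      rewrite /cauchy_weight ler_pdivlMr ?ltr_pwDl ?sqr_ge0//.
      have x2 : x ^+ 2 <= 1 by rewrite -(real_normK (num_real x)) exprn_ile1.
      by rewrite [leRHS]mulrC ler_wpM2l//; lra.
    rewrite -[X in X <= _]add0r lerD ?sqr_ge0// ler_wpM2r ?(ltW cw)//.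
    by rewrite lerDr addr_ge0 ?mulr_ge0 ?cnorm_ge0 ?sqr_ge0.
  have xn0 : x%:C != 0 :> C.
    rewrite real_complex_eq0 -normr_gt0.
    exact: lt_trans x1.
  have ax0 : 0 < `|x| by exact: lt_trans x1.
  have -> : q x%:C = g x%:C / x%:C by rewrite -qE mulrC mulKf.
  have xm := le_cauchy_weight (ltW x1).
  have lx : cnorm (l x%:C) <= L.
    by apply: le_trans (lB _ _) _ => //=; rewrite mulr0 expR0 mulr1.
  have ax : cnorm (a / (x%:C - 'i)) <= cnorm a / `|x|.
    rewrite cnormM cnormV ler_wpM2l ?cnorm_ge0// lef_pV2 ?posrE//.
      apply: le_trans (normRe_le _); by rewrite ReB /= subr0.
    by rewrite cnorm_gt0 zi0.
  rewrite cnormM cnormV cnormR.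
  apply: (@le_trans _ _ ((cnorm (f x%:C) * L + cnorm a / `|x|) / `|x|)).
    rewrite ler_wpM2r ?invr_ge0// (le_trans (cnormB _ _))// lerD// cnormM.
    by rewrite ler_wpM2l ?cnorm_ge0.
  have -> : (cnorm (f x%:C) * L + cnorm a / `|x|) / `|x| =
      cnorm (f x%:C) * (L / `|x|) + cnorm a * x ^- 2.
    by rewrite mulrDl -[x ^+ 2](real_normK (num_real x)) expr2 invfM !mulrA.
  have e1 : cnorm (f x%:C) * (L / `|x|) <= cnorm (f x%:C) ^+ 2 + (L / `|x|) ^+ 2.
    have := sqr_ge0 (cnorm (f x%:C) - L / `|x|).
    have := sqr_ge0 (cnorm (f x%:C)); have := sqr_ge0 (L / `|x|).
    by move: (cnorm _) (_ / _) => u v; rewrite sqrrB !mulr2n; lra.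
  have e2 : (L / `|x|) ^+ 2 <= 2 * L ^+ 2 * cauchy_weight x.
    rewrite exprMn exprVn real_normK ?num_real//.
    by rewrite -[leRHS]mulrA [leRHS]mulrCA ler_wpM2l// sqr_ge0.
  have e3 : cnorm a * x ^- 2 <= 2 * cnorm a * cauchy_weight x.
    by rewrite -[leRHS]mulrA [leRHS]mulrCA ler_wpM2l// cnorm_ge0.
  have e4 : 0 <= 2 * W * cauchy_weight x by rewrite !mulr_ge0// ltW.
  by rewrite /bd !mulrDl; lra.
have qmaj (e A : R) (z : C) (b : R) : 0 <= A -> 0 <= b ->
    cnorm (g z) <= A * expR b + cnorm a -> cnorm (q z) <= (Q + A / r + cnorm a / r) * expR b.
  move=> A0 b0 gz; apply: le_trans (qB z) _.
  have e1 : 1 <= expR b by rewrite -expR0 ler_expR.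
  rewrite !mulrDl -addrA; apply: lerD; first by rewrite ler_peMr.
  apply: (@le_trans _ _ ((A * expR b + cnorm a) / r)).
    by rewrite ler_wpM2r// invr_ge0 ltW.
  rewrite mulrDl mulrAC lerD2l ler_peMr// divr_ge0 ?cnorm_ge0// ltW//.
exists q; split => //; have [A A0 HA] := gB 1 ltr01.
apply: (lower_half_plane (M := Q + A / r + cnorm a / r) (B := B + 1)) => //.
- by rewrite addr_ge0.
- move=> z z0; apply: (qmaj 1) => //.
    by rewrite mulr_ge0 ?cnorm_ge0// addr_ge0.
  apply: le_trans (HA z z0) _; rewrite lerD2r ler_wpM2l// ler_expR.
  by rewrite gerDr mulr_ge0_le0.
(* At - i y the growth (B + e) y of [f] and the decay - B y of [l] leave only e y: type 0. *)
move=> e e0; have [A' A'0 HA'] := gB e e0.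
exists (Q + A' / r + cnorm a / r) => y y0.
apply: (qmaj 1) => //; first by rewrite mulr_ge0// ltW.
have Ey : - 'i * y%:C = 0 -i* y :> C by apply: complexP; rewrite !ReImE /=; ring.
have Iy : Im (- 'i * y%:C) = - y by rewrite Ey.
have := HA' (- 'i * y%:C); rewrite Iy oppr_le0 => /(_ y0).
rewrite cnormM cnormN cnorm_i mul1r cnormR ger0_norm//.
have -> // : B * - y + (B + e) * y = e * y by ring.
Qed.

End HalfPlaneResidue.

(** * Convolution of exponentials with the kernel *)

Section Convolution.
Variable R : realType.
Local Notation C := R[i].
Local Notation Re := complex.Re.
Local Notation Im := complex.Im.
Local Notation leb := (@lebesgue_measure R).

Definition lkernel (c x : R) : R := `|x| * expR (- c * `|x|).
Definition ekernel (c x : R) : R := expR (- c * `|x|).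

Lemma ekernel_cont c : continuous (ekernel c).
Proof.
move=> x; apply: (continuous_comp (f := fun x => - c * `|x|)); last exact: continuous_expR.
by apply: cvgMl_tmp; exact: norm_continuous.
Qed.

Lemma lkernel_cont c : continuous (lkernel c).
Proof. by move=> x; apply: cvgM; [exact: norm_continuous|exact: ekernel_cont]. Qed.

Lemma ekernel_rcont c x : rcont (fun y => (ekernel c y)%:C) x.
Proof. by apply: rcont_real; exact: ekernel_cont. Qed.

Lemma lkernel_rcont c x : rcont (fun y => (lkernel c y)%:C) x.
Proof. by apply: rcont_real; exact: lkernel_cont. Qed.

Lemma lkernel_sub_cont c (x : R) : continuous (fun y => lkernel c (x - y)).
Proof.
move=> y; apply: (continuous_comp (f := fun y => x - y)); last exact: lkernel_cont.
by apply: cvgB; [exact: cvg_cst|exact: cvg_id].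
Qed.

Lemma lkernel_sub_rcont c (x y : R) : rcont (fun y => (lkernel c (x - y))%:C) y.
Proof. by apply: rcont_real; exact: lkernel_sub_cont. Qed.

Lemma lkernelN c x : lkernel c (- x) = lkernel c x.
Proof. by rewrite /lkernel normrN. Qed.

Lemma lkernelE c x : 0 <= x -> (lkernel c x)%:C = x%:C * cexp (- c * x)%:C.
Proof. by move=> x0; rewrite /lkernel ger0_norm// rmorphM /= cexpR. Qed.

Lemma ekernelE c x : 0 <= x -> (ekernel c x)%:C = cexp (- c * x)%:C.
Proof. by move=> x0; rewrite /ekernel ger0_norm// cexpR. Qed.

Lemma ekernelN c x : ekernel c (- x) = ekernel c x.
Proof. by rewrite /ekernel normrN. Qed.

Lemma rder_affine_cexp (k l s x : C) (y : R) :
  rder (fun y => (k + l * y%:C) * (x * cexp (s * y%:C))) y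
    ((l + (k + l * y%:C) * s) * (x * cexp (s * y%:C))).
Proof.
apply: rder_eq.
  apply: rderM.
    by apply: rderD; [exact: rder_cst|apply: rderZ; exact: rder_id].
  by apply: rderZ; exact: rder_cexp.
by rewrite /=; move: (cexp (s * y%:C)) => E; ring.
Qed.

Lemma lkernel_conv_cexp (c h x : R) (eta : C) : - h <= x <= h ->
  c%:C + eta != 0 -> c%:C - eta != 0 ->
  cint (- h) h (fun y => (lkernel c (x - y))%:C * cexp (eta * y%:C)) =
  cexp (eta * x%:C) * ((c%:C + eta) ^- 2 + (c%:C - eta) ^- 2)
  - ((x + h)%:C / (c%:C + eta) + (c%:C + eta) ^- 2) * (cexp (- (c * (x + h))%:C) * cexp (- eta * h%:C))
  - ((h - x)%:C / (c%:C - eta) + (c%:C - eta) ^- 2) * (cexp (- (c * (h - x))%:C) * cexp (eta * h%:C)).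
Proof.
move=> xh s0 t0; have /andP[hx xh'] := xh.
have cI y : rcont (fun y => (lkernel c (x - y))%:C * cexp (eta * y%:C)) y.
  by apply: rcontM; [exact: lkernel_sub_rcont|exact: rcont_cexpM].
rewrite (cint_split xh); last by apply: rcont_integrable => y _; exact: cI.
set s := c%:C + eta in s0 *; set t := c%:C - eta in t0 *.
have -> : cint (- h) x (fun y => (lkernel c (x - y))%:C * cexp (eta * y%:C)) =
    s ^- 2 * cexp (eta * x%:C) -
    ((x + h)%:C / s + s ^- 2) * (cexp (- (c * (x + h))%:C) * cexp (- eta * h%:C)).
  (* To the left of [x] the absolute value opens, and the integrand is an affine function of [y]
     times exp (s y); this is its primitive. *)
  rewrite (@cint_FTC R _ _ _ (fun y => (x%:C / s + s ^- 2 + - s^-1 * y%:C) * (cexp (- (c * x)%:C) * cexp (s * y%:C))))//.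
    rewrite -!cexpD; congr (_ - _).
      have -> : - (c * x)%:C + s * x%:C = eta * x%:C by rewrite /s rmorphM /=; ring.
      by congr (_ * _); field.
    have -> : - (c * x)%:C + s * (- h)%:C = - (c * (x + h))%:C + - eta * h%:C.
      by rewrite /s rmorphM rmorphN rmorphM rmorphD /=; ring.
    by congr (_ * _); rewrite rmorphN rmorphD /=; field.
  move=> y /andP[hy yx]; apply: rder_eq; first exact: rder_affine_cexp.
  have y0 : 0 <= x - y by rewrite subr_ge0.
  rewrite lkernelE// -mulrA -!cexpD.
  have -> : - (c * x)%:C + s * y%:C = (- c * (x - y))%:C + eta * y%:C.
    by rewrite /s !rmorphM rmorphN rmorphB /=; ring.
  by congr (_ * _); rewrite rmorphB /=; field.
have -> : cint x h (fun y => (lkernel c (x - y))%:C * cexp (eta * y%:C)) =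
    t ^- 2 * cexp (eta * x%:C) -
    ((h - x)%:C / t + t ^- 2) * (cexp (- (c * (h - x))%:C) * cexp (eta * h%:C)).
  rewrite (@cint_FTC R _ _ _ (fun y => (x%:C / t - t ^- 2 + - t^-1 * y%:C) * (cexp (c * x)%:C * cexp (- t * y%:C))))//.
    rewrite -!cexpD.
    have -> : (c * x)%:C + - t * x%:C = eta * x%:C by rewrite /t rmorphM /=; ring.
    have -> : (c * x)%:C + - t * h%:C = - (c * (h - x))%:C + eta * h%:C.
      by rewrite /t !rmorphM rmorphB /=; ring.
    set E1 := cexp _; set E2 := cexp _; by rewrite rmorphB /=; field.
  move=> y /andP[xy yh]; apply: rder_eq; first exact: rder_affine_cexp.
  have y0 : 0 <= y - x by rewrite subr_ge0.
  rewrite -lkernelN (opprB x y) lkernelE// -mulrA -!cexpD.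
  have -> : (c * x)%:C + - t * y%:C = (- c * (y - x))%:C + eta * y%:C.
    by rewrite /t !rmorphM rmorphN rmorphB /=; ring.
  by congr (_ * _); rewrite rmorphB /=; field.
set E1 := cexp _; set E2 := cexp _ * _; set E3 := cexp _ * _; ring.
Qed.

Lemma ekernel_int_cexp (c h : R) (eta : C) : 0 <= h ->
  c%:C + eta != 0 -> c%:C - eta != 0 ->
  cint (- h) h (fun y => (ekernel c y)%:C * cexp (eta * y%:C)) =
  (1 - cexp (- (c * h)%:C) * cexp (- eta * h%:C)) / (c%:C + eta) +
  (1 - cexp (- (c * h)%:C) * cexp (eta * h%:C)) / (c%:C - eta).
Proof.
move=> h0 s0 t0; have h00 : - h <= 0 <= h by rewrite oppr_le0 h0.
have cI y : rcont (fun y => (ekernel c y)%:C * cexp (eta * y%:C)) y.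
  by apply: rcontM; [exact: ekernel_rcont|exact: rcont_cexpM].
rewrite (cint_split h00); last by apply: rcont_integrable => y _; exact: cI.
set s := c%:C + eta in s0 *; set t := c%:C - eta in t0 *.
have /andP[hn0 _] := h00.
congr (_ + _).
  rewrite (@cint_FTC R _ _ _ (fun y => s^-1 * cexp (s * y%:C)))//.
    have -> : s * (- h)%:C = - (c * h)%:C + - eta * h%:C by rewrite /s rmorphN rmorphM /=; ring.
    by rewrite mulr0 cexp0 cexpD; set E1 := cexp _; set E2 := cexp _; field.
  move=> y /andP[hy yx]; apply: rder_eq; first by apply: rderZ; exact: rder_cexp.
  rewrite -ekernelN ekernelE; last by rewrite oppr_ge0.
  rewrite -cexpD; have -> : (- c * - y)%:C + eta * y%:C = s * y%:C.
    by rewrite /s mulrNN rmorphM /=; ring.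
  by field.
rewrite (@cint_FTC R _ _ _ (fun y => - t^-1 * cexp (- t * y%:C)))//.
  have -> : - t * h%:C = - (c * h)%:C + eta * h%:C by rewrite /t rmorphM /=; ring.
  by rewrite mulr0 cexp0 cexpD; set E1 := cexp _; set E2 := cexp _; field.
move=> y /andP[hy yx]; apply: rder_eq; first by apply: rderZ; exact: rder_cexp.
rewrite ekernelE// -cexpD; have -> : (- c * y)%:C + eta * y%:C = - t * y%:C.
  by rewrite /t rmorphM rmorphN /=; ring.
by field.
Qed.

(** After subtraction of [P0 * ccosh (eta * x)] the convolution is even and annihilated by (d^2 -
    c^2)^2, hence a combination of cosh (c x) and x sinh (c x). Its value and its second derivative
    at 0 give the coefficients, which is where the integrals of A and B come from. *)
Lemma lkernel_conv_ccosh (c h x : R) (eta : C) : - h <= x <= h ->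
  c%:C + eta != 0 -> c%:C - eta != 0 ->
  let P0 := (c%:C + eta) ^- 2 + (c%:C - eta) ^- 2 in
  cint (- h) h (fun y => (lkernel c (x - y))%:C * ccosh (eta * y%:C)) =
  P0 * ccosh (eta * x%:C) +
  (coshint h (fun a => (lkernel c a)%:C) eta - P0) * ccosh (c * x)%:C +
  ((c%:C + eta)^-1 + (c%:C - eta)^-1 - coshint h (fun a => (ekernel c a)%:C) eta) *
    (x%:C * csinh (c * x)%:C).
Proof.
move=> xh s0 t0 P0; have /andP[hx xh'] := xh.
have h0 : 0 <= h by lra.
have s0' : c%:C + - - eta != 0 by rewrite opprK.
have conv x' : - h <= x' <= h ->
    cint (- h) h (fun y => (lkernel c (x' - y))%:C * ccosh (eta * y%:C)) =
    2^-1 * (cint (- h) h (fun y => (lkernel c (x' - y))%:C * cexp (eta * y%:C)) +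
            cint (- h) h (fun y => (lkernel c (x' - y))%:C * cexp (- eta * y%:C))).
  move=> x'h; have ci z : cintegrable leb `[- h, h] (fun y => (lkernel c (x' - y))%:C * cexp (z * y%:C)).
    by apply: rcont_integrable => y _; apply: rcontM; [exact: lkernel_sub_rcont|exact: rcont_cexpM].
  rewrite -cintegralD// -cintegralZ//; last exact: cintegrableD.
  by apply: eq_cintegral => y _; rewrite /ccosh mulNr; field.
have e1 : coshint h (fun a => (lkernel c a)%:C) eta =
    cint (- h) h (fun y => (lkernel c (0 - y))%:C * ccosh (eta * y%:C)).
  by apply: eq_cintegral => y _; rewrite sub0r lkernelN mulrC.
have e2 : coshint h (fun a => (ekernel c a)%:C) eta =
    2^-1 * (cint (- h) h (fun y => (ekernel c y)%:C * cexp (eta * y%:C)) +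
            cint (- h) h (fun y => (ekernel c y)%:C * cexp (- eta * y%:C))).
  have ci z : cintegrable leb `[- h, h] (fun y => (ekernel c y)%:C * cexp (z * y%:C)).
    by apply: rcont_integrable => y _; apply: rcontM; [exact: ekernel_rcont|exact: rcont_cexpM].
  rewrite -cintegralD// -cintegralZ//; last exact: cintegrableD.
  by apply: eq_cintegral => y _; rewrite /ccosh mulNr; field.
have h00 : - h <= 0 <= h by rewrite oppr_le0 h0.
rewrite e1 e2 !conv// !lkernel_conv_cexp// !ekernel_int_cexp//.
rewrite /P0 /ccosh /csinh !opprK !add0r !subr0 ?rmorph0 !mulNr ?opprK !mulr0 ?oppr0 !cexp0.
have -> : cexp (- (c * (x + h))%:C) = (cexp (c * x)%:C * cexp (c * h)%:C)^-1.
  by rewrite -cexpD -cexpN; congr cexp; rewrite mulrDr rmorphD.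
have -> : cexp (- (c * (h - x))%:C) = cexp (c * x)%:C / cexp (c * h)%:C.
  by rewrite -cexpB; congr cexp; rewrite mulrBr rmorphB /=; ring.
rewrite !cexpN rmorphB rmorphD /=.
move: (cexp_neq0 (c * x)%:C) (cexp_neq0 (c * h)%:C) (cexp_neq0 (eta * x%:C)) (cexp_neq0 (eta * h%:C)).
(* Both sides are now rational functions of four nonzero exponentials, and the identity is purely
   algebraic. *)
move: (cexp (c * x)%:C) (cexp (c * h)%:C) (cexp (eta * x%:C)) (cexp (eta * h%:C)) => X G Y H X0 G0 Y0 H0.
by field; rewrite X0 G0 Y0 H0 s0 t0.
Qed.

End Convolution.

(** * Integration against a point mass plus a density *)

Section PointMassDensity.
Context d (T : measurableType d) (R : realType).
Variables (mu nu : {measure set T -> \bar R}) (D : set T) (w : T -> R) (c : R) (a : T).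
Hypotheses (mD : measurable D) (mw : measurable_fun D w) (w0 : forall x, 0 <= w x) (c0 : 0 <= c).
Hypothesis nuE : forall A, measurable A ->
  nu A = (c%:E * \d_a A + \int[mu]_(x in A `&` D) (w x)%:E)%E.

Import HBNNSimple.

(** The integral of a simple function is a finite sum over its level sets, and [nuE] applies to
    each; monotone convergence then extends the formula to nonnegative functions. *)
Lemma nnsfun_integral_density (f : {nnsfun T >-> R}) :
  (\int[nu]_x (f x)%:E = (c * f a)%:E + \int[mu]_(x in D) (w x * f x)%:E)%E.
Proof.
pose m1 := mscale (NngNum c0) \d_a.
have mf k : measurable (f @^-1` [set k]) by exact: measurable_sfunP.
rewrite integralT_nnsfun sintegralE.
have -> : (\sum_(x \in range f) x%:E * nu (f @^-1` [set x]) =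
    \sum_(x \in range f) (x%:E * m1 (f @^-1` [set x]) +
      \int[mu]_(y in D) (x * \1_(f @^-1` [set x]) y * w y)%:E))%E.
  apply: eq_fsbigr => x; rewrite inE => -[y _ fy].
  have x0 : 0 <= x by rewrite -fy.
  rewrite nuE// ge0_muleDr; first last.
  - by apply: integral_ge0 => z _; rewrite lee_fin.
  - by rewrite mule_ge0// lee_fin.
  congr (_ + _)%E.
  rewrite -ge0_integralZl//; first last.
  - by move=> z _; rewrite lee_fin.
  - by apply/measurable_EFinP; apply: measurable_funS mw.
  - exact: measurableI.
  rewrite integral_mkcondl; apply: eq_integral => z _.
  rewrite patchE indicE; case: ifPn => _; first by rewrite mulr1 -EFinM.
  by rewrite mulr0 mul0r.
rewrite fsbig_split//=; congr (_ + _)%E.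
  rewrite -sintegralE -integralT_nnsfun ge0_integral_mscale//=.
    rewrite integral_dirac//=; last exact/measurable_EFinP.
    by rewrite diracT mul1e.
    exact/measurable_EFinP.
  by move=> x _; rewrite lee_fin.
pose F x y := (x * \1_(f @^-1` [set x]) y * w y)%:E.
have mF k : measurable_fun D (F k).
  apply/measurable_EFinP; apply: measurable_funM => //.
  by apply: measurable_funM => //; apply: measurable_funTS; exact: measurable_indic.
have F0 k y : D y -> (0 <= F k y)%E.
  move=> _; rewrite lee_fin mulr_ge0//.
  by have := nnfun_muleindic_ge0 f k y; rewrite -EFinM lee_fin.
have finf : finite_set (range f) by [].
apply: etrans (esym (ge0_integral_fsum mu mD mF F0 finf)) _; apply: eq_integral => y _.
rewrite fsumEFin//; congr EFin.
by rewrite mulrC [in RHS]fimfunE mulr_fsuml.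
Qed.

Lemma ge0_integral_density (g : T -> R) : measurable_fun setT g -> (forall x, 0 <= g x) ->
  (\int[nu]_x (g x)%:E = (c * g a)%:E + \int[mu]_(x in D) (w x * g x)%:E)%E.
Proof.
move=> mg g0; have mg' : measurable_fun setT (EFin \o g) by exact/measurable_EFinP.
pose f := nnsfun_approx measurableT mg'.
have g0' x : setT x -> (0 <= (EFin \o g) x)%E by move=> _; rewrite lee_fin.
have fg x : (f n x)%:E @[n --> \oo] --> (g x)%:E by exact: cvg_nnsfun_approx.
have fnd x : {homo (fun n => f n x) : n m / (n <= m)%N >-> n <= m}.
  by move=> n m nm; have /lefP := nd_nnsfun_approx measurableT mg' nm; apply.
have L : (\int[nu]_x (f n x)%:E)%E @[n --> \oo] --> (\int[nu]_x (g x)%:E)%E.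
  have -> : (\int[nu]_x (g x)%:E = \int[nu]_x (fun x => limn (fun n => (f n x)%:E)) x)%E.
    by apply: eq_integral => x _; apply/esym/cvg_lim => //; exact: fg.
  apply: cvg_monotone_convergence => //.
  - by move=> n; exact/measurable_EFinP.
  - by move=> n x _; rewrite lee_fin.
  - by move=> x _ n m nm; rewrite lee_fin fnd.
have R1 : (c * f n a)%:E @[n --> \oo] --> (c * g a)%:E.
  apply: cvg_EFin; first by near=> n.
  by apply: cvgM; [exact: cvg_cst|exact: (fine_cvg (fg a))].
have R2 : (\int[mu]_(x in D) (w x * f n x)%:E)%E @[n --> \oo] -->
    (\int[mu]_(x in D) (w x * g x)%:E)%E.
  have -> : (\int[mu]_(x in D) (w x * g x)%:E = \int[mu]_(x in D)
      (fun x => limn (fun n => (w x * f n x)%:E)) x)%E.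
    apply: eq_integral => x _; apply/esym/cvg_lim => //.
    apply: cvg_EFin; first by near=> n.
    by apply: cvgM; [exact: cvg_cst|exact: (fine_cvg (fg x))].
  apply: cvg_monotone_convergence => //.
  - by move=> n; apply/measurable_EFinP; apply: measurable_funM => //; exact: measurable_funTS.
  - by move=> n x _; rewrite lee_fin mulr_ge0.
  - by move=> x _ n m nm; rewrite lee_fin ler_wpM2l// fnd.
have L' : (\int[nu]_x (f n x)%:E)%E @[n --> \oo] -->
    ((c * g a)%:E + \int[mu]_(x in D) (w x * g x)%:E)%E.
  under eq_fun do rewrite nnsfun_integral_density.
  by apply: cvgeD => //; rewrite fin_num_adde_defr.
exact: (cvg_unique _ L L').
Unshelve. all: by end_near. Qed.

End PointMassDensity.

(** * The integral equation and the closed form *)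

Section IntegralEquation.
Variable R : realType.
Local Notation C := R[i].
Local Notation Re := complex.Re.
Local Notation Im := complex.Im.
Local Notation leb := (@lebesgue_measure R).
Variables (Delta c1 c2 c3 : R).
Hypotheses (hDelta : 0 < Delta) (hc1 : 0 < c1) (hc2 : 0 < c2) (hc3 : 0 < c3).

Local Notation h := (Delta / 2).
Local Notation A := (Afun Delta c1 c2 c3).
Local Notation B := (Bfun Delta c1 c2 c3).

Let h_gt0 : 0 < h. Proof. by rewrite divr_gt0. Qed.
Let h_ge0 : 0 <= h. Proof. exact: ltW h_gt0. Qed.
Let c1C : c1%:C != 0 :> C. Proof. by rewrite real_complex_eq0 gt_eqF. Qed.
Let c3C : c3%:C != 0 :> C. Proof. by rewrite real_complex_eq0 gt_eqF. Qed.

Definition Top (phi : R -> C) (x : R) : C :=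
  c1%:C * phi x + c2%:C * cint (- h) h (fun y => (lkernel c3 (x - y))%:C * phi y).

Definition quart (eta : C) : C :=
  c1%:C * eta ^+ 4 + 2 * (c2%:C - c1%:C * c3%:C ^+ 2) * eta ^+ 2
  + c3%:C ^+ 2 * (2 * c2%:C + c1%:C * c3%:C ^+ 2).

Lemma quarticE eta : (quartic c1 c2 c3).[eta] = quart eta.
Proof.
rewrite /quartic !(hornerD, hornerZ, hornerXn, hornerC) /quart.
have -> : (2 * (c2 - c1 * c3 ^+ 2))%:C = 2 * (c2%:C - c1%:C * c3%:C ^+ 2).
  by rewrite rmorphM rmorphB rmorphM rmorphXn rmorph_nat.
ring.
Qed.

Lemma AfunE eta : A eta = 1 + c2%:C / c1%:C * coshint h (fun a => (lkernel c3 a)%:C) eta.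
Proof. by rewrite /Afun rmorphM fmorphV. Qed.

Lemma BfunE eta : B eta = eta ^+ 2 + (2 * (c2%:C / c1%:C) - c3%:C ^+ 2) -
  2 * (c2%:C * c3%:C / c1%:C) * coshint h (fun a => (ekernel c3 a)%:C) eta.
Proof.
rewrite /Bfun; congr (_ + _ - _ * _).
  by rewrite rmorphB (rmorphM _ 2) rmorphM fmorphV; ring.
by rewrite (rmorphM _ 2) !rmorphM fmorphV; ring.
Qed.

Lemma conv_integrable (phi : R -> C) (x : R) : (forall y, rcont phi y) ->
  cintegrable leb `[- h, h] (fun y => (lkernel c3 (x - y))%:C * phi y).
Proof.
move=> cphi; apply: rcont_integrable => y _; apply: rcontM => //.
exact: lkernel_sub_rcont.
Qed.

Lemma TopD (f g : R -> C) x : (forall y, rcont f y) -> (forall y, rcont g y) ->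
  Top (fun y => f y + g y) x = Top f x + Top g x.
Proof.
move=> cf cg; rewrite /Top.
have -> : cint (- h) h (fun y => (lkernel c3 (x - y))%:C * (f y + g y)) =
    cint (- h) h (fun y => (lkernel c3 (x - y))%:C * f y) +
    cint (- h) h (fun y => (lkernel c3 (x - y))%:C * g y).
  rewrite -cintegralD//; try exact: conv_integrable.
  by apply: eq_cintegral => y _; rewrite mulrDr.
ring.
Qed.

Lemma TopZ (a : C) (f : R -> C) x : (forall y, rcont f y) ->
  Top (fun y => a * f y) x = a * Top f x.
Proof.
move=> cf; rewrite /Top.
have -> : cint (- h) h (fun y => (lkernel c3 (x - y))%:C * (a * f y)) =
    a * cint (- h) h (fun y => (lkernel c3 (x - y))%:C * f y).
  rewrite -cintegralZ//; last exact: conv_integrable.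
  by apply: eq_cintegral => y _; rewrite mulrCA.
ring.
Qed.

(** The multiplier of the full-line operator on exponentials, [c1 + c2 * ((c3 + eta) ^- 2 + (c3 -
    eta) ^- 2)], over a common denominator. This is the origin of the quartic. *)
Definition wfun (eta : C) : C := quart eta / (eta ^+ 2 - c3%:C ^+ 2) ^+ 2.

(* [T phi] for [phi = cosh (eta x)]: since [(d^2 - c3^2)^2 k = 2 d^2 delta_0
   + 2 c3^2 delta_0], it differs from [wfun eta * phi] by a combination of
   [cosh (c3 x)] and [x sinh (c3 x)], read off from the definitions of A and B. *)
Lemma Top_ccosh (eta : C) (x : R) : eta ^+ 2 != c3%:C ^+ 2 -> - h <= x <= h ->
  Top (fun y => ccosh (eta * y%:C)) x = wfun eta * ccosh (eta * x%:C) +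
  (c1%:C * A eta - wfun eta) * ccosh (c3 * x)%:C +
  (c1%:C * B eta - wfun eta * (eta ^+ 2 - c3%:C ^+ 2)) / (2 * c3%:C) * (x%:C * csinh (c3 * x)%:C).
Proof.
move=> eta3 xh.
have s0 : c3%:C + eta != 0.
  by apply: contra_neq eta3 => /eqP; rewrite addrC addr_eq0 => /eqP ->; rewrite sqrrN.
have t0 : c3%:C - eta != 0.
  by apply: contra_neq eta3 => /eqP; rewrite subr_eq0 => /eqP ->.
rewrite /Top lkernel_conv_ccosh// AfunE BfunE /wfun /quart.
have E : eta ^+ 2 - c3%:C ^+ 2 = - ((c3%:C + eta) * (c3%:C - eta)) by ring.
rewrite E.
set IA := coshint _ _ _; set IB := coshint _ _ _.
set X := ccosh _; set Y := ccosh _; set Z := csinh _.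
by field; rewrite c1C c3C s0 t0.
Qed.

(** Bounding the kernel by |x - y| would give the constant 1 / 2. The inequality |x - y| <= ((x -
    y)^2 + l^2) / (2 l) avoids splitting the integral at [x], at the small cost of [29 / 50]. *)
Lemma lkernel_real_bound (f : R -> R) (S x : R) : 0 <= S -> (forall y, {for y, continuous f}) ->
  (forall y, - h <= y <= h -> `|f y| <= S) -> - h <= x <= h ->
  `|\int[leb]_(y in `[- h, h]) (lkernel c3 (x - y) * f y)|%R <= S * (29 / 50 * Delta ^+ 2).
Proof.
move=> S0 cf fS xh.
(* The best choice at the worst point [x = h] is 2 / sqrt 3 times [h]. The nearby value [6 / 5]
   gives 104 / 45 h^2, below 29 / 50 Delta^2 = 116 / 50 h^2. *)
pose l := 6 / 5 * h; have l0 : 0 < l by rewrite mulr_gt0// divr_gt0.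
pose b (y : R) := S / (2 * l) * ((x - y) ^+ 2 + l ^+ 2).
pose F (y : R) := S / (2 * l) * (- 3^-1 * ((x - y) * ((x - y) * (x - y))) + l ^+ 2 * y).
have cb y : {for y, continuous b}.
  apply: cvgMl_tmp; apply: cvgD; last exact: cvg_cst.
  rewrite expr2; under eq_fun do rewrite expr2.
  by apply: cvgM; (apply: cvgB; [exact: cvg_cst|exact: cvg_id]).
have ci : leb.-integrable `[- h, h] (EFin \o (fun y => lkernel c3 (x - y) * f y)).
  by apply: cont_integrable => y _; apply: cvgM; [exact: lkernel_sub_cont|exact: cf].
apply: le_trans (le_normr_Rintegral _ ci) _ => //.
apply: (@le_trans _ _ (\int[leb]_(y in `[- h, h]) b y)%R).
  apply: le_Rintegral => //.
  - by have := integrable_abse ci.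
  - by apply: cont_integrable => y _; exact: cb.
  move=> y /=; rewrite in_itv /= => yh; rewrite normrM.
  have k0 : `|lkernel c3 (x - y)| <= ((x - y) ^+ 2 + l ^+ 2) / (2 * l).
    have k1 : `|lkernel c3 (x - y)| <= `|x - y|.
      rewrite /lkernel normrM normr_id ler_piMr// ger0_norm ?expR_ge0//.
      by rewrite -expR0 ler_expR mulNr oppr_le0 mulr_ge0// ltW.
    apply: le_trans k1 _; rewrite ler_pdivlMr ?mulr_gt0//.
    have -> : (x - y) ^+ 2 = `|x - y| ^+ 2 by rewrite real_normK ?num_real.
    by have := sqr_ge0 (`|x - y| - l); nra.
  rewrite /b -mulrA mulrC; apply: ler_pM => //; first exact: fS.
  by rewrite mulrC.
have dF (y : R) : is_derive y 1 F (b y).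
  have d1 : is_derive y 1 (fun y => x - y) (-1).
    have h := is_deriveB (is_derive_cst x y 1) (is_derive_id y 1).
    by apply: (is_derive_eq h); rewrite sub0r.
  have d11 : is_derive y 1 (fun y => (x - y) * (x - y)) (- 2 * (x - y)).
    by apply: (is_derive_eq (is_deriveM d1 d1)); rewrite /GRing.scale /=; ring.
  have d2 := is_deriveM d1 d11.
  have d3 := is_deriveZ (S / (2 * l)) (is_deriveD (is_deriveZ (- 3^-1) d2) (is_deriveZ (l ^+ 2) (is_derive_id y 1))).
  apply: (@is_derive_eq _ _ _ F _ _ _ _ d3).
  by rewrite /b /GRing.scale /=; field; exact: lt0r_neq0.
rewrite (Rintegral_FTC (F := F)) ?ge0_cp//.
have -> : F h - F (- h) = S * ((h * x ^+ 2 + h ^+ 3 / 3 + h * l ^+ 2) / l).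
  by rewrite /F; field; exact: lt0r_neq0.
rewrite ler_wpM2l// ler_pdivrMr// /l.
have x2 : x ^+ 2 <= h ^+ 2.
  by rewrite -(real_normK (num_real x)) ler_pXn2r ?nnegrE//= ler_norml.
have : h * x ^+ 2 <= h * h ^+ 2 by rewrite ler_wpM2l.
have h3 : 0 < h ^+ 3 by rewrite exprn_gt0.
have -> : 29 / 50 * Delta ^+ 2 * (6 / 5 * h) = 29 * 24 / 250 * h ^+ 3 by field.
have -> : h * h ^+ 2 = h ^+ 3 by rewrite exprS.
have -> : h * (6 / 5 * h) ^+ 2 = 36 / 25 * h ^+ 3 by field.
move: (h ^+ 3) h3 (h * x ^+ 2) => H H0 X; lra.
Qed.

Hypothesis hsmall : c2 / c1 * Delta ^+ 2 <= 5 / 3.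

Lemma Top_inj_real (f : R -> R) : (forall y, {for y, continuous f}) ->
  (forall x, - h <= x <= h ->
    c1 * f x + c2 * (\int[leb]_(y in `[- h, h]) (lkernel c3 (x - y) * f y))%R = 0) ->
  forall x, - h <= x <= h -> f x = 0.
Proof.
move=> cf Hf.
have cn : {within `[- h, h], continuous (fun x => `|f x|)}.
  by apply: continuous_subspaceT => x; apply: cvg_norm; exact: cf.
have hh : - h <= h by rewrite ge0_cp.
have [x0 x0h HS] := EVT_max hh cn.
pose S := `|f x0|.
have fS y : - h <= y <= h -> `|f y| <= S by move=> yh; apply: HS; rewrite in_itv.
have x0h' : - h <= x0 <= h by move: x0h; rewrite in_itv.
have S0 : 0 <= S by exact: normr_ge0.
have bd := lkernel_real_bound S0 cf fS x0h'.
have E := Hf x0 x0h'.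
have {}E : c1 * S = c2 * `|\int[leb]_(y in `[- h, h]) (lkernel c3 (x0 - y) * f y)|%R.
  rewrite /S -[c1 in LHS](gtr0_norm hc1) -[c2 in RHS](gtr0_norm hc2) -!normrM.
  by rewrite -normrN; congr `|_|; apply/eqP; rewrite -subr_eq0 -opprD oppr_eq0 E.
(* At a maximum of |f| the equation and the kernel bound give the factor 29 / 50 times 5 / 3, which
   is 29 / 30 and less than 1. *)
have : c1 * S <= c1 * (S * (29 / 30)).
  rewrite E; apply: (@le_trans _ _ (c2 * (S * (29 / 50 * Delta ^+ 2)))).
    by rewrite ler_pM2l.
  have -> : c2 * (S * (29 / 50 * Delta ^+ 2)) = c1 * (S * (29 / 50 * (c2 / c1 * Delta ^+ 2))).
    by field; rewrite gt_eqF.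
  rewrite ler_pM2l// ler_wpM2l//; move: hsmall; lra.
rewrite ler_pM2l// => Sle.
have {}S0 : S = 0 by lra.
by move=> x /fS; rewrite S0 normr_le0 => /eqP.
Qed.

Lemma Top_inj (f : R -> C) : (forall y, rcont f y) ->
  (forall x, - h <= x <= h -> Top f x = 0) -> forall x, - h <= x <= h -> f x = 0.
Proof.
move=> cf Hf x xh; apply: complexP.
  apply: (@Top_inj_real (fun y => Re (f y))) => // [y|z zh]; first by case: (cf y).
  have := congr1 (@complex.Re R) (Hf z zh); rewrite /Top ReD !ReM /= !mul0r !subr0 => <-.
  by congr (_ + _ * _); apply: eq_Rintegral => y _; rewrite ReM /= mul0r subr0.
apply: (@Top_inj_real (fun y => Im (f y))) => // [y|z zh]; first by case: (cf y).
have := congr1 (@complex.Im R) (Hf z zh); rewrite /Top ImD !ImM /= !mul0r !addr0 => <-.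
by congr (_ + _ * _); apply: eq_Rintegral => y _; rewrite ImM /= mul0r addr0.
Qed.

Lemma rcont_ccoshM (eta : C) (x : R) : rcont (fun y => ccosh (eta * y%:C)) x.
Proof.
apply: rcontM; last exact: rcont_cst.
apply: rcontD; first exact: rcont_cexpM.
by apply: rcont_cexp; apply: rcontN; apply: rcontM; [exact: rcont_cst|exact: rcont_id].
Qed.

Lemma rcont_csinhM (eta : C) (x : R) : rcont (fun y => csinh (eta * y%:C)) x.
Proof.
apply: rcontM; last exact: rcont_cst.
apply: rcontB; first exact: rcont_cexpM.
by apply: rcont_cexp; apply: rcontN; apply: rcontM; [exact: rcont_cst|exact: rcont_id].
Qed.

Lemma ccoshN (z : C) : ccosh (- z) = ccosh z.
Proof. by rewrite /ccosh opprK addrC. Qed.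

Lemma csinhN (z : C) : csinh (- z) = - csinh z.
Proof. by rewrite /csinh opprK; ring. Qed.

Lemma ccosh0 : ccosh (0 : C) = 1.
Proof. by rewrite /ccosh oppr0 cexp0; field. Qed.

(* [T phi] lies in the span of [cosh (c3 x)] and [x sinh (c3 x)]; [a] and [b]
   play the role of A(eta) and B(eta). *)
Definition adapted (phi : R -> C) (a b : C) := (forall y, rcont phi y) /\
  forall x, - h <= x <= h -> Top phi x = c1%:C * a * ccosh (c3 * x)%:C +
    c1%:C * b / (2 * c3%:C) * (x%:C * csinh (c3 * x)%:C).

Lemma adapted_lin (phi psi : R -> C) (a b a' b' u v : C) :
  adapted phi a b -> adapted psi a' b' ->
  adapted (fun y => u * phi y + v * psi y) (u * a + v * a') (u * b + v * b').
Proof.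
move=> [cp Hp] [cq Hq].
have cu (w : C) f : (forall y, rcont f y) -> forall y, rcont (fun y => w * f y) y.
  by move=> cf y; apply: rcontM => //; exact: rcont_cst.
split=> [y|x xh]; first by apply: rcontD; exact: cu.
rewrite TopD; try exact: cu.
by rewrite !TopZ// Hp// Hq//; field.
Qed.

Definition independent (phi psi : R -> C) := forall u v : C,
  (forall x, - h <= x <= h -> u * phi x + v * psi x = 0) -> u = 0 /\ v = 0.

(** If the determinant vanished, the combinations with coefficients (a', - a) and (b', - b) would
    have zero coordinates, so they would lie in the kernel of the injective operator. Independence
    then gives a = a' = b = b' = 0, and [phi] itself would be in the kernel. *)
Lemma adapted_det_neq0 (phi psi : R -> C) (a b a' b' : C) :
  adapted phi a b -> adapted psi a' b' -> independent phi psi ->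
  a * b' - b * a' != 0.
Proof.
move=> Hp Hq Hi; apply/eqP => det0.
have key u v : u * a + v * a' = 0 -> u * b + v * b' = 0 -> u = 0 /\ v = 0.
  move=> e1 e2; have [cl Hl] := adapted_lin u v Hp Hq.
  by apply: Hi; apply: Top_inj => // x xh; rewrite Hl// e1 e2; field.
have [] := key a' (- a); first by ring.
  by rewrite -[RHS]oppr0 -det0; ring.
move=> a'0 /eqP; rewrite oppr_eq0 => /eqP a0.
have [] := key b' (- b); [by rewrite -det0; ring|by ring|].
move=> b'0 /eqP; rewrite oppr_eq0 => /eqP b0.
have [] := key 1 0; rewrite ?a0 ?b0 ?a'0 ?b'0; try by ring.
by move=> /eqP; rewrite oner_eq0.
Qed.

(** Since [wfun 0 = qden / c3 ^+ 2], the operator maps the constant [c3 ^+ 2 / qden] to 1 plus an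
    element whose coordinates, in the sense of [adapted], are [- Ucoef] and [Vcoef]. *)
Definition qden : C := 2 * c2%:C + c3%:C ^+ 2 * c1%:C.
Definition Ucoef : C := c1%:C^-1 - A 0 * c3%:C ^+ 2 / qden.
Definition Vcoef : C := c3%:C ^+ 2 / c1%:C + B 0 * c3%:C ^+ 2 / qden.

Lemma qden_neq0 : qden != 0.
Proof.
have -> : qden = (2 * c2 + c3 ^+ 2 * c1)%:C by rewrite /qden; ring.
rewrite real_complex_eq0 gt_eqF//.
by rewrite addr_gt0 ?mulr_gt0// exprn_gt0.
Qed.

(** Cramer's rule for u a + v a' = Ucoef, u b + v b' = - Vcoef, which cancels what the constant term
    leaves besides 1. *)
Definition solution (phi psi : R -> C) (a b a' b' : C) (x : R) : C :=
  c3%:C ^+ 2 / qden + ((Ucoef * b' + Vcoef * a') / (a * b' - b * a') * phi x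
   - (Vcoef * a + Ucoef * b) / (a * b' - b * a') * psi x).

Lemma Top_solution (phi psi : R -> C) (a b a' b' : C) :
  adapted phi a b -> adapted psi a' b' -> a * b' - b * a' != 0 ->
  (forall y, rcont (solution phi psi a b a' b') y) /\
  forall x, - h <= x <= h -> Top (solution phi psi a b a' b') x = 1.
Proof.
move=> Hp Hq det0.
set d := a * b' - b * a' in det0.
pose u := (Ucoef * b' + Vcoef * a') / d; pose v := - ((Vcoef * a + Ucoef * b) / d).
have [cl Hl] := adapted_lin u v Hp Hq.
have E : solution phi psi a b a' b' = fun x => c3%:C ^+ 2 / qden * ccosh (0 * x%:C) + (u * phi x + v * psi x).
  by apply/funext => x; rewrite /solution -/d mul0r ccosh0 /u /v mulr1 mulNr.
have cc y : rcont (fun x => c3%:C ^+ 2 / qden * ccosh (0 * x%:C)) y.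
  by apply: rcontM; [exact: rcont_cst|exact: rcont_ccoshM].
rewrite E; split=> [y|x xh]; first by apply: rcontD.
have c30 : 0 ^+ 2 != c3%:C ^+ 2 by rewrite expr0n /= eq_sym expf_neq0.
rewrite TopD// TopZ; last exact: rcont_ccoshM.
rewrite Top_ccosh// Hl// mul0r ccosh0 /wfun.
have e1 : u * a + v * a' = Ucoef by rewrite /u /v /d; field.
have e2 : u * b + v * b' = - Vcoef by rewrite /u /v /d; field.
rewrite e1 e2 /Ucoef /Vcoef /quart.
set Y := ccosh _; set Z := csinh _; set X := x%:C; set A0 := A 0; set B0 := B 0.
rewrite {cl Hl E cc u v e1 e2}; have := qden_neq0; rewrite /qden => q0.
by field; rewrite c1C c3C q0.
Qed.

(** The closed form with its data kept abstract, so that it covers two distinct roots as well as a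
    root together with its derivative data. *)
Definition kformula (a b a' b' s s' : C) : C :=
  2 / (a * b' - b * a') * Ucoef * (s * b' - s' * b)
  + 2 / (a * b' - b * a') * Vcoef * (s * a' - s' * a)
  + Delta%:C * c3%:C ^+ 2 / qden.

Lemma kernel_formulaE (eta1 eta2 : C) : kernel_formula Delta c1 c2 c3 eta1 eta2 =
  kformula (A eta1) (B eta1) (A eta2) (B eta2) (shc Delta eta1) (shc Delta eta2).
Proof.
rewrite /kernel_formula /kformula /detAB /Ucoef /Vcoef /qden.
have -> : (2 * c2 + c3 ^+ 2 * c1)%:C = 2 * c2%:C + c3%:C ^+ 2 * c1%:C by ring.
have -> : (c3 ^+ 2 / c1)%:C = c3%:C ^+ 2 / c1%:C by rewrite rmorphM fmorphV rmorphXn.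
have -> : (Delta * c3 ^+ 2)%:C = Delta%:C * c3%:C ^+ 2 by ring.
by have -> : (c3 ^+ 2)%:C = c3%:C ^+ 2 by ring.
Qed.

Lemma cint_cst (a : C) : cint (- h) h (fun=> a) = Delta%:C * a.
Proof.
rewrite (@cint_FTC _ _ _ _ (fun y => a * y%:C)).
- have -> : (- h)%:C = - h%:C :> C by ring.
  by rewrite rmorphM fmorphV rmorph_nat; field.
- by rewrite ge0_cp.
- by move=> x _; exact: rcont_cst.
- by move=> x _; have := rderZ a (rder_id x); rewrite mulr1.
Qed.

Lemma cint_solution (phi psi : R -> C) (a b a' b' s s' : C) :
  (forall y, rcont phi y) -> (forall y, rcont psi y) ->
  cint (- h) h phi = 2 * s -> cint (- h) h psi = 2 * s' -> a * b' - b * a' != 0 ->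
  cint (- h) h (solution phi psi a b a' b') = kformula a b a' b' s s'.
Proof.
move=> cp cq ip iq det0; rewrite /solution.
set u := (Ucoef * b' + _) / _; set v := (_ + _ * b) / _; set w := _ / qden.
have ci (f : R -> C) : (forall y, rcont f y) -> cintegrable leb `[- h, h] f.
  by move=> cf; apply: rcont_integrable.
have -> : cint (- h) h (fun x => w + (u * phi x - v * psi x)) = Delta%:C * w + (u * (2 * s) - v * (2 * s')).
  rewrite -ip -iq -cint_cst -!cintegralZ//; try exact: ci.
  rewrite -cintegralB//; try by apply: cintegrableZ => //; exact: ci.
  rewrite -cintegralD//; first by apply: ci => y; exact: rcont_cst.
  by apply: cintegrableB => //; apply: cintegrableZ => //; exact: ci.
rewrite /kformula /w /u /v; have := qden_neq0; set q := qden; set U := Ucoef; set V := Vcoef => q0.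
by field; rewrite det0 q0.
Qed.

Lemma expint1 (z : C) : z != 0 ->
  expint h (fun=> 1) z = (cexp (z * h%:C) - cexp (- (z * h%:C))) / z.
Proof.
move=> z0; rewrite /expint (@cint_FTC _ _ _ _ (fun y => z^-1 * cexp (z * y%:C))).
- have -> : z * (- h)%:C = - (z * h%:C) by rewrite rmorphN; ring.
  by set E1 := cexp _; set E2 := cexp _; field.
- by rewrite ge0_cp.
- by move=> x _; apply: rcontM; [exact: rcont_cst|exact: rcont_cexpM].
- by move=> x _; apply: rder_eq; [apply: rderZ; exact: rder_cexp|rewrite mul1r; field].
Qed.

Lemma shcE (eta : C) : eta != 0 -> coshint h (fun=> 1) eta = 2 * shc Delta eta.
Proof.
move=> eta0; rewrite coshintE//; last by move=> x; exact: rcont_cst.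
rewrite !expint1 ?oppr_eq0// /shc /csinh !mulNr !opprK.
have -> : Delta%:C * eta / 2 = eta * h%:C.
  by rewrite rmorphM fmorphV rmorph_nat; field.
by set E1 := cexp _; set E2 := cexp _; field.
Qed.

Lemma quart_neq0 : quart 0 != 0.
Proof.
have -> : quart 0 = c3%:C ^+ 2 * qden by rewrite /quart /qden; ring.
by rewrite mulf_neq0 ?expf_neq0// qden_neq0.
Qed.

Lemma quart_root_neq0 (eta : C) : quart eta = 0 -> eta != 0.
Proof. by move=> q0; apply: contra_eq_neq q0 => ->; exact: quart_neq0. Qed.

(** At eta^2 = c3^2 the quartic equals 4 c2 c3^2, so no root sits at the poles of [wfun]. *)
Lemma quart_root_sqr (eta : C) : quart eta = 0 -> eta ^+ 2 != c3%:C ^+ 2.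
Proof.
move=> q0; apply: contra_eq_neq q0 => e.
have -> : quart eta = (4 * c2 * c3 ^+ 2)%:C.
  have e4 : eta ^+ 4 = (eta ^+ 2) ^+ 2 by rewrite -exprM.
  by rewrite /quart e4 e; ring.
rewrite real_complex_eq0 gt_eqF//.
by rewrite !mulr_gt0// exprn_gt0.
Qed.

Lemma adapted_root (eta : C) : quart eta = 0 ->
  adapted (fun y => ccosh (eta * y%:C)) (A eta) (B eta).
Proof.
move=> q0; split=> [y|x xh]; first exact: rcont_ccoshM.
by rewrite Top_ccosh ?quart_root_sqr// /wfun q0 mul0r; field.
Qed.

(** The value at 0 gives u = - v; the coefficient of x^2 then gives v (eta1^2 - eta2^2) = 0. *)
Lemma independent_distinct (eta1 eta2 : C) : eta1 ^+ 2 != eta2 ^+ 2 ->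
  independent (fun y => ccosh (eta1 * y%:C)) (fun y => ccosh (eta2 * y%:C)).
Proof.
move=> e12 u v H.
have h00 : - h <= 0 <= h by rewrite oppr_le0 h_ge0.
have := H 0 h00; rewrite !mulr0 ccosh0 !mulr1 => /eqP; rewrite addr_eq0 => /eqP uv.
suff v0 : v = 0 by rewrite uv v0 oppr0.
have e0 : eta1 ^+ 2 - eta2 ^+ 2 != 0 by rewrite subr_eq0.
suff /eqP : v * (eta1 ^+ 2 - eta2 ^+ 2) = 0 by rewrite mulf_eq0 (negbTE e0) orbF => /eqP.
pose K e := 8 * cnorm e ^+ 3 * expR (cnorm e * h).
have KT e (x : R) : 0 < x <= h ->
    cnorm (ccosh (e * x%:C) - 1 - (e * x%:C) ^+ 2 / 2) <= K e * x ^+ 3.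
  move=> /andP[x0 xh]; apply: le_trans (ccosh_taylor _) _.
  rewrite cnormM cnormR gtr0_norm// exprMn mulrA mulrAC /K.
  rewrite ler_wpM2r ?exprn_ge0 ?(ltW x0)// ler_wpM2l ?mulr_ge0 ?exprn_ge0 ?cnorm_ge0//.
  by rewrite ler_expR ler_wpM2l// cnorm_ge0.
apply: (@cnorm_le_small_eq0 R _ (2 * (cnorm v * (K eta1 + K eta2))) h) => // x x0h.
have /andP[x0 xh] := x0h.
have xh' : - h <= x <= h by lra.
have E : v * (eta1 ^+ 2 - eta2 ^+ 2) * (x ^+ 2 / 2)%:C =
    v * ((ccosh (eta2 * x%:C) - 1 - (eta2 * x%:C) ^+ 2 / 2) -
         (ccosh (eta1 * x%:C) - 1 - (eta1 * x%:C) ^+ 2 / 2)).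
  have {}H : v * (ccosh (eta2 * x%:C) - ccosh (eta1 * x%:C)) = 0.
    by rewrite -(H x xh') uv; ring.
  rewrite rmorphM rmorphXn fmorphV rmorph_nat.
  have -> : v * ((ccosh (eta2 * x%:C) - 1 - (eta2 * x%:C) ^+ 2 / 2) -
      (ccosh (eta1 * x%:C) - 1 - (eta1 * x%:C) ^+ 2 / 2)) =
    v * (ccosh (eta2 * x%:C) - ccosh (eta1 * x%:C)) +
    v * ((eta1 * x%:C) ^+ 2 / 2 - (eta2 * x%:C) ^+ 2 / 2) by ring.
  by rewrite H; field.
have x2 : 0 < x ^+ 2 / 2 by rewrite divr_gt0// exprn_gt0.
rewrite -(ler_pM2r x2) -[x ^+ 2 / 2 in X in X <= _]gtr0_norm// -cnormR -cnormM E cnormM.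
have -> : 2 * (cnorm v * (K eta1 + K eta2)) * x * (x ^+ 2 / 2) =
  cnorm v * (K eta2 * x ^+ 3 + K eta1 * x ^+ 3) by field.
rewrite ler_wpM2l ?cnorm_ge0// (le_trans (cnormB _ _))//.
by apply: lerD; exact: KT.
Qed.

(** The value at 0 gives u = 0; then x sinh (eta x) is eta x^2 to leading order, which forces v eta
    = 0. *)
Lemma independent_double (eta : C) : eta != 0 ->
  independent (fun y => ccosh (eta * y%:C)) (fun y => y%:C * csinh (eta * y%:C)).
Proof.
move=> eta0 u v H.
have h00 : - h <= 0 <= h by rewrite oppr_le0 h_ge0.
have := H 0 h00; rewrite !mulr0 ccosh0 mul0r mulr0 addr0 mulr1 => u0; split => //.
suff /eqP : v * eta = 0 by rewrite mulf_eq0 (negbTE eta0) orbF => /eqP.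
pose K := 4 * cnorm eta ^+ 2 * expR (cnorm eta * h).
have KT (x : R) : 0 < x <= h -> cnorm (csinh (eta * x%:C) - eta * x%:C) <= K * x ^+ 2.
  move=> /andP[x0 xh]; apply: le_trans (csinh_taylor _) _.
  rewrite cnormM cnormR gtr0_norm// exprMn mulrA mulrAC /K.
  rewrite ler_wpM2r ?exprn_ge0 ?(ltW x0)// ler_wpM2l ?mulr_ge0 ?exprn_ge0 ?cnorm_ge0//.
  by rewrite ler_expR ler_wpM2l// cnorm_ge0.
apply: (@cnorm_le_small_eq0 R _ (cnorm v * K) h) => // x x0h.
have /andP[x0 xh] := x0h.
have xh' : - h <= x <= h by lra.
have xC : x%:C != 0 by rewrite real_complex_eq0 gt_eqF.
have E : v * eta * x%:C = - (v * (csinh (eta * x%:C) - eta * x%:C)).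
  have : x%:C * (v * csinh (eta * x%:C)) = 0.
    by rewrite -(H x xh') u0; ring.
  move/eqP; rewrite mulf_eq0 (negbTE xC) /= => /eqP v0.
  by rewrite mulrBr v0; ring.
rewrite -(ler_pM2r x0) -[x in X in X <= _]gtr0_norm// -cnormR -cnormM E cnormN cnormM.
rewrite -!(mulrA (cnorm v)) ler_wpM2l ?cnorm_ge0//.
by apply: le_trans (KT x x0h) _; rewrite expr2 mulrA.
Qed.

(** Derivatives of A and B in [eta] under the integral sign; at a double root they are the
    coordinates of the image of x sinh (eta x). *)
Definition Ader (eta : C) : C := c2%:C / c1%:C *
  cint (- h) h (fun a => a%:C * csinh (eta * a%:C) * (lkernel c3 a)%:C).
Definition Bder (eta : C) : C := 2 * eta - 2 * (c2%:C * c3%:C / c1%:C) *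
  cint (- h) h (fun a => a%:C * csinh (eta * a%:C) * (ekernel c3 a)%:C).
Definition Sder (eta : C) : C := cint (- h) h (fun a => a%:C * csinh (eta * a%:C)).

Lemma Afun_sder (eta : C) : sder A eta (Ader eta).
Proof.
have -> : A = fun eta => 1 + c2%:C / c1%:C * coshint h (fun a => (lkernel c3 a)%:C) eta.
  by apply/funext => z; exact: AfunE.
apply: sder_eq.
  apply: sderD; first exact: sder_cst.
  by apply: sderZ; apply: coshint_sder => // x; exact: lkernel_rcont.
by rewrite add0r.
Qed.

Lemma Bfun_sder (eta : C) : sder B eta (Bder eta).
Proof.
have -> : B = fun eta => (eta ^+ 2 + (2 * (c2%:C / c1%:C) - c3%:C ^+ 2)) +
    - (2 * (c2%:C * c3%:C / c1%:C)) * coshint h (fun a => (ekernel c3 a)%:C) eta.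
  by apply/funext => z; rewrite BfunE mulNr.
apply: sder_eq.
  apply: sderD.
    by apply: sderD; [exact: sder_sqr|exact: sder_cst].
  by apply: sderZ; apply: coshint_sder => // x; exact: ekernel_rcont.
by rewrite addr0 mulNr.
Qed.

Lemma shc_sder (eta : C) : sder (coshint h (fun=> 1)) eta (Sder eta).
Proof.
apply: sder_eq; first by apply: coshint_sder => // x; exact: rcont_cst.
by apply: eq_cintegral => a _; rewrite mulr1.
Qed.

Lemma ccosh_cder (x : R) (eta : C) :
  cder (fun z => ccosh (z * x%:C)) eta (x%:C * csinh (eta * x%:C)).
Proof.
have e (c : C) : cder (fun z => cexp (c * z)) eta (cexp (c * eta) * c).
  by apply: (cder_comp (f := @cexp R)); [exact: cder_cexp|exact: cder_linear].
have -> : (fun z => ccosh (z * x%:C)) = fun z => 2^-1 * (cexp (x%:C * z) + cexp (- x%:C * z)).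
  by apply/funext => z; rewrite /ccosh mulNr ![x%:C * z]mulrC; field.
apply: cder_eq; first by apply: cderZ; apply: cderD; exact: e.
by rewrite /csinh mulNr ![x%:C * eta]mulrC; field.
Qed.

(** Differentiate [Top_ccosh] in [eta]: at a double root [wfun] and its derivative both vanish, so
    only the derivatives of A and B survive. *)
Lemma adapted_double (eta : C) : quart eta = 0 ->
  (forall z, quart z = c1%:C * (z ^+ 2 - eta ^+ 2) ^+ 2) ->
  adapted (fun y => y%:C * csinh (eta * y%:C)) (Ader eta) (Bder eta).
Proof.
move=> q0 qd; split=> [y|x xh].
  by apply: rcontM; [exact: rcont_id|exact: rcont_csinhM].
have e3 := quart_root_sqr q0.
have d0 : eta ^+ 2 - c3%:C ^+ 2 != 0 by rewrite subr_eq0.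
have cX n (z : C) : ccont (fun w => w ^+ n) z := ccontX n z.
have cd : ccont (fun z => z ^+ 2 - c3%:C ^+ 2) eta.
  by apply: ccontB; [exact: cX|exact: ccont_cst].
(* [Top_ccosh] excludes eta^2 = c3^2; on this disc it is available, so it may be differentiated. *)
have [r r0 Hr] : exists2 r : R, 0 < r & forall w, cnorm (w - eta) < r -> w ^+ 2 != c3%:C ^+ 2.
  have n0 : 0 < cnorm (eta ^+ 2 - c3%:C ^+ 2) by rewrite cnorm_gt0.
  have [r r0 Hr] := ccontP cd n0; exists r => // w /Hr.
  by apply: contraTneq => ->; rewrite subrr sub0r cnormN ltxx.
(* The explicit quotient still contains a factor [w - eta], hence vanishes at [eta]. *)
have dw : cder wfun eta 0.
  exists (fun w => c1%:C * (w - eta) * (w + eta) ^+ 2 / (w ^+ 2 - c3%:C ^+ 2) ^+ 2); split.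
  - by move=> w; rewrite /wfun q0 qd mul0r add0r; ring.
  - by rewrite subrr mulr0 !mul0r.
  - apply: ccontM.
      apply: ccontM; first apply: ccontM; first exact: ccont_cst.
        by apply: ccontB; [exact: ccont_id|exact: ccont_cst].
      apply: (ccont_comp (f := fun w => w ^+ 2)); first exact: cX.
      by apply: ccontD; [exact: ccont_id|exact: ccont_cst].
    apply: ccontV; first by rewrite expf_neq0.
    by apply: (ccont_comp (f := fun w => w ^+ 2)); [exact: cX|exact: cd].
have w0 : wfun eta = 0 by rewrite /wfun q0 mul0r.
have L : cder (fun z => Top (fun y => ccosh (z * y%:C)) x) eta
    (Top (fun y => y%:C * csinh (eta * y%:C)) x).
  have -> : (fun z => Top (fun y => ccosh (z * y%:C)) x) =
      fun z => c1%:C * ccosh (z * x%:C) + c2%:C * coshint h (fun y => (lkernel c3 (x - y))%:C) z.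
    by apply/funext => z; congr (_ + _ * _); apply: eq_cintegral => y _; rewrite mulrC.
  apply: cder_eq.
    apply: cderD; apply: cderZ; first exact: ccosh_cder.
    by apply: sder_cder; apply: coshint_sder => // y; exact: lkernel_sub_rcont.
  by congr (_ + _ * _); apply: eq_cintegral => y _; rewrite mulrC.
set Y := ccosh (c3 * x)%:C; set Z := x%:C * csinh (c3 * x)%:C.
have RR : cder (fun z => wfun z * ccosh (z * x%:C) + (c1%:C * A z - wfun z) * Y +
    (c1%:C * B z - wfun z * (z ^+ 2 - c3%:C ^+ 2)) / (2 * c3%:C) * Z) eta
    (c1%:C * Ader eta * Y + c1%:C * Bder eta / (2 * c3%:C) * Z).
  apply: cder_eq.
    apply: cderD; first apply: cderD.
    - by apply: cderM; [exact: dw|exact: ccosh_cder].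
    - apply: cderM; last exact: cder_cst.
      by apply: cderB; [apply: cderZ; exact: sder_cder (Afun_sder _)|exact: dw].
    - apply: cderM; last exact: cder_cst.
      apply: cderM; last exact: cder_cst.
      apply: cderB; first by apply: cderZ; exact: sder_cder (Bfun_sder _).
      apply: cderM; first exact: dw.
      by apply: cderB; [exact: sder_cder (sder_sqr _)|exact: cder_cst].
  by rewrite w0; set X := ccosh _; set W := csinh _; field.
apply: cder_unique L _; apply: (cder_near r0) RR => w wr.
by rewrite Top_ccosh ?Hr.
Qed.

(** The quartic is even, so a nonzero double root [eta] comes with the double root [- eta];
    comparing coefficients uses only the vanishing of the quartic and of its derivative. *)
Lemma quart_double (eta : C) : ('X - eta%:P) * ('X - eta%:P) %| quartic c1 c2 c3 ->
  eta != 0 -> quart eta = 0 /\ forall z, quart z = c1%:C * (z ^+ 2 - eta ^+ 2) ^+ 2.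
Proof.
move=> /dvdpP[r Er] eta0.
have q0 : quart eta = 0 by rewrite -quarticE Er !hornerM !hornerXsubC subrr !mulr0.
have dq : 4 * c1%:C * eta ^+ 3 + 4 * (c2%:C - c1%:C * c3%:C ^+ 2) * eta = 0.
  have : (quartic c1 c2 c3)^`().[eta] = 0.
    rewrite Er !derivM !derivXsubC !(mulr1, mul1r) !(hornerD, hornerM).
    by rewrite hornerN hornerX hornerC subrr addr0 !(mulr0, mul0r, addr0).
  move=> <-; rewrite /quartic !derivD !derivZ !derivXn derivC addr0 hornerD !hornerZ !hornerMn !hornerXn /=.
  have -> : (2 * (c2 - c1 * c3 ^+ 2))%:C = 2 * (c2%:C - c1%:C * c3%:C ^+ 2).
    by rewrite rmorphM rmorphB rmorphM rmorphXn rmorph_nat.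
  by ring.
have e2 : c2%:C - c1%:C * c3%:C ^+ 2 = - c1%:C * eta ^+ 2.
  have n4 : 4 * eta != 0 by rewrite mulf_neq0 ?pnatr_eq0.
  by apply: (mulfI n4); apply/eqP; rewrite -subr_eq0 -dq; apply/eqP; ring.
split => // z; rewrite /quart e2.
have -> : c3%:C ^+ 2 * (2 * c2%:C + c1%:C * c3%:C ^+ 2) = c1%:C * eta ^+ 4.
  by move: q0; rewrite /quart e2 => /eqP; rewrite addrC addr_eq0 => /eqP ->; ring.
ring.
Qed.

(** Evenness of [phi] makes its transform even, so a single function [tail] describes both half
    planes. *)
Definition solves (phi : R -> C) (K0 : C) := [/\ forall y, rcont phi y,
  forall x, phi (- x) = phi x, forall x, - h <= x <= h -> Top phi x = 1
  & cint (- h) h phi = K0].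

Lemma root_neq (eta1 eta2 : C) : eta1 != eta2 -> eta1 + eta2 != 0 -> eta1 ^+ 2 != eta2 ^+ 2.
Proof. by move=> n p; rewrite -subr_eq0 subr_sqr mulf_neq0// subr_eq0. Qed.

Lemma solution_distinct (eta1 eta2 : C) : quart eta1 = 0 -> quart eta2 = 0 ->
  eta1 ^+ 2 != eta2 ^+ 2 -> detAB Delta c1 c2 c3 eta1 eta2 != 0 /\
  exists phi, solves phi (kernel_formula Delta c1 c2 c3 eta1 eta2).
Proof.
move=> q1 q2 e12.
have a1 := adapted_root q1; have a2 := adapted_root q2.
have det0 := adapted_det_neq0 a1 a2 (independent_distinct e12).
split=> //; have [cs Ts] := Top_solution a1 a2 det0.
exists (solution (fun y => ccosh (eta1 * y%:C)) (fun y => ccosh (eta2 * y%:C))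
  (A eta1) (B eta1) (A eta2) (B eta2)); split => //.
  by move=> x; rewrite /solution rmorphN !mulrN !ccoshN.
rewrite kernel_formulaE; apply: cint_solution => //; try by move=> y; exact: rcont_ccoshM.
  by rewrite -shcE ?quart_root_neq0//; apply: eq_cintegral => x _; rewrite mulr1.
by rewrite -shcE ?quart_root_neq0//; apply: eq_cintegral => x _; rewrite mulr1.
Qed.

(** An entire substitute for [shc], equal to it away from 0, whose strict derivative is available
    from [shc_sder]. *)
Definition shalf (eta : C) : C := coshint h (fun=> 1) eta / 2.

Lemma solution_double (eta : C) : quart eta = 0 ->
  (forall z, quart z = c1%:C * (z ^+ 2 - eta ^+ 2) ^+ 2) ->
  A eta * Bder eta - B eta * Ader eta != 0 /\
  exists phi, solves phi
    (kformula (A eta) (B eta) (Ader eta) (Bder eta) (shalf eta) (Sder eta / 2)).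
Proof.
move=> q0 qd; have e0 := quart_root_neq0 q0.
have a1 := adapted_root q0; have a2 := adapted_double q0 qd.
have det0 := adapted_det_neq0 a1 a2 (independent_double e0).
split=> //; have [cs Ts] := Top_solution a1 a2 det0.
exists (solution (fun y => ccosh (eta * y%:C)) (fun y => y%:C * csinh (eta * y%:C))
  (A eta) (B eta) (Ader eta) (Bder eta)); split => //.
  by move=> x; rewrite /solution rmorphN !mulrN !ccoshN csinhN mulrNN.
apply: cint_solution => //.
- by move=> y; exact: rcont_ccoshM.
- by move=> y; apply: rcontM; [exact: rcont_id|exact: rcont_csinhM].
- rewrite [RHS]mulrC divfK ?pnatr_eq0//.
  by apply: eq_cintegral => x _; rewrite mulr1.
- by rewrite [RHS]mulrC divfK ?pnatr_eq0.
Qed.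

Lemma ctendsI T (F : set_system T) (FF : Filter F) (f : T -> C) (l : C) :
  (forall e : R, 0 < e -> \forall x \near F, cnorm (f x - l) <= e) -> ctends F f l.
Proof.
move=> H; have t0 : ctends F (fun x => f x - l) 0.
  apply: ctends0; apply/cvgrPdist_le => e e0; near=> x.
  rewrite sub0r normrN ger0_norm ?cnorm_ge0//; near: x; exact: H.
have t1 : ctends F (fun x => f x - l + l) (0 + l).
  by apply: ctendsD => //; exact: ctends_cst.
rewrite add0r in t1; apply: ctends_near t1.
by near=> x; rewrite subrK.
Unshelve. all: by end_near. Qed.

Section Diagonal.
Variable eta : C.
Local Notation G := (within [set p | p.1 != p.2] (nbhs (eta : C^o, eta : C^o))).

Lemma near_diagonal (r : R) : 0 < r -> \forall p \near G,
  [/\ cnorm (p.1 - eta) < r, cnorm (p.2 - eta) < r & p.1 != p.2].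
Proof.
move=> r0; pose U : set C := [set w | cnorm (w - eta) < r].
exists (U, U); first by split; apply/nbhs_cnorm; exists r.
by move=> [p q] [/= h1 h2] ne; split.
Qed.

Lemma ctends_diagonal (f : C -> C) : ccont f eta -> ctends G (fun p => f p.1) (f eta).
Proof.
move=> cf; apply: (ctends_comp cf); apply: ctendsI => e e0.
have n := near_diagonal e0; near=> p.
have [+ _ _] : [/\ cnorm (p.1 - eta) < e, cnorm (p.2 - eta) < e & p.1 != p.2] by near: p.
exact: ltW.
Unshelve. all: by end_near. Qed.

(** Here strictness is essential: both points of the slope vary. *)
Lemma ctends_slope (f : C -> C) (d : C) : sder f eta d ->
  ctends G (fun p => (f p.2 - f p.1) / (p.2 - p.1)) d.
Proof.
move=> df; apply: ctendsI => e e0; have [r r0 Hr] := df e e0.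
have n := near_diagonal r0; near=> p.
have [p1 p2 p12] : [/\ cnorm (p.1 - eta) < r, cnorm (p.2 - eta) < r & p.1 != p.2] by near: p.
have n0 : p.2 - p.1 != 0 by rewrite subr_eq0 eq_sym.
have -> : (f p.2 - f p.1) / (p.2 - p.1) - d = (f p.2 - f p.1 - d * (p.2 - p.1)) / (p.2 - p.1).
  by field.
by rewrite cnormM cnormV ler_pdivrMr ?cnorm_gt0//; exact: Hr.
Unshelve. all: by end_near. Qed.

(** Numerators and denominator are alternating in (a, b, s) and (a', b', s'), so subtracting the
    first triple from the second changes nothing, and the common factor 1 / t cancels. *)
Lemma kformula_ratio (t a b a' b' s s' : C) : t != 0 -> a * b' - b * a' != 0 ->
  kformula a b ((a' - a) / t) ((b' - b) / t) s ((s' - s) / t) = kformula a b a' b' s s'.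
Proof.
move=> t0 d0; rewrite /kformula.
have -> : a * ((b' - b) / t) - b * ((a' - a) / t) = (a * b' - b * a') / t by field.
have := qden_neq0; set q := qden; set U := Ucoef; set V := Vcoef => q0.
by field; rewrite t0 d0 q0.
Qed.

Lemma kernel_formula_cvg : eta != 0 -> A eta * Bder eta - B eta * Ader eta != 0 ->
  (\forall p \near G, detAB Delta c1 c2 c3 p.1 p.2 != 0) /\
  kernel_formula Delta c1 c2 c3 p.1 p.2 @[p --> G] -->
    (kformula (A eta) (B eta) (Ader eta) (Bder eta) (shalf eta) (Sder eta / 2) : C^o).
Proof.
move=> eta0 W0.
have dS : sder shalf eta (Sder eta / 2).
  have -> : shalf = fun z => 2^-1 * coshint h (fun=> 1) z by apply/funext => z; rewrite /shalf mulrC.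
  by apply: sder_eq; [apply: sderZ; exact: shc_sder|rewrite mulrC].
have cont f d : sder f eta d -> ctends G (fun p => f p.1) (f eta).
  by move=> df; apply: ctends_diagonal; exact: cder_cont (sder_cder df).
have dA := Afun_sder eta; have dB := Bfun_sder eta.
have tA := cont _ _ dA; have tB := cont _ _ dB; have tS := cont _ _ dS.
have sA := ctends_slope dA; have sB := ctends_slope dB; have sS := ctends_slope dS.
have tW : ctends G (fun p => A p.1 * ((B p.2 - B p.1) / (p.2 - p.1)) -
    B p.1 * ((A p.2 - A p.1) / (p.2 - p.1))) (A eta * Bder eta - B eta * Ader eta).
  by apply: ctendsB; apply: ctendsM.
(* The radius |eta| keeps both points away from 0, where [shc] and [shalf] could differ. *)
have nz : 0 < cnorm eta by rewrite cnorm_gt0.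
have n := near_diagonal nz.
have nW : \forall p \near G, 0 < cnorm (A p.1 * ((B p.2 - B p.1) / (p.2 - p.1)) -
    B p.1 * ((A p.2 - A p.1) / (p.2 - p.1))).
  by apply: (cvgr_gt _ (ctends_cnorm tW)); rewrite cnorm_gt0.
have ndet : \forall p \near G, detAB Delta c1 c2 c3 p.1 p.2 != 0.
  near=> p.
  have [p1 p2 p12] : [/\ cnorm (p.1 - eta) < cnorm eta, cnorm (p.2 - eta) < cnorm eta & p.1 != p.2].
    by near: p.
  have n0 : p.2 - p.1 != 0 by rewrite subr_eq0 eq_sym.
  have : 0 < cnorm (A p.1 * ((B p.2 - B p.1) / (p.2 - p.1)) -
    B p.1 * ((A p.2 - A p.1) / (p.2 - p.1))) by near: p.
  rewrite cnorm_gt0; apply: contra_neq; rewrite /detAB => E.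
  have {}E : A p.1 * (B p.2 - B p.1) - B p.1 * (A p.2 - A p.1) = 0.
    by rewrite -[RHS]E; move: (A p.1) (A p.2) (B p.1) (B p.2) => *; ring.
  by rewrite !mulrA -mulrBl E mul0r.
split=> //; apply/cvg_ctends.
have tK : ctends G (fun p => kformula (A p.1) (B p.1) ((A p.2 - A p.1) / (p.2 - p.1))
    ((B p.2 - B p.1) / (p.2 - p.1)) (shalf p.1) ((shalf p.2 - shalf p.1) / (p.2 - p.1)))
    (kformula (A eta) (B eta) (Ader eta) (Bder eta) (shalf eta) (Sder eta / 2)).
  rewrite /kformula.
  apply: ctendsD; last exact: ctends_cst.
  have tc (c : C) : ctends G (fun=> c) c by exact: ctends_cst.
  have tQ : ctends G (fun p => 2 / (A p.1 * ((B p.2 - B p.1) / (p.2 - p.1)) -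
      B p.1 * ((A p.2 - A p.1) / (p.2 - p.1)))) (2 / (A eta * Bder eta - B eta * Ader eta)).
    by apply: ctendsM; [exact: tc|exact: ctendsV].
  by apply: ctendsD; (apply: ctendsM; [apply: ctendsM => //; exact: tc|apply: ctendsB; exact: ctendsM]).
apply: ctends_near tK; near=> p.
have [p1 p2 p12] : [/\ cnorm (p.1 - eta) < cnorm eta, cnorm (p.2 - eta) < cnorm eta & p.1 != p.2].
  by near: p.
have n0 : p.2 - p.1 != 0 by rewrite subr_eq0 eq_sym.
have d0 : detAB Delta c1 c2 c3 p.1 p.2 != 0 by near: p.
have nz' w : cnorm (w - eta) < cnorm eta -> w != 0.
  by apply: contraTneq => ->; rewrite sub0r cnormN ltxx.
have Sp w : w != 0 -> shalf w = shc Delta w.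
  by move=> w0; rewrite /shalf shcE// mulrC mulKf ?pnatr_eq0.
by rewrite kformula_ratio// !Sp ?nz'// -kernel_formulaE.
Unshelve. all: by end_near. Qed.

End Diagonal.

Lemma quartic_factor (eta1 eta2 : C) :
  ('X - eta1%:P) * ('X - eta2%:P) %| quartic c1 c2 c3 -> quart eta1 = 0 /\ quart eta2 = 0.
Proof.
move=> /dvdpP[r Er].
by split; rewrite -quarticE Er !hornerM !hornerXsubC subrr ?(mul0r, mulr0).
Qed.

(** * The Fourier transform of the solution *)

Section FourierSide.
Variables (phi : R -> C) (K0 : C).
Hypothesis Hphi : solves phi K0.

Local Notation G := (expint h phi).

Let phic y : rcont phi y. Proof. by case: Hphi. Qed.
Let phiN y : phi (- y) = phi y. Proof. by case: Hphi. Qed.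
Let phiT x : - h <= x <= h -> Top phi x = 1. Proof. by case: Hphi => _ _ + _; apply. Qed.

Lemma expint_even eta : G (- eta) = G eta.
Proof.
rewrite /expint cint_oppr//; last by move=> x _; exact: expint_rcont.
by apply: eq_cintegral => y _; rewrite phiN rmorphN mulrNN.
Qed.

Definition mom0 : C := cint (- h) h (fun y => phi y * cexp (c3%:C * y%:C)).
Definition mom1 : C := cint (- h) h (fun y => phi y * ((h - y)%:C * cexp (c3%:C * y%:C))).

(** The integral of [phi] against [edge_int], with the dependence on [eta] made explicit so that
    analyticity and decay can be read off. *)
Definition edge (eta : C) : C := cexp ((eta - c3%:C) * h%:C) *
  (mom1 / (c3%:C - eta) + mom0 / (c3%:C - eta) ^+ 2).

(** The integral of [(x - y) * exp (- c3 (x - y)) * exp (eta x)] over x > h when Re eta < c3: what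
    the full-line convolution has beyond the right endpoint. *)
Definition edge_int (eta : C) (y : R) : C := cexp ((eta - c3%:C) * h%:C) *
  (((c3%:C - eta)^-1 * ((h - y)%:C * cexp (c3%:C * y%:C))) +
   (c3%:C - eta) ^- 2 * cexp (c3%:C * y%:C)).

Lemma cint_edge (eta : C) : cint (- h) h (fun y => phi y * edge_int eta y) = edge eta.
Proof.
have c0 y : rcont (fun y => phi y * cexp (c3%:C * y%:C)) y.
  by apply: rcontM => //; exact: rcont_cexpM.
have c1' y : rcont (fun y => phi y * ((h - y)%:C * cexp (c3%:C * y%:C))) y.
  apply: rcontM => //; apply: rcontM; last exact: rcont_cexpM.
  by apply: rcont_real; apply: cvgB; [exact: cvg_cst|exact: cvg_id].
have ci (f : R -> C) : (forall y, rcont f y) -> cintegrable leb `[- h, h] f.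
  by move=> cf; apply: rcont_integrable.
rewrite /edge /mom0 /mom1 !(mulrC (cint _ _ _)) -!cintegralZ//; try exact: ci.
rewrite -cintegralD//; try by apply: cintegrableZ => //; exact: ci.
rewrite -cintegralZ//; last by apply: cintegrableD => //; apply: cintegrableZ => //; exact: ci.
by apply: eq_cintegral => y _; rewrite /edge_int; ring.
Qed.

Lemma edge_int_rcont eta y : rcont (edge_int eta) y.
Proof.
apply: rcontM; first exact: rcont_cst.
apply: rcontD; last by apply: rcontM; [exact: rcont_cst|exact: rcont_cexpM].
apply: rcontM; first exact: rcont_cst.
apply: rcontM; last exact: rcont_cexpM.
by apply: rcont_real; apply: cvgB; [exact: cvg_cst|exact: cvg_id].
Qed.

Lemma conv_edge (eta : C) (y : R) : - h <= y <= h -> c3%:C + eta != 0 -> c3%:C - eta != 0 ->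
  cint (- h) h (fun x => (lkernel c3 (y - x))%:C * cexp (eta * x%:C)) =
  ((c3%:C + eta) ^- 2 + (c3%:C - eta) ^- 2) * cexp (eta * y%:C)
  - (edge_int eta y + edge_int (- eta) (- y)).
Proof.
move=> yh s0 t0; rewrite lkernel_conv_cexp// /edge_int opprK.
have e1 : cexp (- (c3 * (y + h))%:C) * cexp (- eta * h%:C) =
    cexp ((- eta - c3%:C) * h%:C) * cexp (c3%:C * (- y)%:C).
  by rewrite -!cexpD; congr cexp; ring.
have e2 : cexp (- (c3 * (h - y))%:C) * cexp (eta * h%:C) =
    cexp ((eta - c3%:C) * h%:C) * cexp (c3%:C * y%:C).
  by rewrite -!cexpD; congr cexp; ring.
have e3 : (h - - y)%:C = (y + h)%:C :> C by congr _%:C; ring.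
rewrite e1 e2 e3; move: (cexp _) (cexp _) (cexp _) (cexp _) (cexp _) => E1 E2 E3 E4 E5.
by move: (y + h)%:C (h - y)%:C => u v; field; rewrite s0 t0.
Qed.

(** Fubini on the square, with the evenness of the kernel: the convolution is moved from [phi] to
    the exponential, where it is explicit. *)
Lemma conv_swap (eta : C) :
  cint (- h) h (fun x => cint (- h) h (fun y => (lkernel c3 (x - y))%:C * phi y) * cexp (eta * x%:C)) =
  cint (- h) h (fun y => phi y * cint (- h) h (fun x => (lkernel c3 (y - x))%:C * cexp (eta * x%:C))).
Proof.
pose H (p : R * R) : C := cexp (eta * p.1%:C) * ((lkernel c3 (p.1 - p.2))%:C * phi p.2).
have [W W0 HW] := rcont_bounded (- h) h phic.
have [E E0 HE] := rcont_bounded (- h) h (rcont_cexpM eta).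
have [L L0 HL] := rcont_bounded (- Delta) Delta (lkernel_rcont c3).
have mH : cmeasurable (setT : set (measurableTypeR R * measurableTypeR R)%type) H.
  have [mp1 mp2] : cmeasurable (setT : set (measurableTypeR R)) phi by exact: rcont_cmeasurable.
  have [me1 me2] : cmeasurable (setT : set (measurableTypeR R)) (fun x => cexp (eta * x%:C)).
    by apply: rcont_cmeasurable => // x; exact: rcont_cexpM.
  apply: cmeasurableM => //.
    split.
      exact: (measurableT_comp me1 (@measurable_fst _ _ (measurableTypeR R) (measurableTypeR R))).
    exact: (measurableT_comp me2 (@measurable_fst _ _ (measurableTypeR R) (measurableTypeR R))).
  apply: cmeasurableM => //; last first.
    split.
      exact: (measurableT_comp mp1 (@measurable_snd _ _ (measurableTypeR R) (measurableTypeR R))).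
    exact: (measurableT_comp mp2 (@measurable_snd _ _ (measurableTypeR R) (measurableTypeR R))).
  have ml : measurable_fun (setT : set (measurableTypeR R)) (lkernel c3).
    by apply: continuous_measurable_fun; exact: lkernel_cont.
  split; last exact: measurable_cst.
  apply: (measurableT_comp ml); apply: measurable_funB.
    exact: measurable_fst.
  exact: measurable_snd.
have hB x y : - h <= x <= h -> - h <= y <= h -> cnorm (H (x, y)) <= E * (L * W).
  move=> xh yh; rewrite /H /= cnormM; apply: ler_pM; rewrite ?cnorm_ge0 ?HE//.
  rewrite cnormM; apply: ler_pM; rewrite ?cnorm_ge0 ?HW ?HL//.
  by move: xh yh => /andP[? ?] /andP[? ?]; lra.
have := cint_swap mH hB => sw.
transitivity (cint (- h) h (fun x => cint (- h) h (fun y => H (x, y)))).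
  apply: eq_cintegral => x _; rewrite [LHS]mulrC.
  have ci : cintegrable leb `[- h, h] (fun y => (lkernel c3 (x - y))%:C * phi y) by exact: conv_integrable.
  by rewrite /cint -(cintegralZ _ _ ci).
rewrite sw; apply: eq_cintegral => y _.
have ci : cintegrable leb `[- h, h] (fun x => (lkernel c3 (y - x))%:C * cexp (eta * x%:C)).
  apply: rcont_integrable => x _; apply: rcontM; first exact: lkernel_sub_rcont.
  exact: rcont_cexpM.
have mI : measurable (`[- h, h] : set (measurableTypeR R)) by exact: measurable_itv.
rewrite /cint -(cintegralZ mI (phi y) ci).
apply: eq_cintegral => x _; rewrite /H /= -(lkernelN c3 (y - x)) opprB.
by rewrite mulrC mulrAC mulrC.
Qed.

(** Obtained by integrating [Top phi x = 1] against exp (eta x). The full-line multiplier appears on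
    the left, the contributions beyond the two endpoints on the right. *)
Lemma transform_equation (eta : C) : eta != 0 -> c3%:C + eta != 0 -> c3%:C - eta != 0 ->
  G eta * (c1%:C + c2%:C * ((c3%:C + eta) ^- 2 + (c3%:C - eta) ^- 2)) =
  (cexp (eta * h%:C) - cexp (- (eta * h%:C))) / eta + c2%:C * (edge eta + edge (- eta)).
Proof.
move=> e0 s0 t0.
have ci (f : R -> C) : (forall y, rcont f y) -> cintegrable leb `[- h, h] f.
  by move=> cf; apply: rcont_integrable.
set P := _ ^- 2 + _ ^- 2.
have E1 : c2%:C * cint (- h) h (fun x =>
      cint (- h) h (fun y => (lkernel c3 (x - y))%:C * phi y) * cexp (eta * x%:C)) =
    expint h (fun=> 1) eta - c1%:C * G eta.
  have cE x : rcont (fun x => 1 * cexp (eta * x%:C)) x by apply: expint_rcont => y; exact: rcont_cst.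
  have cG x : rcont (fun x => phi x * cexp (eta * x%:C)) x by exact: expint_rcont.
  rewrite -[c1%:C * _]cintegralZ//; last exact: ci.
  rewrite -cintegralB//; [|exact: ci|by apply: cintegrableZ => //; exact: ci].
  have c2C : c2%:C != 0 :> C by rewrite real_complex_eq0 gt_eqF.
  have {}cE x : rcont (fun x => c2%:C^-1 * (1 * cexp (eta * x%:C) - c1%:C * (phi x * cexp (eta * x%:C)))) x.
    apply: rcontM; first exact: rcont_cst.
    by apply: rcontB => //; apply: rcontM => //; exact: rcont_cst.
  (* On [[- h, h]] the equation expresses the convolution through [phi], hence by a continuous
     function; this gives its integrability. *)
  pose g (x : R) : C := c2%:C^-1 * (1 * cexp (eta * x%:C) - c1%:C * (phi x * cexp (eta * x%:C))).
  transitivity (c2%:C * cint (- h) h g).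
    congr (_ * _); apply: eq_cintegral => x /= xh; rewrite in_itv /= in xh.
    rewrite /g -[X in X * cexp _ - _](phiT xh) /Top.
    by set I := cint _ _ _; set X := cexp _; field.
  have mI : measurable (`[- h, h] : set (measurableTypeR R)) by exact: measurable_itv.
  rewrite /cint -(cintegralZ mI c2%:C (ci g cE)).
  by apply: eq_cintegral => x _; rewrite /g mulVKf.
have E2 : cint (- h) h (fun y => phi y * cint (- h) h (fun x => (lkernel c3 (y - x))%:C * cexp (eta * x%:C))) =
    P * G eta - (edge eta + edge (- eta)).
  have cb x e : rcont (fun y => phi y * edge_int e y) x by apply: rcontM => //; exact: edge_int_rcont.
  have -> : edge (- eta) = cint (- h) h (fun y => phi y * edge_int (- eta) (- y)).
    rewrite -cint_edge (cint_oppr h_ge0); last by move=> x _; exact: cb.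
    by apply: eq_cintegral => y _; rewrite phiN.
  have cb' x : rcont (fun y => phi y * edge_int (- eta) (- y)) x.
    apply: rcontM => //.
    apply: rcontM; first exact: rcont_cst.
    have ce z : rcont (fun y => cexp (c3%:C * (- y)%:C)) z.
      have -> : (fun y => cexp (c3%:C * (- y)%:C)) = fun y : R => cexp (- c3%:C * y%:C).
        by apply/funext => y; rewrite rmorphN mulrN mulNr.
      exact: rcont_cexpM.
    apply: rcontD; last by apply: rcontM; [exact: rcont_cst|exact: ce].
    apply: rcontM; first exact: rcont_cst.
    apply: rcontM; last exact: ce.
    apply: rcont_real; apply: cvgB; first exact: cvg_cst.
    by apply: cvgN; exact: cvg_id.
  rewrite -cint_edge -cintegralD//; try by apply: ci.
  rewrite -[P * _]cintegralZ//; last by apply: ci => x; exact: expint_rcont.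
  rewrite -cintegralB//; first last.
  - by apply: cintegrableD => //; exact: ci.
  - by apply: cintegrableZ => //; apply: ci => x; exact: expint_rcont.
  apply: eq_cintegral => y /= yh; rewrite in_itv /= in yh.
  by rewrite conv_edge// -/P; ring.
move: E1; rewrite conv_swap E2 expint1// => E1.
have -> : G eta * (c1%:C + c2%:C * P) = c1%:C * G eta + c2%:C * (P * G eta) by ring.
move: E1; move: (_ / eta) (G eta) (P * _) (edge eta) (edge _) => a b c d e E1.
by rewrite -[a](subrK (c1%:C * b)) -E1; ring.
Qed.

Definition nuh (eta : C) : C := c1%:C +
  c2%:C * cint (- Delta) Delta (fun a => (lkernel c3 a)%:C * cexp (eta * a%:C)).

(* [G eta * nuh eta] is the transform of 1 on [[- h, h]] plus
   [tail eta + tail (- eta)], and [tail] is analytic and small on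
   [Re eta <= 0]; see [nuh_expint] and [tail_bound]. *)
Definition tail (eta : C) : C := c2%:C * (edge eta -
  (Delta%:C / (c3%:C - eta) + (c3%:C - eta) ^- 2) * cexp ((eta - c3%:C) * Delta%:C) * G eta).

Lemma nuhE (eta : C) : c3%:C + eta != 0 -> c3%:C - eta != 0 ->
  nuh eta = c1%:C + c2%:C * ((c3%:C + eta) ^- 2 + (c3%:C - eta) ^- 2 -
    (Delta%:C / (c3%:C + eta) + (c3%:C + eta) ^- 2) * cexp ((- eta - c3%:C) * Delta%:C) -
    (Delta%:C / (c3%:C - eta) + (c3%:C - eta) ^- 2) * cexp ((eta - c3%:C) * Delta%:C)).
Proof.
move=> s0 t0; rewrite /nuh; congr (_ + _ * _).
transitivity (cint (- Delta) Delta (fun y => (lkernel c3 (0 - y))%:C * cexp (eta * y%:C))).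
  by apply: eq_cintegral => y _; rewrite sub0r lkernelN.
rewrite lkernel_conv_cexp//; last by rewrite oppr_le0 !ltW.
rewrite mulr0 cexp0 mul1r add0r subr0 -!cexpD.
have -> : - (c3 * Delta)%:C + - eta * Delta%:C = (- eta - c3%:C) * Delta%:C by ring.
by have -> : - (c3 * Delta)%:C + eta * Delta%:C = (eta - c3%:C) * Delta%:C by ring.
Qed.

(** [nuh] differs from the full-line multiplier by the boundary terms at [Delta] and [- Delta]; each
    joins the edge term with the same sign of [eta] to form a [tail]. *)
Lemma nuh_expint (eta : C) : eta != 0 -> c3%:C + eta != 0 -> c3%:C - eta != 0 ->
  G eta * nuh eta =
  (cexp (eta * h%:C) - cexp (- (eta * h%:C))) / eta + (tail eta + tail (- eta)).
Proof.
move=> e0 s0 t0; have E := transform_equation e0 s0 t0.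
rewrite (nuhE s0 t0) /tail expint_even opprK.
set X := cexp ((- eta - _) * _); set Y := cexp ((eta - _) * Delta%:C).
set u := Delta%:C / (c3%:C + eta) + _; set v := Delta%:C / (c3%:C - eta) + _.
move: E; set P := _ ^- 2 + _ ^- 2; set S := _ / eta.
move: (G eta) (edge eta) (edge _) => g a b E.
have -> : g * (c1%:C + c2%:C * (P - u * X - v * Y)) =
  g * (c1%:C + c2%:C * P) - c2%:C * ((u * X + v * Y) * g) by ring.
by rewrite E; ring.
Qed.

Lemma cnorm_shift (eta : C) : Re eta <= 0 -> c3 <= cnorm (c3%:C - eta).
Proof.
move=> e0; have E : Re (c3%:C - eta) = c3 - Re eta by rewrite ReB.
by apply: le_trans (normRe_le _); rewrite E ger0_norm; move: hc3 e0; lra.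
Qed.

Lemma shift_neq0 (eta : C) : Re eta <= 0 -> c3%:C - eta != 0.
Proof. by move=> /cnorm_shift e; rewrite -cnorm_gt0 (lt_le_trans hc3). Qed.

(** The cut-off of the density at Delta = 2 h contributes exp (Delta Re eta), and the transform of
    [phi] grows at most like exp (- h Re eta). Their product decays like exp (h Re eta), the same
    rate as the edge term. *)
Lemma tail_bound : exists2 K, 0 <= K & forall eta, Re eta <= 0 ->
  cnorm (tail eta) <= K * expR (h * Re eta) / cnorm (c3%:C - eta).
Proof.
have [W W0 HW'] := expint_bound h_ge0 phic.
have HW eta : Re eta <= 0 -> cnorm (G eta) <= W * expR (- (h * Re eta)).
  by move=> e0; rewrite (le_trans (HW' eta))// ler0_norm// mulrN.
have [c20 D0 ci0] : [/\ 0 <= c2, 0 <= Delta & 0 <= c3^-1].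
  by split; rewrite ?invr_ge0; exact: ltW.
exists (c2 * (cnorm mom1 + cnorm mom0 / c3 + (Delta + c3^-1) * W)).
  by rewrite !(mulr_ge0, addr_ge0, cnorm_ge0).
move=> eta e0; have s3 := cnorm_shift e0; set s := cnorm _ in s3 *.
have s0 : 0 < s by rewrite (lt_le_trans hc3).
have si : s^-1 <= c3^-1 by rewrite lef_pV2.
have ss : s ^- 2 <= c3^-1 / s.
  by rewrite expr2 invfM ler_wpM2r// invr_ge0 ltW.
have Ee : 0 < expR (h * Re eta) by exact: expR_gt0.
have b1 : cnorm (edge eta) <= expR (h * Re eta) * ((cnorm mom1 + cnorm mom0 / c3) / s).
  rewrite /edge cnormM; apply: ler_pM; rewrite ?cnorm_ge0//.
    rewrite cnorm_cexp ler_expR ReM ReB /= mulr0 subr0 mulrC ler_wpM2l//.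
    by rewrite gerBl ltW.
  apply: le_trans (cnormD _ _) _; rewrite mulrDl; apply: lerD.
    by rewrite cnormM cnormV.
  rewrite cnormM cnormV cnormX -/s -mulrA ler_wpM2l ?cnorm_ge0//.
have b2 : cnorm ((Delta%:C / (c3%:C - eta) + (c3%:C - eta) ^- 2) *
    cexp ((eta - c3%:C) * Delta%:C) * G eta) <=
    expR (h * Re eta) * ((Delta + c3^-1) * W / s).
  rewrite cnormM [cnorm (_ * cexp _)]cnormM.
  have t1 : cnorm (Delta%:C / (c3%:C - eta) + (c3%:C - eta) ^- 2) <= (Delta + c3^-1) / s.
    apply: le_trans (cnormD _ _) _; rewrite mulrDl; apply: lerD.
      by rewrite cnormM cnormV cnormR gtr0_norm.
    by rewrite cnormV cnormX.
  have t2 : cnorm (cexp ((eta - c3%:C) * Delta%:C)) <= expR (Delta * Re eta).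
    rewrite cnorm_cexp ler_expR ReM ReB /= mulr0 subr0 mulrC ler_wpM2l//.
    by rewrite gerBl ltW.
  have -> : expR (h * Re eta) * ((Delta + c3^-1) * W / s) =
      (Delta + c3^-1) / s * expR (Delta * Re eta) * (W * expR (- (h * Re eta))).
    rewrite -[in expR (h * _)](_ : Delta * Re eta + - (h * Re eta) = h * Re eta); last by field.
    by rewrite expRD; ring.
  apply: ler_pM; rewrite ?mulr_ge0 ?cnorm_ge0 ?HW//.
  by apply: ler_pM; rewrite ?cnorm_ge0.
rewrite /tail cnormM cnormR gtr0_norm// -!(mulrA c2) ler_pM2l//.
apply: le_trans (cnormB _ _) _; apply: le_trans (lerD b1 b2) _.
by rewrite -mulrDr -mulrDl mulrA [X in X / s]mulrC.
Qed.

(** The substitution eta = - 2 pi i z turns [expint] into the Fourier transform and the lower half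
    plane into Re eta <= 0. *)
Definition freq (z : C) : C := - ((2 * pi)%:C * 'i) * z.

Lemma Re_freq z : Re (freq z) = 2 * pi * Im z.
Proof. by rewrite /freq !ReImE /=; ring. Qed.

(** Equals z times the half of the transform attached to the lower half plane, written without
    division since z / freq z is the constant i / (2 pi); the factor z removes the pole of the split
    sine. *)
Definition ell (z : C) : C := z * tail (freq z) + 'i / (2 * pi)%:C * cexp (freq z * h%:C).

Let pi2 : 0 < 2 * pi :> R. Proof. by rewrite mulr_gt0// pi_gt0. Qed.
Let pi2C : (2 * pi)%:C != 0 :> C. Proof. by rewrite real_complex_eq0 gt_eqF. Qed.

Lemma cnorm_freq z : cnorm (freq z) = 2 * pi * cnorm z.
Proof. by rewrite /freq cnormM cnormN cnormM cnorm_i mulr1 cnormR gtr0_norm. Qed.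

Lemma ell0 : ell 0 = 'i / (2 * pi)%:C.
Proof. by rewrite /ell mul0r add0r /freq mulr0 mul0r cexp0 mulr1. Qed.

Lemma ellE z : z != 0 -> ell z = z * (tail (freq z) + cexp (freq z * h%:C) / freq z).
Proof.
move=> z0; rewrite /ell [RHS]mulrDr; congr (_ + _); rewrite /freq.
have i0 : ('i : C) != 0 by rewrite -cnorm_gt0 cnorm_i ltr01.
have ii := mulii R; set X := cexp _.
have -> : 'i / (2 * pi)%:C = z / (- ((2 * pi)%:C * 'i) * z) :> C.
  have w0 : (2 * pi)%:C * 'i != 0 :> C by rewrite mulf_neq0.
  apply: (mulIf w0); rewrite [LHS]mulrA divfK// ii; move: (_ * 'i) w0 => w w0.
  by field; rewrite w0 z0.
by rewrite mulrA mulrAC.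
Qed.

Lemma ell_cder z : Im z <= 0 -> exists d, cder ell z d.
Proof.
move=> z0; have r0 : Re (freq z) <= 0 by rewrite Re_freq pmulr_rle0.
have s0 := shift_neq0 r0.
have df : cder freq z (- ((2 * pi)%:C * 'i)) by exact: cder_linear.
have dexp (a : R) (b : C) : exists d, cder (fun e => cexp ((e - b) * a%:C)) (freq z) d.
  eexists; apply: (cder_comp (f := @cexp R)); first exact: cder_cexp.
  by apply: cderM; [apply: cderB; [exact: cder_id|exact: cder_cst]|exact: cder_cst].
have dinv : exists d, cder (fun e => (c3%:C - e)^-1) (freq z) d.
  eexists; apply: cderV => //.
  by apply: cderB; [exact: cder_cst|exact: cder_id].
have [di Hi] := dinv.
have dinv2 : exists d, cder (fun e => (c3%:C - e) ^- 2) (freq z) d.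
  exists (di * (c3%:C - freq z)^-1 + (c3%:C - freq z)^-1 * di).
  have -> : (fun e => (c3%:C - e) ^- 2) = fun e => (c3%:C - e)^-1 * (c3%:C - e)^-1.
    by apply/funext => e; rewrite expr2 invfM.
  exact: cderM.
have [dj Hj] := dinv2.
have [dx Hx] := dexp h c3%:C; have [dy Hy] := dexp Delta c3%:C; have [dw Hw] := dexp h 0.
have dt : exists d, cder tail (freq z) d.
  eexists; apply: cderM; first exact: cder_cst.
  apply: cderB.
    apply: cderM; first exact: Hx.
    apply: cderD; apply: cderM; [exact: cder_cst|exact: Hi|exact: cder_cst|exact: Hj].
  apply: cderM; last exact: expint_cder.
  apply: cderM; last exact: Hy.
  apply: cderD; last exact: Hj.
  by apply: cderM; [exact: cder_cst|exact: Hi].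
have [dtl Ht] := dt.
have Hw' : cder (fun e => cexp (e * h%:C)) (freq z) dw.
  by move: Hw; under eq_fun do rewrite subr0.
eexists; apply: cderD.
  apply: cderM; first exact: cder_id.
  exact: (cder_comp Ht df).
apply: cderM; first exact: cder_cst.
exact: (cder_comp (f := fun e => cexp (e * h%:C)) Hw' df).
Qed.

(** The factor z is absorbed by the denominator in [tail_bound]: 2 pi |z| is at most c3 + |c3 - freq
    z|, hence at most twice |c3 - freq z|. *)
Lemma ell_bound : exists L, forall z, Im z <= 0 -> cnorm (ell z) <= L * expR (pi * Delta * Im z).
Proof.
have [K Kp HK] := tail_bound.
exists (K / pi + (2 * pi)^-1) => z z0.
have r0 : Re (freq z) <= 0 by rewrite Re_freq pmulr_rle0.
have s3 := cnorm_shift r0; have := HK _ r0; set s := cnorm (c3%:C - _) in s3 *.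
have s0 : 0 < s by rewrite (lt_le_trans hc3).
have zs : cnorm z <= s / pi.
  rewrite ler_pdivlMr ?pi_gt0// mulrC -(ler_pM2l (ltr0n _ 2)) mulrA -cnorm_freq.
  have -> : freq z = c3%:C - (c3%:C - freq z) by ring.
  apply: le_trans (cnormB _ _) _; rewrite cnormR gtr0_norm// -/s; lra.
have -> : h * Re (freq z) = pi * Delta * Im z by rewrite Re_freq; field.
set E := expR _ => Ht; have E0 : 0 < E by exact: expR_gt0.
apply: le_trans (cnormD _ _) _; rewrite [leRHS]mulrDl; apply: lerD.
  rewrite cnormM; apply: (@le_trans _ _ (s / pi * (K * E / s))).
    by apply: ler_pM; rewrite ?cnorm_ge0.
  rewrite le_eqVlt; apply/orP; left; apply/eqP.
  have := gt_eqF (pi_gt0 R); move: (pi : R) => p p0; field.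
  by rewrite p0 (gt_eqF s0).
have cc : cnorm ('i / (2 * pi)%:C : C) = (2 * pi)^-1.
  by rewrite cnormM cnorm_i mul1r cnormV cnormR gtr0_norm.
rewrite cnormM cc cnorm_cexp le_eqVlt; apply/orP; left; apply/eqP.
congr (_ * expR _).
by rewrite ReM Re_freq /= mulr0 subr0; field.
Qed.

Lemma freqN z : freq (- z) = - freq z.
Proof. by rewrite /freq mulrN. Qed.

Lemma Re_freq_real (x : R) : Re (freq x%:C) = 0.
Proof. by rewrite Re_freq /= mulr0. Qed.

Lemma shift_le (x : R) : 2 * pi * `|x| <= cnorm (c3%:C - freq x%:C).
Proof.
apply: le_trans (normIm_le _); rewrite ImB sub0r normrN.
have -> : Im (freq x%:C) = - (2 * pi * x) by rewrite /freq !ReImE /=; ring.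
by rewrite normrN normrM gtr0_norm.
Qed.

Lemma nuh_bounded : exists2 N, 0 <= N & forall x : R, cnorm (nuh (freq x%:C)) <= N.
Proof.
have [W W0 HW] := expint_bound (ltW hDelta) (lkernel_rcont c3).
exists (c1 + c2 * W); first by rewrite addr_ge0 ?mulr_ge0// ltW.
move=> x; apply: le_trans (cnormD _ _) _; rewrite cnormR gtr0_norm// lerD2l.
rewrite cnormM cnormR gtr0_norm// ler_pM2l//.
by have := HW (freq x%:C); rewrite Re_freq_real normr0 mulr0 expR0 mulr1.
Qed.

Lemma nuh_freq_rcont (x : R) : rcont (fun x => nuh (freq x%:C)) x.
Proof.
apply: (rcont_comp (f := nuh)); last by apply: rcontM; [exact: rcont_cst|exact: rcont_id].
have [] : ccont nuh (freq x%:C); last by [].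
apply: ccontD; first exact: ccont_cst.
apply: ccontM; first exact: ccont_cst.
by apply: cder_cont (expint_cder _ _ _) => //; [exact: ltW|exact: lkernel_rcont].
Qed.

Lemma transform_freq_rcont (x : R) : rcont (fun x => G (freq x%:C)) x.
Proof.
apply: (rcont_comp (f := G)); last by apply: rcontM; [exact: rcont_cst|exact: rcont_id].
by apply: cder_cont (expint_cder _ _ _).
Qed.

Lemma freq_neq0 (x : R) : x != 0 -> freq x%:C != 0.
Proof. by move=> x0; rewrite -cnorm_gt0 cnorm_freq cnormR mulr_gt0// normr_gt0. Qed.

Lemma freq_shift (x : R) : c3%:C + freq x%:C != 0 /\ c3%:C - freq x%:C != 0.
Proof.
split; last by rewrite shift_neq0// Re_freq_real.
by rewrite -[freq _]opprK -freqN -rmorphN shift_neq0// Re_freq_real.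
Qed.

Lemma nuh_decay : exists2 N, 0 <= N & forall x : R, x != 0 ->
  cnorm (nuh (freq x%:C) - c1%:C) <= N / `|x|.
Proof.
have D0 := ltW hDelta; have ci0 : 0 <= c3^-1 by rewrite invr_ge0 ltW.
exists (c2 * (2 * (2 * c3^-1 + Delta) / (2 * pi))).
  by rewrite !(mulr_ge0, addr_ge0)// ?invr_ge0 ltW.
move=> x x0; have [s0 t0] := freq_shift x; rewrite (nuhE s0 t0).
set u := Delta%:C / (c3%:C + _) + _; set v := Delta%:C / (c3%:C - _) + _.
set X := cexp _; set Y := cexp _.
have ax : 0 < `|x| by rewrite normr_gt0.
have sb (y : R) : `|y| = `|x| -> cnorm (c3%:C - freq y%:C)^-1 <= (2 * pi * `|x|)^-1 /\
    cnorm ((c3%:C - freq y%:C) ^- 2) <= c3^-1 * (2 * pi * `|x|)^-1.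
  move=> yx; have a1 := shift_le y; rewrite yx in a1.
  have a2 : c3 <= cnorm (c3%:C - freq y%:C) by apply: cnorm_shift; rewrite Re_freq_real.
  have p0 : 0 < 2 * pi * `|x| by rewrite mulr_gt0.
  have b1 : (cnorm (c3%:C - freq y%:C))^-1 <= (2 * pi * `|x|)^-1.
    by rewrite lef_pV2// posrE (lt_le_trans p0).
  have b2 : (cnorm (c3%:C - freq y%:C))^-1 <= c3^-1.
    by rewrite lef_pV2// posrE (lt_le_trans hc3).
  by split; rewrite cnormV// cnormX expr2 invfM; apply: ler_pM; rewrite ?invr_ge0 ?cnorm_ge0.
have [p1 p2] := sb x erefl; have [q1 q2] := sb (- x) (normrN x).
rewrite rmorphN freqN opprK in q1 q2.
have X1 : cnorm X <= 1.
  rewrite cnorm_cexp -expR0 ler_expR ReM ReB ReN Re_freq_real /= mulr0 subr0 oppr0 sub0r.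
  by rewrite mulNr oppr_le0 mulr_ge0// ltW.
have Y1 : cnorm Y <= 1.
  rewrite cnorm_cexp -expR0 ler_expR ReM ReB Re_freq_real /= mulr0 subr0 sub0r.
  by rewrite mulNr oppr_le0 mulr_ge0// ltW.
have u1 : cnorm (u * X) <= (Delta + c3^-1) * (2 * pi * `|x|)^-1.
  rewrite cnormM -[leRHS]mulr1; apply: ler_pM; rewrite ?cnorm_ge0//.
  apply: le_trans (cnormD _ _) _; rewrite mulrDl; apply: lerD => //.
  by rewrite cnormM cnormR ger0_norm// ler_wpM2l.
have v1 : cnorm (v * Y) <= (Delta + c3^-1) * (2 * pi * `|x|)^-1.
  rewrite cnormM -[leRHS]mulr1; apply: ler_pM; rewrite ?cnorm_ge0//.
  apply: le_trans (cnormD _ _) _; rewrite mulrDl; apply: lerD => //.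
  by rewrite cnormM cnormR ger0_norm// ler_wpM2l.
rewrite addrC addKr cnormM cnormR gtr0_norm//.
have -> : c2 * (2 * (2 * c3^-1 + Delta) / (2 * pi)) / `|x| =
    c2 * (2 * ((2 * c3^-1 + Delta) * (2 * pi * `|x|)^-1)).
  by rewrite (invfM (2 * pi)) !mulrA.
rewrite ler_pM2l//.
apply: le_trans (cnormB _ _) _; apply: le_trans (lerD (cnormB _ _) (lexx _)) _.
apply: le_trans (lerD (lerD (cnormD _ _) (lexx _)) (lexx _)) _.
move: p2 q2 u1 v1; set w := (_ * `|x|)^-1.
move: (cnorm (u * X)) (cnorm (v * Y)) (cnorm (_ ^- 2)) (cnorm (_ ^- 2)) => ? ? ? ?.
by lra.
Qed.

(** The kernel is even, so the sine part of the transform has an odd integrand. *)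
Lemma nuh_real (x : R) : nuh (freq x%:C) = (Re (nuh (freq x%:C)))%:C.
Proof.
suff I0 : Im (nuh (freq x%:C)) = 0 by apply: complexP.
pose g a := (lkernel c3 a)%:C * cexp (freq x%:C * a%:C).
have -> : Im (nuh (freq x%:C)) = c2 * (\int[leb]_(a in `[- Delta, Delta]) Im (g a))%R.
  by rewrite /nuh ImD ImM [Im c1%:C]/= [Im c2%:C]/= mul0r addr0 add0r.
set I := (\int[_]_(_ in _) _)%R.
suff : I = - I by move=> E; have -> : I = 0; [lra|rewrite mulr0].
rewrite [LHS]Rintegral_oppr ?ltW//; last first.
  move=> a _; have [] := rcontM (lkernel_rcont c3 a) (rcont_cexpM (freq x%:C) a).
  by [].
have iI : leb.-integrable `[- Delta, Delta] (EFin \o (fun a => Im (g a))).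
  apply: cont_integrable => a _.
  by have [] := rcontM (lkernel_rcont c3 a) (rcont_cexpM (freq x%:C) a).
have mI : measurable (`[- Delta, Delta] : set (measurableTypeR R)) by exact: measurable_itv.
rewrite -[RHS]mulN1r /I -(RintegralZl (-1) mI iI).
apply: eq_Rintegral => a _.
have gE y : Im (g y) = lkernel c3 y * sin (- (2 * pi * x * y)).
  have Icexp (w : C) : Im (cexp w) = expR (Re w) * sin (Im w).
    by rewrite /cexp ImM [Im _%:C]/= mul0r addr0.
  rewrite /g ImM [Im (lkernel _ _)%:C]/= mul0r addr0 Icexp.
  have -> : Re (freq x%:C * y%:C) = 0 by rewrite ReM Re_freq_real /= mul0r mulr0 subr0.
  have -> : Im (freq x%:C * y%:C) = - (2 * pi * x * y) by rewrite /freq !ReImE /=; ring.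
  by rewrite expR0 mul1r.
by rewrite !gE lkernelN !mulrN !sinN mulN1r opprK mulrN opprK.
Qed.

(** Far out only the point mass survives. This makes [nuh] invertible at infinity; on a compact
    interval continuity does the rest. *)
Lemma nuh_lower : exists2 X, 0 < X & forall x : R, X <= `|x| -> c1 / 2 <= Re (nuh (freq x%:C)).
Proof.
have [N N0 HN] := nuh_decay.
have X0 : 0 < 2 * N / c1 + 1 by rewrite ltr_wpDl// divr_ge0 ?mulr_ge0// ltW.
exists (2 * N / c1 + 1) => // x Xx.
have ax : 0 < `|x| by rewrite (lt_le_trans X0).
have x0 : x != 0 by rewrite -normr_gt0.
have b : N / `|x| <= c1 / 2.
  rewrite ler_pdivrMr// -ler_pdivrMl ?divr_gt0//; apply: le_trans Xx.
  by have -> : (c1 / 2)^-1 * N = 2 * N / c1; [field; rewrite gt_eqF|rewrite lerDl].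
have := le_trans (normRe_le _) (le_trans (HN x x0) b).
by rewrite ReB /= ler_norml => /andP[+ _]; lra.
Qed.

(** For large |x| divide [nuh_expint] by [nuh]: the right-hand side is of order 1 / |x|. The
    transform is thereby square integrable. *)
Lemma transform_decay : exists2 N, 0 <= N & forall x : R,
  cnorm (G (freq x%:C)) ^+ 2 <= N * cauchy_weight x.
Proof.
have [X X0 HX] := nuh_lower; have [K Kp HK] := tail_bound.
have [W W0 HW] := expint_bound h_ge0 phic.
(* The maximum with 1 serves [le_cauchy_weight]. In [M], the 2 bounds the sine part, [2 * K] the two
   tails, and [2 / c1] comes from [nuh_lower]. *)
pose Y := Num.max X 1; pose M := (2 + 2 * K) / (2 * pi) * (2 / c1).
have M0 : 0 <= M by rewrite /M !(mulr_ge0, addr_ge0)// ?invr_ge0 ltW.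
exists (W ^+ 2 * (1 + Y ^+ 2) + M ^+ 2 * 2).
  by apply: addr_ge0; apply: mulr_ge0; rewrite ?addr_ge0 ?sqr_ge0.
move=> x; have cw := cauchy_weight_gt0 x.
have [xY|xY] := leP `|x| Y.
  apply: (@le_trans _ _ (W ^+ 2 * (1 + Y ^+ 2) * cauchy_weight x)).
    have GW : cnorm (G (freq x%:C)) <= W.
      by have := HW (freq x%:C); rewrite Re_freq_real normr0 mulr0 expR0 mulr1.
    apply: (@le_trans _ _ (W ^+ 2)); first by rewrite ler_pXn2r ?nnegrE ?cnorm_ge0.
    rewrite -mulrA ler_peMr ?sqr_ge0// /cauchy_weight ler_pdivlMr ?mul1r ?ltr_pwDl ?sqr_ge0//.
    by rewrite lerD2l -(real_normK (num_real x)) ler_pXn2r ?nnegrE// le_max ltW.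
  by rewrite ler_wpM2r ?(ltW cw)// lerDl mulr_ge0 ?sqr_ge0.
have Xx : X <= `|x| by rewrite (le_trans _ (ltW xY))// le_max lexx.
have x1 : 1 <= `|x| by rewrite (le_trans _ (ltW xY))// le_max lexx orbT.
have ax : 0 < `|x| by rewrite (lt_le_trans X0).
have x0 : x != 0 by rewrite -normr_gt0.
have [s0 t0] := freq_shift x.
have E := nuh_expint (freq_neq0 x0) s0 t0.
pose p := 2 * pi * `|x|; have p0 : 0 < p by rewrite mulr_gt0.
have tb (y : R) : `|y| = `|x| -> cnorm (tail (freq y%:C)) <= K / p.
  move=> yx; have := HK (freq y%:C); rewrite Re_freq_real mulr0 expR0 mulr1.
  move=> /(_ (lexx _)) h1; apply: le_trans h1 _; rewrite ler_wpM2l//.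
  have := shift_le y; rewrite yx -/p => h2.
  by rewrite lef_pV2// posrE (lt_le_trans p0).
have t1 := tb x erefl; have t2 := tb (- x) (normrN x).
rewrite rmorphN freqN in t2.
have e1 : cnorm ((cexp (freq x%:C * h%:C) - cexp (- (freq x%:C * h%:C))) / freq x%:C) <= 2 / p.
  rewrite cnormM cnormV cnorm_freq cnormR -/p ler_wpM2r ?invr_ge0 ?(ltW p0)//.
  apply: le_trans (cnormB _ _) _; rewrite !cnorm_cexp ReN ReM Re_freq_real /= mul0r mulr0 subr0 oppr0.
  by rewrite expR0; lra.
have GM : cnorm (G (freq x%:C)) <= M / `|x|.
  have : cnorm (G (freq x%:C)) * (c1 / 2) <= (2 + 2 * K) / p.
    apply: (@le_trans _ _ (cnorm (G (freq x%:C) * nuh (freq x%:C)))).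
      rewrite cnormM ler_wpM2l ?cnorm_ge0// (le_trans (HX x Xx))//.
      by rewrite (le_trans _ (normRe_le _))// ler_norm.
    rewrite E; apply: le_trans (cnormD _ _) _.
    apply: le_trans (lerD e1 (cnormD _ _)) _; apply: le_trans (lerD (lexx _) (lerD t1 t2)) _.
    by rewrite le_eqVlt; apply/orP; left; apply/eqP; ring.
  rewrite -ler_pdivlMr ?divr_gt0// => h1; apply: le_trans h1 _.
  rewrite le_eqVlt; apply/orP; left; apply/eqP.
  have c2i : (c1 / 2)^-1 = 2 / c1 by rewrite invf_div.
  rewrite /M /p c2i (invfM (2 * pi) `|x|).
  by move: (2 * pi)^-1 (`|x|^-1) (2 / c1) => u v w; ring.
apply: (@le_trans _ _ (M ^+ 2 * 2 * cauchy_weight x)).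
  apply: (@le_trans _ _ ((M / `|x|) ^+ 2)).
    by rewrite ler_pXn2r ?nnegrE ?cnorm_ge0// divr_ge0.
  rewrite exprMn exprVn real_normK ?num_real// -mulrA ler_wpM2l ?sqr_ge0//.
  exact: le_cauchy_weight.
by rewrite ler_wpM2r ?(ltW cw)// lerDr mulr_ge0 ?sqr_ge0 ?addr_ge0 ?sqr_ge0.
Qed.

(** Carries an identity obtained after division by x over to x = 0. *)
Lemma rcont_eq0 (f g : R -> C) : rcont f 0 -> rcont g 0 ->
  (forall x, x != 0 -> f x = g x) -> f 0 = g 0.
Proof.
move=> [f1 f2] [g1 g2] E.
have key (u v : R -> R) : u x @[x --> (0 : R)] --> u 0 -> v x @[x --> (0 : R)] --> v 0 ->
    (forall x, x != 0 -> u x = v x) -> u 0 = v 0.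
  move=> cu cv uv; have i0 := @inv_succ_cvg R.
  have lu : u (n.+1%:R^-1) @[n --> \oo] --> u 0 by apply: (cvg_comp _ _ i0 cu).
  have lv : v (n.+1%:R^-1) @[n --> \oo] --> v 0 by apply: (cvg_comp _ _ i0 cv).
  have luv : u (n.+1%:R^-1) @[n --> \oo] --> v 0.
    by under eq_fun do rewrite uv ?invr_eq0 ?pnatr_eq0//.
  by rewrite -(cvg_lim (@Rhausdorff R) lu) -(cvg_lim (@Rhausdorff R) luv).
apply: complexP.
  by apply: (key (fun x => Re (f x)) (fun x => Re (g x))) => // x /E ->.
by apply: (key (fun x => Im (f x)) (fun x => Im (g x))) => // x /E ->.
Qed.

Lemma cauchy_weight_cintegrable (c : C) :
  cintegrable leb setT (fun x => c * (cauchy_weight x)%:C).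
Proof.
apply: cintegrableZ => //; split; first exact: cauchy_weight_integrable.
exact: integrable0.
Qed.

Lemma cintegral_cauchy_weight (c : C) :
  cintegral leb setT (fun x => c * (cauchy_weight x)%:C) = c * pi%:C.
Proof.
rewrite cintegralZ//; last first.
  by have := cauchy_weight_cintegrable 1; under eq_fun do rewrite mul1r.
congr (_ * _); apply: complexP; rewrite cintegralE /=.
  by rewrite /Rintegral integral_cauchy_weight.
by rewrite /Rintegral integral0.
Qed.

(** The algebra of the splitting, with [fx] for the frequency, [X] and [X'] for the exponentials of
    the sine, and [j] for ['i]. The two subtracted poles combine into v / p times the Cauchy
    weight. *)
Lemma residue_identity (fx ta tb X X' u v y p j : C) :
  fx != 0 -> p != 0 -> y - j != 0 -> - y - j != 0 ->
  y * (u * ((X - X') / fx + (ta + tb)) - v / p * - ((y - j) * (- y - j))^-1) =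
  (u * (y * (ta + X / fx)) - v / (2 * p) / (y - j))
  - (u * (- y * (tb + X' / - fx)) - v / (2 * p) / (- y - j)).
Proof. by move=> *; field; do ?[apply/andP; split]. Qed.

Theorem transform_reproducing (f : C -> C) :
  (forall z, exists d, cder f z d) ->
  (forall e : R, 0 < e -> exists A, forall z, cnorm (f z) <= A * expR ((pi * Delta + e) * cnorm z)) ->
  leb.-integrable setT (fun x => (cnorm (f x%:C) ^+ 2)%:E) ->
  cintegral leb setT (fun x => f x%:C * G (freq x%:C) * nuh (freq x%:C)) = f 0.
Proof.
move=> fD fB fL2.
have pD0 : 0 <= pi * Delta by rewrite mulr_ge0 ?pi_ge0// ltW.
have [L HL] := ell_bound.
have [k1 [k1E k1c k1i k1I]] := half_plane_residue pD0 fD fB fL2 ell_cder HL ell0.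
pose f' z := f (- z).
have f'D z : exists d, cder f' z d.
  have [d Hd] := fD (- z); exists (d * (- 1)).
  by apply: cder_comp Hd _; apply: cderN; exact: cder_id.
have f'B (e : R) : 0 < e -> exists A, forall z, cnorm (f' z) <= A * expR ((pi * Delta + e) * cnorm z).
  by move=> /fB[A HA]; exists A => z; rewrite -[cnorm z]cnormN; exact: HA.
have fr x : rcont (fun x => f x%:C) x.
  apply: (rcont_comp (f := f)); last exact: rcont_id.
  by have [d Hd] := fD x%:C; exact: cder_cont Hd.
have f'L2 : leb.-integrable setT (fun x => (cnorm (f' x%:C) ^+ 2)%:E).
  have E : (fun x : R => (cnorm (f' x%:C) ^+ 2)%:E) = (fun x : R => (cnorm (f (- x)%:C) ^+ 2)%:E).
    by apply/funext => x; rewrite /f' rmorphN.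
  rewrite E; exact: (integrable_opp (f := fun x : R => cnorm (f x%:C) ^+ 2)).
have [k2 [k2E k2c k2i k2I]] := half_plane_residue pD0 f'D f'B f'L2 ell_cder HL ell0.
pose P x := f x%:C * G (freq x%:C) * nuh (freq x%:C).
pose a := f 0 / pi%:C.
have Pc x : rcont P x.
  by apply: rcontM; [apply: rcontM => //; exact: transform_freq_rcont|exact: nuh_freq_rcont].
have Pi : cintegrable leb setT P.
  have [N N0 HN] := nuh_bounded; have [N' N'0 HN'] := transform_decay.
  pose bd (x : R) : R := N * (cnorm (f x%:C) ^+ 2 + N' * cauchy_weight x).
  apply: (@cintegrable_dom _ _ _ leb setT measurableT _ bd).
  - by apply: rcont_cmeasurable.
  - have i1 : leb.-integrable setT (fun x => (cnorm (f x%:C) ^+ 2 + N' * cauchy_weight x)%:E).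
      apply: (@integrableD _ _ _ leb setT measurableT (fun x => (cnorm (f x%:C) ^+ 2)%:E)
        (fun x => (N' * cauchy_weight x)%:E)) => //.
      exact: (integrableZl measurableT _ (cauchy_weight_integrable R)).
    exact: (integrableZl measurableT N i1).
  move=> x _; rewrite cnormM /bd mulrC; apply: ler_pM; rewrite ?cnorm_ge0//.
  rewrite cnormM; apply: (@le_trans _ _ (cnorm (f x%:C) ^+ 2 + cnorm (G (freq x%:C)) ^+ 2)).
    have := sqr_ge0 (cnorm (f x%:C) - cnorm (G (freq x%:C))).
    have := sqr_ge0 (cnorm (f x%:C)); have := sqr_ge0 (cnorm (G (freq x%:C))).
    by move: (cnorm _) (cnorm _) => u v; rewrite sqrrB !mulr2n; lra.
  by rewrite lerD2l.
(* The weight carries the subtracted poles of both halves, so [S] is the sum of two functions whose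
   integrals vanish; integrating the weight then gives [a * pi], that is [f 0]. *)
pose S x := P x - a * (cauchy_weight x)%:C.
have Si : cintegrable leb setT S by apply: cintegrableB => //; exact: cauchy_weight_cintegrable.
have Sc x : rcont S x.
  apply: rcontB => //; apply: rcontM; first exact: rcont_cst.
  by apply: rcont_real; exact: cauchy_weight_cont.
have k2c' x : rcont (fun x => k2 (- x)%:C) x.
  have : ctends (nbhs (- x)) (fun x => k2 x%:C) (k2 (- x)%:C) by exact: k2c.
  have nN : - y @[y --> x] --> (- x : R) by apply: cvgN; exact: cvg_id.
  by move=> [u v]; split; [exact: (cvg_comp _ _ nN u)|exact: (cvg_comp _ _ nN v)].
have SE x : x != 0 -> S x = k1 x%:C + k2 (- x)%:C.
  move=> x0; have [s0 t0] := freq_shift x.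
  have xC : x%:C != 0 :> C by rewrite real_complex_eq0.
  have rN : (- x)%:C = - x%:C :> C by rewrite rmorphN.
  have xN : (- x)%:C != 0 :> C by rewrite rN oppr_eq0.
  rewrite /S /P -mulrA nuh_expint ?freq_neq0//.
  have := k1E x%:C; rewrite ellE// => e1.
  have := k2E (- x)%:C; rewrite ellE// /f' rN freqN oppr0 opprK => e2.
  have r1 : x%:C - 'i != 0 by apply/eqP => /(congr1 (@complex.Im R)) /= /eqP; rewrite sub0r oppr_eq0 oner_eq0.
  have r2 : - x%:C - 'i != 0 by apply/eqP => /(congr1 (@complex.Im R)) /= /eqP; rewrite oppr0 sub0r oppr_eq0 oner_eq0.
  have w0 : (cauchy_weight x)%:C = - ((x%:C - 'i) * (- x%:C - 'i))^-1.
    have ii := mulii R.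
    have -> : (x%:C - 'i) * (- x%:C - 'i) = - (1 + x ^+ 2)%:C.
      have -> : (x%:C - 'i) * (- x%:C - 'i) = - (x%:C ^+ 2 - 'i * 'i) by ring.
      by rewrite ii opprK addrC rmorphD rmorphXn rmorph1.
    by rewrite invrN opprK /cauchy_weight fmorphV.
  have pC : pi%:C != 0 :> C by rewrite real_complex_eq0 gt_eqF// pi_gt0.
  have p2 : (2 * pi)%:C = 2 * pi%:C :> C by rewrite rmorphM rmorph_nat.
  apply: (mulfI xC).
  have -> : x%:C * (k1 x%:C + k2 (- x%:C)) = x%:C * k1 x%:C - (- x%:C * k2 (- x%:C)) by ring.
  rewrite e1 e2 w0 /a p2.
  rewrite (mulNr (freq x%:C)); apply: residue_identity => //; exact: freq_neq0.
have SE' x : S x = k1 x%:C + k2 (- x)%:C.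
  have [->|x0] := eqVneq x 0; last exact: SE.
  by apply: (rcont_eq0 (g := fun x => k1 x%:C + k2 (- x)%:C)) => //; exact: rcontD.
(* Integrability of the reflected function is read off from the two other terms of [SE']. *)
have k2i' : cintegrable leb setT (fun x => k2 (- x)%:C).
  apply: (@eq_cintegrable _ _ _ leb setT measurableT (fun x => S x - k1 x%:C)).
    by move=> x _; rewrite SE'; ring.
  exact: cintegrableB.
have k2I' : cintegral leb setT (fun x => k2 (- x)%:C) = 0.
  rewrite cintegral_line// -k2I cintegral_line// addrC; congr (_ + _).
  by apply: eq_cintegral => x _; rewrite opprK.
have SI : cintegral leb setT S = 0.
  rewrite (@eq_cintegral _ _ _ leb setT S (fun x => k1 x%:C + k2 (- x)%:C)) => [|x _]; last exact: SE'.
  by rewrite cintegralD// k1I k2I' addr0.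
move: SI; rewrite /S cintegralB//; last exact: cauchy_weight_cintegrable.
rewrite cintegral_cauchy_weight /a divfK => [|]; last first.
  by rewrite real_complex_eq0 gt_eqF// pi_gt0.
by move/eqP; rewrite subr_eq0 => /eqP.
Qed.

(** * The measure and the Hilbert space *)

Section Measure.
Variable nu : {measure set (measurableTypeR R) -> \bar R}.
Hypothesis hnu : is_dirac_plus_density Delta c1 c2 c3 nu.

Local Notation D := (`[- Delta, Delta]%classic : set (measurableTypeR R)).
Let mD : measurable D. Proof. exact: measurable_itv. Qed.

Let lkernel_integrable (g : R -> R) : continuous g ->
  leb.-integrable D (EFin \o (fun x => lkernel c3 x * g x)).
Proof. by move=> cg; apply: cont_integrable => x _; apply: cvgM; [exact: lkernel_cont|exact: cg]. Qed.

Lemma ge0_Rintegral_nu (g : R -> R) : continuous g -> (forall x, 0 <= g x) ->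
  nu.-integrable setT (EFin \o g) /\
  (\int[nu]_x g x)%R = c1 * g 0 + c2 * (\int[leb]_(x in D) (lkernel c3 x * g x))%R.
Proof.
move=> cg g0.
have mg : measurable_fun (setT : set (measurableTypeR R)) g by exact: continuous_measurable_fun.
pose w (x : R) := c2 * lkernel c3 x.
have mw : measurable_fun D w.
  apply: measurable_funTS; apply: continuous_measurable_fun => x.
  by apply: cvgM; [exact: cvg_cst|exact: lkernel_cont].
have w0 x : 0 <= w x by rewrite mulr_ge0 ?(ltW hc2)// mulr_ge0 ?expR_ge0.
have nuE (A : set (measurableTypeR R)) : measurable A ->
    nu A = (c1%:E * \d_(0%R : measurableTypeR R) A + \int[leb]_(x in A `&` D) (w x)%:E)%E.
  move=> mA; rewrite hnu//; congr (_ + _)%E; apply: eq_integral => x _.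
  by rewrite /w /lkernel mulrA.
have E := ge0_integral_density mD mw w0 (ltW hc1) nuE mg g0.
have iw : leb.-integrable D (EFin \o (fun x => w x * g x)).
  have := integrableZl mD c2 (lkernel_integrable cg).
  by apply: eq_integrable => // x _ /=; rewrite /w -EFinM mulrA.
have {}E : (\int[nu]_x (g x)%:E = (c1 * g 0 + c2 * \int[leb]_(x in D) (lkernel c3 x * g x))%:E)%E.
  rewrite E EFinD; congr (_ + _)%E.
  rewrite -(RintegralZl _ mD (lkernel_integrable cg)).
  rewrite -[LHS]fineK; last exact: (integrable_fin_num mD iw).
  congr EFin; apply: eq_Rintegral => x _; by rewrite /w mulrA.
split; last by rewrite /Rintegral E.
apply/integrableP; split; first exact/measurable_EFinP.
under eq_integral do rewrite /= ger0_norm//.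
by rewrite E ltry.
Qed.

Lemma Rintegral_nu (g : R -> R) : continuous g -> (forall x, `|g x| <= 1) ->
  (\int[nu]_x g x)%R = c1 * g 0 + c2 * (\int[leb]_(x in D) (lkernel c3 x * g x))%R.
Proof.
move=> cg g1.
(* Adding 1 makes the bounded function nonnegative; the constant is subtracted again by the same
   formula, [nu] having finite mass. *)
have cg1 : continuous (fun x => g x + 1) by move=> x; apply: cvgD; [exact: cg|exact: cvg_cst].
have g10 x : 0 <= g x + 1 by have := g1 x; rewrite ler_norml => /andP[+ _]; lra.
have c1' : continuous ((fun=> 1) : R -> R) by move=> x; exact: cvg_cst.
have [i1 I1] := ge0_Rintegral_nu cg1 g10.
have [i2 I2] := ge0_Rintegral_nu c1' (fun=> ler01).
have -> : (\int[nu]_x g x)%R = (\int[nu]_x (g x + 1))%R - (\int[nu]_x (1 : R))%R.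
  by rewrite -RintegralB//; apply: eq_Rintegral => x _; rewrite addrK.
rewrite I1 I2.
have -> : (\int[leb]_(x in D) (lkernel c3 x * g x))%R =
    (\int[leb]_(x in D) (lkernel c3 x * (g x + 1)))%R - (\int[leb]_(x in D) (lkernel c3 x * 1))%R.
  rewrite -(RintegralB mD (lkernel_integrable cg1) (lkernel_integrable c1')).
  by apply: eq_Rintegral => x _ /=; ring.
ring.
Qed.

Lemma fourierE (x : R) : fourier nu x = nuh (freq x%:C).
Proof.
pose e (a : R) := cexp (freq x%:C * a%:C).
have eE a : cexp (0 +i* (- (2 * pi * x * a))) = e a.
  by congr cexp; apply: complexP; rewrite /freq !ReImE /=; ring.
have ec a : rcont e a by exact: rcont_cexpM.
have e1 a : cnorm (e a) = 1.
  by rewrite cnorm_cexp ReM Re_freq_real /= mul0r mulr0 subr0 expR0.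
have E : fourier nu x = cintegral nu setT e.
  by apply: eq_cintegral => a _; exact: eE.
have e0 : e 0 = 1 by rewrite /e mulr0 cexp0.
rewrite E; apply: complexP.
  transitivity (\int[nu]_a Re (e a))%R => //.
  rewrite Rintegral_nu; first last.
  - by move=> a; rewrite -[leRHS](e1 a); exact: normRe_le.
  - by move=> a; have [] := ec a.
  rewrite e0 /nuh ReD ReM [Re c1%:C]/= [Re c2%:C]/= [Im c2%:C]/= mul0r subr0 mulr1.
  congr (_ + _ * _); apply: (@eq_Rintegral _ _ _ leb D (fun a => Re ((lkernel c3 a)%:C * e a))) => a _.
  by rewrite ReM [Im (lkernel _ _)%:C]/= mul0r subr0.
transitivity (\int[nu]_a Im (e a))%R => //.
rewrite Rintegral_nu; first last.
- by move=> a; rewrite -[leRHS](e1 a); exact: normIm_le.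
- by move=> a; have [] := ec a.
rewrite e0 /nuh ImD ImM [Im c1%:C]/= [Re c2%:C]/= [Im c2%:C]/= mul0r addr0 mulr0.
congr (_ + _ * _); apply: (@eq_Rintegral _ _ _ leb D (fun a => Im ((lkernel c3 a)%:C * e a))) => a _.
by rewrite ImM [Im (lkernel _ _)%:C]/= mul0r addr0.
Qed.

Local Notation H := (Hspace nu Delta).

Lemma normcE (z : C) : `|z| = (cnorm z)%:C.
Proof. by []. Qed.

Lemma cnorm_conj (z : C) : cnorm z^*%C = cnorm z.
Proof. by case: z => a b; rewrite /cnorm /ComplexField.Normc.normc /= sqrrN. Qed.

Lemma Hspace_cder (f : C -> C) : H f -> forall z, exists d, cder f z d.
Proof. by move=> [ef _ _] z; apply/derivableP_cder; exact: ef. Qed.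

Lemma Hspace_type (f : C -> C) : H f -> forall e : R, 0 < e ->
  exists A, forall z, cnorm (f z) <= A * expR ((pi * Delta + e) * cnorm z).
Proof.
move=> [_ tf _] e /tf[A HA]; exists A => z.
by have := HA z; rewrite normcE lecR.
Qed.

Lemma Hspace_rcont (f : C -> C) : H f -> forall x, rcont (fun x => f x%:C) x.
Proof.
move=> Hf x; apply: (rcont_comp (f := f)); last exact: rcont_id.
by have [d Hd] := Hspace_cder Hf x%:C; exact: cder_cont Hd.
Qed.

Lemma norm_sqr_fourier (z : C) (x : R) :
  `|z| ^+ 2 * fourier nu x = (cnorm z ^+ 2 * Re (nuh (freq x%:C)))%:C.
Proof. by rewrite fourierE nuh_real normcE [RHS]rmorphM rmorphXn. Qed.

(** Outside [[- X, X]] the weight is at least c1 / 2, so the weighted integrand dominates there;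
    inside, a continuous function is bounded. *)
Lemma Hspace_L2 (f : C -> C) : H f -> leb.-integrable setT (fun x => (cnorm (f x%:C) ^+ 2)%:E).
Proof.
move=> Hf; have fr := Hspace_rcont Hf; have [_ _ [fi _]] := Hf.
have [X X0 HX] := nuh_lower.
have [W W0 HW] := rcont_bounded (- X) X fr.
have {}fi : leb.-integrable setT (fun x => (cnorm (f x%:C) ^+ 2 * Re (nuh (freq x%:C)))%:E).
  by apply: eq_integrable fi => // x _; rewrite norm_sqr_fourier.
pose bd (x : R) : R := 2 / c1 * `|cnorm (f x%:C) ^+ 2 * Re (nuh (freq x%:C))| +
  W ^+ 2 * (1 + X ^+ 2) * cauchy_weight x.
have bi : leb.-integrable setT (EFin \o bd).
  apply: (@integrableD _ _ _ leb setT measurableT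
    (fun x => (2 / c1 * `|cnorm (f x%:C) ^+ 2 * Re (nuh (freq x%:C))|)%:E)
    (fun x => (W ^+ 2 * (1 + X ^+ 2) * cauchy_weight x)%:E)) => //.
    exact: (integrableZl measurableT (2 / c1) (integrable_abse fi)).
  exact: (integrableZl measurableT _ (cauchy_weight_integrable R)).
apply: (le_integrable measurableT _ _ bi).
  apply/measurable_EFinP; apply: continuous_measurable_fun => x.
  by rewrite /= ; under eq_fun do rewrite expr2; apply: cvgM; exact: ctends_cnorm (fr x).
move=> x _; have cw := cauchy_weight_gt0 x.
have q0 := sqr_ge0 (cnorm (f x%:C)).
have b0 : 0 <= 2 / c1 * `|cnorm (f x%:C) ^+ 2 * Re (nuh (freq x%:C))|.
  by rewrite mulr_ge0// divr_ge0// ltW.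
have d0 : 0 <= W ^+ 2 * (1 + X ^+ 2) * cauchy_weight x.
  by apply: mulr_ge0; [apply: mulr_ge0; rewrite ?addr_ge0 ?sqr_ge0|exact: ltW].
rewrite lee_fin ger0_norm// [leRHS]ger0_norm ?addr_ge0//.
have [xX|xX] := leP `|x| X.
  apply: (@le_trans _ _ (W ^+ 2 * (1 + X ^+ 2) * cauchy_weight x)); last by rewrite /bd lerDr.
  apply: (@le_trans _ _ (W ^+ 2)).
    by rewrite ler_pXn2r ?nnegrE ?cnorm_ge0// HW// -ler_norml.
  rewrite -mulrA ler_peMr ?sqr_ge0// /cauchy_weight ler_pdivlMr ?mul1r ?ltr_pwDl ?sqr_ge0//.
  by rewrite lerD2l -(real_normK (num_real x)) ler_pXn2r ?nnegrE ?(ltW X0).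
have n0 := HX x (ltW xX).
apply: (@le_trans _ _ (2 / c1 * `|cnorm (f x%:C) ^+ 2 * Re (nuh (freq x%:C))|)); last by rewrite /bd lerDl.
rewrite normrM [X in _ <= _ * (X * _)]ger0_norm// mulrCA ler_peMr//.
rewrite -invf_div ler_pdivlMl ?divr_gt0// mulr1 (le_trans n0)//.
exact: ler_norm.
Qed.

Lemma transform_Hspace : H (fun z => G (freq z)).
Proof.
have [W W0 HW] := expint_bound h_ge0 phic.
have cD z : exists d, cder (fun z => G (freq z)) z d.
  eexists; apply: (cder_comp (f := G)); first exact: expint_cder.
  exact: cder_linear.
split.
- by move=> z; apply/derivableP_cder; exact: cD.
- move=> e e0; exists W => z; rewrite !normcE lecR; apply: le_trans (HW _) _.
  rewrite ler_wpM2l// ler_expR Re_freq normrM (ger0_norm (ltW pi2)).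
  apply: (@le_trans _ _ (pi * Delta * cnorm z)).
    have -> : h * (2 * pi * `|Im z|) = pi * Delta * `|Im z| by field.
    by rewrite ler_wpM2l ?normIm_le// mulr_ge0 ?pi_ge0// ltW.
  by rewrite ler_wpM2r ?cnorm_ge0// lerDl ltW.
have [N N0 HN] := nuh_bounded; have [N' N'0 HN'] := transform_decay.
apply: (@cintegrable_dom _ _ _ leb setT measurableT _ (fun x => N' * N * cauchy_weight x)).
- rewrite /=; under eq_fun do rewrite norm_sqr_fourier.
  apply: rcont_cmeasurable => // x; apply: rcont_real; apply: cvgM.
    by under eq_fun do rewrite expr2; apply: cvgM; exact: ctends_cnorm (transform_freq_rcont x).
  by have [] := nuh_freq_rcont x.
- exact: (integrableZl measurableT _ (cauchy_weight_integrable R)).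
move=> x _; rewrite norm_sqr_fourier cnormR normrM ger0_norm ?sqr_ge0//.
rewrite [leRHS]mulrAC; apply: ler_pM; rewrite ?sqr_ge0//.
by apply: le_trans (normRe_le _) _; exact: HN.
Qed.

Lemma cder_conj (f : C -> C) (z d : C) : cder f z^*%C d -> cder (fun w => (f w^*%C)^*%C) z d^*%C.
Proof.
move=> [q [E qd cq]]; exists (fun w => (q w^*%C)^*%C); split.
- by move=> w; rewrite E rmorphD rmorphM rmorphB /= !conjcK.
- by rewrite qd.
- apply: (ccont_comp (f := fun w => w^*%C)); first exact: ccont_conj.
  by apply: (ccont_comp (f := q)) => //; exact: ccont_conj.
Qed.

Lemma kernel_value (K : C -> C -> C) : reproducing_kernel nu Delta K -> K 0 0 = K0.
Proof.
move=> [KH KR]; have k0 := KH 0; set f := K 0 in k0 *.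
(* By reproduction [f 0] is the squared norm of [f], and the weight is real, so the imaginary part
   of the integrand is 0. *)
have real0 : (f 0)^*%C = f 0.
  suff : Im (f 0) = 0 by case: (f 0) => a b /= ->; rewrite oppr0.
  rewrite (KR f 0 k0) /inner.
  rewrite (@eq_cintegral _ _ _ leb setT _ (fun x => (cnorm (f x%:C) ^+ 2 * Re (nuh (freq x%:C)))%:C)).
    by rewrite cintegralE /= /Rintegral integral0.
  move=> x _; rewrite -norm_sqr_fourier; congr (_ * _).
  by rewrite -/f -normCK.
(* The conjugate of [f] occurs in the inner product. This is the entire function that agrees with it
   on the real line, as [transform_reproducing] requires. *)
pose g z := (f z^*%C)^*%C.
have gR (x : R) : g x%:C = (f x%:C)^*%C by rewrite /g conjc_real.
have E : cintegral leb setT (fun x => g x%:C * G (freq x%:C) * nuh (freq x%:C)) = g 0.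
  apply: transform_reproducing.
  - by move=> z; have [d Hd] := Hspace_cder k0 z^*%C; exists d^*%C; exact: cder_conj.
  - move=> e /(Hspace_type k0)[A HA]; exists A => z.
    by rewrite /g cnorm_conj -[cnorm z]cnorm_conj; exact: HA.
  - apply: eq_integrable (Hspace_L2 k0) => // x _.
    by rewrite gR cnorm_conj.
have g0 : g 0 = f 0 by rewrite /g conjc0 real0.
have F0 := KR _ 0 transform_Hspace.
rewrite -/f -g0 -E.
have -> : K0 = G (freq 0).
  case: Hphi => _ _ _ <-; rewrite /freq mulr0; apply: eq_cintegral => x _.
  by rewrite mul0r cexp0 mulr1.
rewrite F0; apply: eq_cintegral => x _.
by rewrite fourierE gR -/f (mulrC (_^*)%C).
Qed.

End Measure.

End FourierSide.

End IntegralEquation.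

Theorem theorem5 (R : realType) (Delta c1 c2 c3 : R)
    (hDelta : 0 < Delta) (hc1 : 0 < c1) (hc2 : 0 < c2) (hc3 : 0 < c3)
    (hsmall : c2 / c1 * Delta ^+ 2 <= 5 / 3)
    (nu : {measure set (measurableTypeR R) -> \bar R})
    (hnu : is_dirac_plus_density Delta c1 c2 c3 nu)
    (K : R[i] -> R[i] -> R[i]) (hK : reproducing_kernel nu Delta K)
    (eta1 eta2 : R[i])
    (hroots : ('X - eta1%:P) * ('X - eta2%:P) %| quartic c1 c2 c3)
    (hsum : eta1 + eta2 != 0) :
  (eta1 != eta2 ->
     detAB Delta c1 c2 c3 eta1 eta2 != 0 /\
     K 0 0 = kernel_formula Delta c1 c2 c3 eta1 eta2) /\
  (eta1 = eta2 ->
     (\forall p \near within [set p | p.1 != p.2] (nbhs (eta1 : R[i]^o, eta2 : R[i]^o)),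
        detAB Delta c1 c2 c3 p.1 p.2 != 0) /\
     kernel_formula Delta c1 c2 c3 p.1 p.2
       @[p --> within [set p | p.1 != p.2] (nbhs (eta1 : R[i]^o, eta2 : R[i]^o))]
       --> (K 0 0 : R[i]^o)).
Proof.
have [q1 q2] := quartic_factor hroots.
split=> [ne|E].
  have [det0 [phi Hphi]] := solution_distinct hDelta hc1 hc2 hc3 hsmall q1 q2 (root_neq ne hsum).
  by split=> //; exact: (kernel_value hDelta hc1 hc2 hc3 Hphi hnu hK).
rewrite -E in hroots q2 *.
have e0 : eta1 != 0 by exact: (quart_root_neq0 hc1 hc2 hc3 q1).
have [_ qd] := quart_double hroots e0.
have [W0 [phi Hphi]] := solution_double hDelta hc1 hc2 hc3 hsmall q1 qd.
rewrite (kernel_value hDelta hc1 hc2 hc3 Hphi hnu hK).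
exact: kernel_formula_cvg.
Qed.
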